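(* Consider the curved rarefaction wave associated with $u-c$ in the generalized Riemann problem for the compressible Euler equations (without source term). The interaction of kinematic-thermodynamic variables is described by the linear relation $$a_L\left(\frac{D_0u}{Dt}\right)_*+b_L\left(\frac{D_0p}{Dt}\right)_*=d_L,\qquad (a_L,b_L)=\left(1,\frac{1}{\rho_{1*}c_{1*}}\right),$$ where, for a generic equation of state, $$d_L=\frac{c_L}{2}K(\rho_{1*},s_L)\,s_L'\,\Pi^{-2}(c;\beta_*,\beta_L)+\frac12\Pi^{-1}(c;\beta_*,\beta_L)\bigl(-2c_L\psi_L'+c_LK(\rho_L,s_L)s_L'\bigr)+\frac12\Pi^{-1}(c;\beta_*,\beta_L)\int_{\beta_L}^{\beta_*}\frac{1}{2c(0,\xi)}\,\Pi(c;\xi,\beta_L)\,H(0,\xi)\,d\xi,$$ with $H=cK(\rho,s)\frac{\partial s}{\partial x}$; and for polytropic gases with index $\gamma>1$, writing $\theta=c(0,\beta_* )/c_L$ and $\mu^2=\frac{\gamma-1}{\gamma+1}$, $$d_L=\left[\frac{1+\mu^2}{1+2\mu^2}\,\theta^{1/(2\mu^2)}+\frac{\mu^2}{1+2\mu^2}\,\theta^{(1+\mu^2)/\mu^2}\right]T_Ls_L'-c_L\,\theta^{1/(2\mu^2)}\,\psi_L'.$$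
   Context: Consider the one-dimensional compressible Euler equations $\mathbf u_t+\mathbf f(\mathbf u)_x=0$ with $\mathbf u=(\rho,\rho u,\rho E)^\top$, $\mathbf f(\mathbf u)=(\rho u,\rho u^2+p,u(\rho E+p))^\top$, $E=\frac{u^2}{2}+e$; $\rho,u,p$ are density, velocity, pressure. The internal energy $e$, temperature $T$ and entropy $s$ obey the Gibbs relation $T\,ds=de-\frac{p}{\rho^2}\,d\rho$. The sound speed $c>0$ is defined by $c^2=\partial p(\rho,s)/\partial\rho$. A polytropic gas has $p=A(s)\rho^\gamma$, $c^2=\gamma p/\rho$, $e=\frac{p}{(\gamma-1)\rho}$ proportional to $T$. Generalized Riemann problem (GRP): the initial data at $t=0$ are polynomial (smooth) on each side of $x=0$, with one-sided limits $\mathbf u_L,\mathbf u_R$ and one-sided first derivatives $\mathbf u_L',\mathbf u_R'$ at $x=0^\mp$; subscript $L$ denotes limits from the left and primes denote $x$-derivatives (also for other flow variables, e.g. $T_Ls_L'=e_L'-\frac{p_L}{\rho_L^2}\rho_L'$). The solution is assumed piecewise smooth near the origin (smooth up to the origin in each region between waves), away from vacuum. As $t\to0+$ along each ray $x=at$ it tends to the self-similar solution $R^A(a;\mathbf u_L,\mathbf u_R)$ of the classical Riemann problem with data $\mathbf u_L,\mathbf u_R$. The wave pattern is: a (curved) rarefaction wave associated with $u-c$ moving to the left, a contact discontinuity in the middle, a shock associated with $u+c$ moving to the right, with the $t$-axis inside the intermediate region between the rarefaction wave and the shock. $\rho_{1*},c_{1*}$ are the density and sound speed of the Riemann solution immediately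 to the left of the contact discontinuity (between rarefaction and contact); the entropy of that state is $s_L$ since the Riemann rarefaction is isentropic. The material derivative is $\frac{D_0}{Dt}=\frac{\partial}{\partial t}+u\frac{\partial}{\partial x}$, and $(\cdot)_*$ denotes the limiting value at $x=0$ as $t\to0+$. Kinematic-thermodynamic variable: $$\psi=u+\int^{\rho}\frac{c(\omega,s)}{\omega}\,d\omega,\qquad d\psi=du+\frac{1}{\rho c}\,dp+K(\rho,s)\,ds,\qquad K(\rho,s)=-\frac{1}{\rho c}\frac{\partial p}{\partial s}+\int^{\rho}\frac{1}{\omega}\frac{\partial c(\omega,s)}{\partial s}\,d\omega,$$ with one fixed reference lower limit in both integrals. For polytropic gases $\psi=u+\frac{2c}{\gamma-1}$ and $K=T/c$. Characteristic coordinates: inside the rarefaction wave, $\alpha(x,t)=$ const and $\beta(x,t)=$ const are the integral curves of $\frac{dx}{dt}=u+c$ and $\frac{dx}{dt}=u-c$, respectively. The origin corresponds to $\alpha=0$ (with $t(0,\beta)=0$), and $\beta$ is normalized as the wave speed at the origin, $(u-c)(0,\beta)=\beta$; $\beta_L=u_L-c_L$ and $\beta_*$ are the speeds of the wave head and of the wave tail at the origin. Flow variables and their $x$-derivatives are regarded as functions of $(\alpha,\beta)$; $(0,\beta)$ denotes the limit $\alpha\to0$ at fixed $\beta$ (for $u,\rho,p,c$ it is the associated centered Riemann rarefaction). The $\alpha$-derivatives of $u\pm c$, of $c\,s_x$ and of $H$ are bounded near $\alpha=0$ inside the wave, and $\frac{\partial t}{\partial\alpha}(0,\beta)\neq0$.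 Finally, $$\Pi(c;\beta,\beta_L):=\exp\left[\int_{\beta_L}^{\beta}\frac{1}{2c(0,\xi)}\,d\xi\right].$$ *)

(* Defs.v *)
From Stdlib Require Import Reals.
From Coquelicot Require Import Coquelicot.

Open Scope R_scope.

Definition d1 (f : R -> R -> R) (x y : R) : R := Derive (fun z => f z y) x.
Definition d2 (f : R -> R -> R) (x y : R) : R := Derive (fun z => f x z) y.

(* Limit of [f] at [(x, y)] along the points of [D]; [(x, y)] itself need not
   belong to [D]. *)
Definition lim_in (D : R -> R -> Prop) (f : R -> R -> R) (x y l : R) : Prop :=
  filterlim (fun z : R * R => f (fst z) (snd z))
    (within (fun z : R * R => D (fst z) (snd z)) (locally (x, y)))
    (locally l).

(* [f] is C^1 in the open set [D] and [f], with its first derivatives, extends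
   continuously to [D']; in use, [D'] is the closure of [D], up to artificial
   outer boundaries. *)
Definition C1_up_to (D D' : R -> R -> Prop) (f : R -> R -> R) : Prop :=
  (forall x y, D x y -> ex_diff_n f 1 x y) /\
  (forall x y, D' x y -> exists l l1 l2 : R,
     lim_in D f x y l /\ lim_in D (d1 f) x y l1 /\ lim_in D (d2 f) x y l2).

(** * Equation of state *)

(* Density, velocity and entropy are the primary variables; pressure, specific
   internal energy and temperature are functions of (density, entropy). *)
Record state := State { rho : R; vel : R; ent : R }.

Record eos := Eos {
  pr : R -> R -> R;
  en : R -> R -> R;
  temp : R -> R -> R }.

Record eos_ok (g : eos) : Prop := {
  pr_C2 : forall r s, 0 < r -> ex_diff_n (pr g) 2 r s;
  en_C1 : forall r s, 0 < r -> ex_diff_n (en g) 1 r s;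
  (* Gibbs relation T ds = de - (p / rho^2) drho *)
  gibbs_rho : forall r s, 0 < r -> d1 (en g) r s = pr g r s / r ^ 2;
  gibbs_ent : forall r s, 0 < r -> d2 (en g) r s = temp g r s;
  temp_pos : forall r s, 0 < r -> 0 < temp g r s;
  pr_incr : forall r s, 0 < r -> 0 < d1 (pr g) r s }.

Definition sound (g : eos) (r s : R) : R := sqrt (d1 (pr g) r s).

Definition polytropic (g : eos) (gamma : R) : Prop :=
  exists (A : R -> R) (cv : R), 0 < cv /\
    forall r s, 0 < r ->
      pr g r s = A s * Rpower r gamma /\
      en g r s = pr g r s / ((gamma - 1) * r) /\
      en g r s = cv * temp g r s.

Definition pressure (g : eos) (U : state) : R := pr g (rho U) (ent U).
Definition csound (g : eos) (U : state) : R := sound g (rho U) (ent U).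
Definition energy (g : eos) (U : state) : R :=
  vel U ^ 2 / 2 + en g (rho U) (ent U).

(** * Kinematic-thermodynamic variable *)

(* The common lower limit of the two integrals defining psi and K: a positive
   density, or vacuum, where the integrals are improper. *)
Inductive lower_limit := Density (r0 : R) | Vacuum.

Definition lower_filter (b : lower_limit) : (R -> Prop) -> Prop :=
  match b with
  | Density r0 => at_point r0
  | Vacuum => at_right 0
  end.

Definition sound_int (g : eos) (b : lower_limit) (r s : R) : R :=
  RInt_gen (fun o => sound g o s / o) (lower_filter b) (at_point r).

Definition sound_ent_int (g : eos) (b : lower_limit) (r s : R) : R :=
  RInt_gen (fun o => / o * d2 (sound g) o s) (lower_filter b) (at_point r).

(* For a positive reference density, convergence and differentiation under the
   integral sign are automatic; for the vacuum they are the conditions under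
   which psi is defined and d psi = du + dp / (rho c) + K ds holds. *)
Definition admissible (g : eos) (b : lower_limit) : Prop :=
  match b with
  | Density r0 => 0 < r0
  | Vacuum => forall r s, 0 < r ->
      ex_RInt_gen (fun o => sound g o s / o) (at_right 0) (at_point r) /\
      ex_RInt_gen (fun o => / o * d2 (sound g) o s) (at_right 0) (at_point r) /\
      is_derive (fun s' => sound_int g Vacuum r s') s (sound_ent_int g Vacuum r s) /\
      continuity_2d_pt (sound_ent_int g Vacuum) r s
  end.

Definition psi (g : eos) (b : lower_limit) (U : state) : R :=
  vel U + sound_int g b (rho U) (ent U).

Definition Kfun (g : eos) (b : lower_limit) (r s : R) : R :=
  - (/ (r * sound g r s) * d2 (pr g) r s) + sound_ent_int g b r s.

Definition psi_poly (g : eos) (gamma : R) (U : state) : R :=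
  vel U + 2 * csound g U / (gamma - 1).

(** * Euler equations *)

Inductive law := Mass | Momentum | Energy.

Definition density (g : eos) (k : law) (U : state) : R :=
  match k with
  | Mass => rho U
  | Momentum => rho U * vel U
  | Energy => rho U * energy g U
  end.

Definition flux (g : eos) (k : law) (U : state) : R :=
  match k with
  | Mass => rho U * vel U
  | Momentum => rho U * vel U ^ 2 + pressure g U
  | Energy => vel U * (rho U * energy g U + pressure g U)
  end.

Definition euler_on (g : eos) (D : R -> R -> Prop) (w : R -> R -> state) : Prop :=
  forall k x t, D x t ->
    d2 (fun y h => density g k (w y h)) x t
    + d1 (fun y h => flux g k (w y h)) x t = 0.

(* Rankine-Hugoniot conditions and Lax inequalities of a shock of the family
   u + c; [Ul] is the state behind the shock. *)
Definition shock (g : eos) (Ul Ur : state) (sigma : R) : Prop :=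
  (forall k, flux g k Ur - flux g k Ul = sigma * (density g k Ur - density g k Ul)) /\
  vel Ul < sigma /\
  vel Ur + csound g Ur < sigma < vel Ul + csound g Ul.

(** * Self-similar solution of the associated Riemann problem *)

Section Riemann.

Variables (g : eos) (UL UR : state).
(* [fan b] is the state on the ray x = b t of the centered rarefaction wave,
   [bs] the speed of its tail, [U2] the state between the contact and the
   shock, and [sigma] the speed of the shock. *)
Variables (fan : R -> state) (bs : R) (U2 : state) (sigma : R).

Definition head_speed : R := vel UL - csound g UL.

Record centered_rarefaction : Prop := {
  fan_order : head_speed < bs;
  fan_head : fan head_speed = UL;
  fan_ent : forall b, head_speed <= b <= bs -> ent (fan b) = ent UL;
  fan_pos : forall b, head_speed <= b <= bs -> 0 < rho (fan b);
  fan_speed : forall b, head_speed <= b <= bs ->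
    vel (fan b) - csound g (fan b) = b;
  fan_cont : forall b, head_speed <= b <= bs ->
    continuous (fun x => rho (fan x)) b /\ continuous (fun x => vel (fan x)) b;
  (* isentropic Riemann invariant: du + (c / rho) drho = 0 across the wave *)
  fan_invariant : forall b, head_speed < b < bs ->
    ex_derive (fun x => rho (fan x)) b /\
    is_derive (fun x => vel (fan x)) b
      (- (csound g (fan b) / rho (fan b) * Derive (fun x => rho (fan x)) b)) }.

Record riemann_solution : Prop := {
  rs_pos : 0 < rho UL /\ 0 < rho U2 /\ 0 < rho UR;
  rs_rarefaction : centered_rarefaction;
  rs_contact : vel (fan bs) = vel U2 /\ pressure g (fan bs) = pressure g U2;
  rs_shock : shock g U2 UR sigma }.

(* R^A(a; UL, UR) *)
Definition RA (a : R) : state :=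
  if Rle_dec a head_speed then UL
  else if Rle_dec a bs then fan a
  else if Rlt_dec a (vel U2) then fan bs
  else if Rlt_dec a sigma then U2
  else UR.

End Riemann.

(** * Generalized Riemann problem *)

(* Data describing a solution in the box |x| < [delta], 0 < t < [tau]. *)
Record grp := Grp {
  initL : R -> state;            (* initial data for x < 0 *)
  initR : R -> state;            (* initial data for x > 0 *)
  tau : R;
  delta : R;
  w : R -> R -> state;           (* solution, as a function of x and t *)
  Xhead : R -> R;
  Xtail : R -> R;
  Xcontact : R -> R;
  Xshock : R -> R;
  fan : R -> state;
  bstar : R;
  U2star : state;
  sigma : R;
  eps : R;                       (* characteristic coordinates: 0 <= alpha < eps *)
  xab : R -> R -> R;             (* x as a function of (alpha, beta) *)
  tab : R -> R -> R              (* t as a function of (alpha, beta) *)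
}.

Definition UL (G : grp) : state := initL G 0.
Definition UR (G : grp) : state := initR G 0.
Definition betaL (g : eos) (G : grp) : R := head_speed g (UL G).
Definition U1star (G : grp) : state := fan G (bstar G).

Definition between (G : grp) (a b : R -> R) (x t : R) : Prop :=
  0 < t < tau G /\ a t < x < b t.
Definition between_closed (G : grp) (a b : R -> R) (x t : R) : Prop :=
  0 <= t < tau G /\ a t <= x <= b t.

Definition Dleft (G : grp) := between G (fun _ => - delta G) (Xhead G).
Definition Dwave (G : grp) := between G (Xhead G) (Xtail G).
Definition D1 (G : grp) := between G (Xtail G) (Xcontact G).
Definition D2 (G : grp) := between G (Xcontact G) (Xshock G).
Definition Dright (G : grp) := between G (Xshock G) (fun _ => delta G).

Definition lim_state (D : R -> R -> Prop) (v : R -> R -> state)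
    (x t : R) (U : state) : Prop :=
  lim_in D (fun y h => rho (v y h)) x t (rho U) /\
  lim_in D (fun y h => vel (v y h)) x t (vel U) /\
  lim_in D (fun y h => ent (v y h)) x t (ent U).

Definition lim_state_right (f : R -> state) (U : state) : Prop :=
  filterlim (fun a => rho (f a)) (at_right 0) (locally (rho U)) /\
  filterlim (fun a => vel (f a)) (at_right 0) (locally (vel U)) /\
  filterlim (fun a => ent (f a)) (at_right 0) (locally (ent U)).

Definition continuous_state (v : R -> R -> state) (x t : R) : Prop :=
  continuity_2d_pt (fun y h => rho (v y h)) x t /\
  continuity_2d_pt (fun y h => vel (v y h)) x t /\
  continuity_2d_pt (fun y h => ent (v y h)) x t.

Definition smooth_profile (f : R -> state) : Prop :=
  forall n x, ex_derive_n (fun y => rho (f y)) n x /\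
    ex_derive_n (fun y => vel (f y)) n x /\
    ex_derive_n (fun y => ent (f y)) n x.

Definition smooth_up_to (D D' : R -> R -> Prop) (v : R -> R -> state) : Prop :=
  C1_up_to D D' (fun y h => rho (v y h)) /\
  C1_up_to D D' (fun y h => vel (v y h)) /\
  C1_up_to D D' (fun y h => ent (v y h)).

Definition curve_from_origin (X : R -> R) (slope : R) : Prop :=
  X 0 = 0 /\ filterlim (fun t => X t / t) (at_right 0) (locally slope).

Section GRP.

Variables (g : eos) (G : grp).

Record wave_pattern : Prop := {
  box_pos : 0 < tau G /\ 0 < delta G;
  head_origin : curve_from_origin (Xhead G) (betaL g G);
  tail_origin : curve_from_origin (Xtail G) (bstar G);
  contact_origin : curve_from_origin (Xcontact G) (vel (U1star G));
  shock_origin : curve_from_origin (Xshock G) (sigma G);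
  curve_order : forall t, 0 < t < tau G ->
    - delta G < Xhead G t < Xtail G t /\ Xtail G t < Xcontact G t /\
    Xcontact G t < Xshock G t < delta G;
  axis_intermediate : forall t, 0 < t < tau G -> Xtail G t < 0 < Xshock G t;
  head_curve : forall t, 0 < t < tau G ->
    is_derive (Xhead G) t
      (vel (w G (Xhead G t) t) - csound g (w G (Xhead G t) t)) /\
    continuous_state (w G) (Xhead G t) t;
  tail_curve : forall t, 0 < t < tau G ->
    is_derive (Xtail G) t
      (vel (w G (Xtail G t) t) - csound g (w G (Xtail G t) t)) /\
    continuous_state (w G) (Xtail G t) t;
  (* velocity and pressure, but not density or entropy, are continuous *)
  contact_curve : forall t, 0 < t < tau G ->
    is_derive (Xcontact G) t (vel (w G (Xcontact G t) t)) /\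
    continuity_2d_pt (fun y h => vel (w G y h)) (Xcontact G t) t /\
    continuity_2d_pt (fun y h => pressure g (w G y h)) (Xcontact G t) t;
  shock_curve : forall t, 0 < t < tau G -> exists (Ul Ur : state) (v : R),
    lim_state (D2 G) (w G) (Xshock G t) t Ul /\
    lim_state (Dright G) (w G) (Xshock G t) t Ur /\
    is_derive (Xshock G) t v /\ 0 < rho Ul /\ 0 < rho Ur /\ shock g Ul Ur v }.

Record piecewise_smooth_solution : Prop := {
  no_vacuum : forall x t, 0 < t < tau G -> - delta G < x < delta G ->
    0 < rho (w G x t);
  left_smooth : smooth_up_to (Dleft G)
    (between_closed G (fun _ => - delta G) (Xhead G)) (w G);
  mid1_smooth : smooth_up_to (D1 G)
    (between_closed G (Xtail G) (Xcontact G)) (w G);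
  mid2_smooth : smooth_up_to (D2 G)
    (between_closed G (Xcontact G) (Xshock G)) (w G);
  right_smooth : smooth_up_to (Dright G)
    (between_closed G (Xshock G) (fun _ => delta G)) (w G);
  wave_smooth : forall x t, Dwave G x t ->
    ex_diff_n (fun y h => rho (w G y h)) 2 x t /\
    ex_diff_n (fun y h => vel (w G y h)) 2 x t /\
    ex_diff_n (fun y h => ent (w G y h)) 2 x t;
  euler_left : euler_on g (Dleft G) (w G);
  euler_wave : euler_on g (Dwave G) (w G);
  euler_mid1 : euler_on g (D1 G) (w G);
  euler_mid2 : euler_on g (D2 G) (w G);
  euler_right : euler_on g (Dright G) (w G);
  data_smooth : smooth_profile (initL G) /\ smooth_profile (initR G);
  data_left : forall x, - delta G < x < 0 ->
    lim_state (Dleft G) (w G) x 0 (initL G x);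
  data_right : forall x, 0 < x < delta G ->
    lim_state (Dright G) (w G) x 0 (initR G x) }.

Definition coord_strip (a b : R) : Prop :=
  0 < a < eps G /\ betaL g G < b < bstar G.
Definition coord_strip_closed (a b : R) : Prop :=
  0 <= a < eps G /\ betaL g G <= b <= bstar G.

(* A function of (x, t) read in characteristic coordinates. *)
Definition in_coords (q : R -> R -> R) (a b : R) : R := q (xab G a b) (tab G a b).

Definition alpha_derivative_bounded (q : R -> R -> R) : Prop :=
  exists M d : R, 0 < d /\ forall a b, coord_strip a b -> a < d ->
    ex_derive (fun z => in_coords q z b) a /\ Rabs (d1 (in_coords q) a b) <= M.

(* The coordinates are given through the inverse map (alpha, beta) |-> (x, t),
   with alpha oriented so that it is positive inside the wave. *)
Record characteristic_coordinates : Prop := {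
  eps_pos : 0 < eps G;
  coord_in : forall a b, coord_strip a b -> Dwave G (xab G a b) (tab G a b);
  coord_head : forall a, 0 < a < eps G ->
    0 < tab G a (betaL g G) < tau G /\
    xab G a (betaL g G) = Xhead G (tab G a (betaL g G));
  coord_tail : forall a, 0 < a < eps G ->
    0 < tab G a (bstar G) < tau G /\
    xab G a (bstar G) = Xtail G (tab G a (bstar G));
  coord_inj : forall a b a' b',
    coord_strip_closed a b -> coord_strip_closed a' b' -> 0 < a -> 0 < a' ->
    xab G a b = xab G a' b' -> tab G a b = tab G a' b' -> a = a' /\ b = b';
  coord_cover : exists t0, 0 < t0 <= tau G /\
    forall x t, 0 < t < t0 -> Xhead G t <= x <= Xtail G t ->
    exists a b, 0 < a /\ coord_strip_closed a b /\
      xab G a b = x /\ tab G a b = t;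
  coord_C2 : forall a b, coord_strip a b ->
    ex_diff_n (xab G) 2 a b /\ ex_diff_n (tab G) 2 a b;
  coord_C1_up_to : C1_up_to coord_strip coord_strip_closed (xab G) /\
    C1_up_to coord_strip coord_strip_closed (tab G);
  coord_cont : forall a b, coord_strip_closed a b ->
    lim_in coord_strip (xab G) a b (xab G a b) /\
    lim_in coord_strip (tab G) a b (tab G a b);
  coord_origin : forall b, betaL g G <= b <= bstar G ->
    xab G 0 b = 0 /\ tab G 0 b = 0;
  coord_regular : forall b, betaL g G <= b <= bstar G ->
    exists l, lim_in coord_strip (d1 (tab G)) 0 b l /\ l <> 0;
  (* beta = const: dx/dt = u - c *)
  beta_curve : forall a b, coord_strip a b ->
    d1 (xab G) a b = (vel (w G (xab G a b) (tab G a b))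
                      - csound g (w G (xab G a b) (tab G a b))) * d1 (tab G) a b;
  (* alpha = const: dx/dt = u + c *)
  alpha_curve : forall a b, coord_strip a b ->
    d2 (xab G) a b = (vel (w G (xab G a b) (tab G a b))
                      + csound g (w G (xab G a b) (tab G a b))) * d2 (tab G) a b;
  (* With [fan_speed], this also normalizes beta: (u - c)(0, beta) = beta. *)
  coord_limit : forall b, betaL g G <= b <= bstar G ->
    lim_state_right (fun a => w G (xab G a b) (tab G a b)) (fan G b);
  bounded_plus : alpha_derivative_bounded
    (fun x t => vel (w G x t) + csound g (w G x t));
  bounded_minus : alpha_derivative_bounded
    (fun x t => vel (w G x t) - csound g (w G x t));
  bounded_entropy : alpha_derivative_bounded
    (fun x t => csound g (w G x t) * d1 (fun y h => ent (w G y h)) x t) }.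

Record grp_solution : Prop := {
  grp_riemann : riemann_solution g (UL G) (UR G) (fan G) (bstar G) (U2star G) (sigma G);
  grp_pattern : wave_pattern;
  grp_smooth : piecewise_smooth_solution;
  grp_rays : forall a, a <> vel (U2star G) -> a <> sigma G ->
    lim_state_right (fun t => w G (a * t) t)
      (RA g (UL G) (UR G) (fan G) (bstar G) (U2star G) (sigma G) a);
  grp_coords : characteristic_coordinates }.

Definition material (f : R -> R -> R) (x t : R) : R :=
  d2 f x t + vel (w G x t) * d1 f x t.

(* [l] is the limit as t -> 0+ of the value at x = 0. The value at x = 0 is
   taken as a limit x -> 0 because the contact discontinuity, across which the
   two partial derivatives in D_0/Dt need not exist, may meet the t-axis. *)
Definition axis_limit (f : R -> R -> R) (l : R) : Prop :=
  forall e, 0 < e ->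
    at_right 0 (fun t => locally' 0 (fun x => Rabs (f x t - l) < e)).

Definition Hfun (b : lower_limit) (x t : R) : R :=
  csound g (w G x t) * Kfun g b (rho (w G x t)) (ent (w G x t))
  * d1 (fun y h => ent (w G y h)) x t.

(* [H0] is H(0, .): the limit alpha -> 0+ at fixed beta inside the wave. *)
Definition is_H_origin (b : lower_limit) (H0 : R -> R) : Prop :=
  forall xi, betaL g G < xi < bstar G ->
    filterlim (fun a => in_coords (Hfun b) a xi) (at_right 0) (locally (H0 xi)).

Definition c0 (xi : R) : R := csound g (fan G xi).

Definition Pi (b : R) : R := exp (RInt (fun xi => / (2 * c0 xi)) (betaL g G) b).

Definition dL_generic (b : lower_limit) (H0 : R -> R) : R :=
  let cL := csound g (UL G) in
  let sL := ent (UL G) in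
  let sL' := Derive (fun x => ent (initL G x)) 0 in
  let psiL' := Derive (fun x => psi g b (initL G x)) 0 in
  let bs := bstar G in
  cL / 2 * Kfun g b (rho (U1star G)) sL * sL' * / Pi bs ^ 2
  + / 2 * / Pi bs * (- 2 * cL * psiL' + cL * Kfun g b (rho (UL G)) sL * sL')
  + / 2 * / Pi bs *
    RInt (fun xi => / (2 * c0 xi) * Pi xi * H0 xi) (betaL g G) bs.

Definition dL_polytropic (gamma : R) : R :=
  let cL := csound g (UL G) in
  let TL := temp g (rho (UL G)) (ent (UL G)) in
  let sL' := Derive (fun x => ent (initL G x)) 0 in
  let psiL' := Derive (fun x => psi_poly g gamma (initL G x)) 0 in
  let theta := c0 (bstar G) / cL in
  let mu2 := (gamma - 1) / (gamma + 1) in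
  ((1 + mu2) / (1 + 2 * mu2) * Rpower theta (1 / (2 * mu2))
   + mu2 / (1 + 2 * mu2) * Rpower theta ((1 + mu2) / mu2)) * (TL * sL')
  - cL * Rpower theta (1 / (2 * mu2)) * psiL'.

Definition aL : R := 1.
Definition bL : R := / (rho (U1star G) * csound g (U1star G)).

End GRP.

(* Main.v *)
Require Import Defs.
From Stdlib Require Import Reals Lra Psatz Classical ClassicalEpsilon.
From Coquelicot Require Import Coquelicot.
(* Restores [d1] and [d2] as partial derivatives. *)
Import Defs.
Open Scope R_scope.

(** The unknown limits are found in three steps.

    On both sides of the contact discontinuity, the solution is [C1] up to the
    origin, so that the material derivatives of velocity and pressure have
    limits there. These two functions are continuous across the contact, which
    moves with the fluid: their increments along the contact are governed by
    the material derivatives from either side, which therefore have the same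
    limits ([contact_match]). Hence the limits [Du] and [Dp] exist on the time
    axis, wherever the contact lies ([axis_velocity], [axis_pressure]), and they
    can be computed in the region between the tail of the wave and the contact.

    Let [d] be the derivative along [dx/dt = u - c]. In that region, the Euler
    equations give [2 (Du + Dp / (rho c)) = d psi - K d s] at the origin
    ([jet_material]). Now [d psi] and [d s] are the limits of the difference
    quotients of psi and of the entropy along the tail ([edge_quotient]), and
    since the solution is continuous across the tail, these quotients can also
    be computed inside the wave. Likewise the quotients along the head are known
    from the initial data, as [- 2 cL psiL' + cL K sL'] and [- cL sL'].

    It remains to go from the head to the tail inside the wave. There the
    solution is not [C1] up to the origin, but characteristic coordinates are
    available. Let [A] be the limit of [t_alpha] at the origin, a function of
    [beta] ([rate]). For small [alpha], the time is monotone in [beta]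
    ([time_beta_nonneg]): along a line of constant time [x] is injective in
    [beta] and asymptotic to [beta t], hence increasing, and [dx] is equal to
    [2 c t_beta dbeta] there. Therefore a function [f] with [f_beta = h t_beta],
    where [h] tends uniformly to [h0], is a Stieltjes integral with respect to
    the time, and the increments in [beta] of the limits of [f / alpha] are the
    integrals of [h0 dA] ([stieltjes_limit], [transported_quotient]), although
    [t_beta / alpha] is not known to have a limit. This is used three times.
    - For [f = x] and [h = u + c], as [x / alpha] tends to [beta A], it says that
      [A' = A / (2 c)], so that [A] is proportional to [Pi] ([rate_Pi]).
    - For the entropy, [h = c s_x], and [s_alpha = - c s_x t_alpha] by the
      entropy equation; both together imply that [c s_x A^2] does not depend on
      [beta] ([entropy_law]). Hence [c s_x] is [cL sL' / Pi^2] at the origin, and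
      [d s] at the tail is [- cL sL' / Pi^2].
    - For psi, [h = H], and the quotients by [alpha] at the tail and at the head
      differ by the integral of [H A / (2 c)] ([interaction]).

    The only property of psi involved is its differential ([potential]). It
    holds for the integral of the sound speed ([generic_potential]) and, for a
    polytropic gas, for [2 c / (gamma - 1)] with [K = T / c], a multiple of [c]
    ([polytropic_potential]). In the latter case [c] is an affine function of
    [beta], so that [Pi], [H] and the integral are powers of [c]
    ([polytropic_dL]). *)

Local Notation CR := R_CompleteNormedModule.

Ltac abs_lra :=
  repeat match goal with
  | H : Rabs _ < _ |- _ => apply Rabs_lt_between in H
  | H : Rabs _ <= _ |- _ => apply Rabs_le_between in H
  end;
  try match goal with
  | |- Rabs _ < _ => apply Rabs_lt_between
  | |- Rabs _ <= _ => apply Rabs_le_between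
  end; lra.

Ltac min_lra := unfold Rmin in *; repeat destruct Rle_dec; lra.

Ltac Rmin_bounds m :=
  match m with Rmin ?x ?y => pose proof (Rmin_l x y); pose proof (Rmin_r x y) end.

(** * Real inequalities *)

Lemma Rmult_le_div (K x q : R) : 0 < K -> x <= q / K -> K * x <= q.
Proof.
  intros HK Hx. replace q with (K * (q / K)) by (field; lra).
  apply Rmult_le_compat_l; lra.
Qed.

Lemma Rmult_lt_div (K x q : R) : 0 < K -> x < q / K -> K * x < q.
Proof.
  intros HK Hx. replace q with (K * (q / K)) by (field; lra).
  apply Rmult_lt_compat_l; lra.
Qed.

Lemma Rabs_div_lt (x t e : R) : 0 < t -> Rabs x < e * t -> Rabs (x / t) < e.
Proof.
  intros Ht Hx. unfold Rdiv. rewrite Rabs_mult, Rabs_inv, (Rabs_pos_eq t) by lra.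
  apply Rmult_lt_reg_r with t; [lra|].
  rewrite Rmult_assoc, Rinv_l, Rmult_1_r; lra.
Qed.

(** A choice of tolerance, for estimates whose error is a multiple of a
    parameter that can be made small. *)
Lemma small_factor (b K e : R) : 0 < b -> 0 < e -> exists n, 0 < n <= b /\ n * K < e.
Proof.
  intros Hb He. set (k := Rabs K + 1).
  assert (Hk : 0 < k) by (pose proof (Rabs_pos K); unfold k; lra).
  assert (Hq : 0 < e / k) by now apply Rdiv_lt_0_compat.
  exists (Rmin b (e / k)).
  Rmin_bounds (Rmin b (e / k)).
  assert (Hn : 0 < Rmin b (e / k)) by now apply Rmin_pos.
  split; [lra|]. apply Rlt_le_trans with (Rmin b (e / k) * k).
  - apply Rmult_lt_compat_l; [exact Hn|]. unfold k. pose proof (Rle_abs K). lra.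
  - rewrite Rmult_comm. apply Rmult_le_div; lra.
Qed.

Lemma lim_inP (D : R -> R -> Prop) (f : R -> R -> R) (x y l : R) :
  lim_in D f x y l <->
  (forall e, 0 < e -> exists d, 0 < d /\ forall u v,
     Rabs (u - x) < d -> Rabs (v - y) < d -> D u v -> Rabs (f u v - l) < e).
Proof.
  unfold lim_in. split.
  - intros H e He.
    specialize (proj1 (filterlim_locally _ _) H (mkposreal e He)) as [d Hd].
    exists d. split; [apply cond_pos|]. intros u v Hu Hv HD.
    apply (Hd (u, v)); [split; assumption|assumption].
  - intros H. apply filterlim_locally. intros e.
    destruct (H e (cond_pos e)) as [d [Hd H']].
    exists (mkposreal d Hd). intros [u v] [Hu Hv] HD. apply H'; assumption.
Qed.

(** * Limits *)

Local Notation rlim f l := (filterlim f (at_right 0) (locally l)).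

Lemma near_right (P : R -> Prop) :
  at_right 0 P <-> exists d, 0 < d /\ forall t, 0 < t < d -> P t.
Proof.
  split.
  - intros [d Hd]. exists d. split; [apply cond_pos|]. intros t Ht.
    apply Hd; [|apply Ht].
    change (Rabs (t - 0) < d). rewrite Rminus_0_r, Rabs_pos_eq; lra.
  - intros [d [Hd H]]. exists (mkposreal d Hd). intros t Ht Ht0.
    apply H. split; [assumption|].
    change (Rabs (t - 0) < d) in Ht. rewrite Rminus_0_r in Ht.
    abs_lra.
Qed.

Lemma right_limP (f : R -> R) (l : R) :
  rlim f l <->
  (forall e, 0 < e -> exists d, 0 < d /\
     forall t, 0 < t < d -> Rabs (f t - l) < e).
Proof.
  split.
  - intros H e He. apply near_right.
    exact (proj1 (filterlim_locally _ _) H (mkposreal e He)).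
  - intros H. apply filterlim_locally. intros e.
    apply near_right. exact (H e (cond_pos e)).
Qed.

Lemma right_limU (f : R -> R) (l l' : R) :
  rlim f l ->
  rlim f l' -> l = l'.
Proof.
  apply (@filterlim_locally_unique R R_AbsRing R_NormedModule).
  apply Proper_StrongProper, at_right_proper_filter.
Qed.

Lemma right_lim_id : rlim (fun t : R => t) 0.
Proof.
  apply right_limP. intros e He. exists e. split; [assumption|]. intros t Ht.
  rewrite Rminus_0_r, Rabs_pos_eq; lra.
Qed.

(** Estimates of increments, such as the mean value theorem gives away from an
    end point or a boundary, are extended to that point by this passage to the
    limit. *)
Lemma lim_abs_le (f h : R -> R) (l m : R) :
  rlim f l -> rlim h m ->
  at_right 0 (fun z => Rabs (f z) <= h z) -> Rabs l <= m.
Proof.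
  intros Hf Hh Hle.
  apply (filterlim_le (F := at_right 0) (fun z => Rabs (f z)) h
    (Finite (Rabs l)) (Finite m) Hle); [|exact Hh].
  apply (filterlim_comp _ _ _ f Rabs _ (locally l) _ Hf).
  apply (filterlim_norm (K := R_AbsRing) (V := R_NormedModule)).
Qed.

Lemma filterlim_2d (T : Type) (F : (T -> Prop) -> Prop) {FF : Filter F}
    (phi : R -> R -> R) (f h : T -> R) (l m : R) :
  continuity_2d_pt phi l m ->
  filterlim f F (locally l) -> filterlim h F (locally m) ->
  filterlim (fun t => phi (f t) (h t)) F (locally (phi l m)).
Proof.
  intros Hphi Hf Hh. apply continuity_2d_pt_filterlim in Hphi.
  apply (filterlim_comp_2 (G := locally l) (H := locally m) f h phi Hf Hh).
  intros P HP. destruct (Hphi P HP) as [d Hd].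
  exists (ball l d) (ball m d); try apply locally_ball.
  intros x y Hx Hy. apply (Hd (x, y)). now split.
Qed.

Lemma right_lim_minus (f h : R -> R) (l m : R) :
  rlim f l -> rlim h m ->
  rlim (fun t => f t - h t) (l - m).
Proof.
  apply (filterlim_2d R (at_right 0) Rminus).
  apply continuity_2d_pt_minus; [apply continuity_2d_pt_id1|apply continuity_2d_pt_id2].
Qed.

Lemma right_lim_plus (f h : R -> R) (l m : R) :
  rlim f l -> rlim h m ->
  rlim (fun t => f t + h t) (l + m).
Proof.
  apply (filterlim_2d R (at_right 0) Rplus).
  apply continuity_2d_pt_plus; [apply continuity_2d_pt_id1|apply continuity_2d_pt_id2].
Qed.

Lemma right_lim_mult (f h : R -> R) (l m : R) :
  rlim f l -> rlim h m ->
  rlim (fun t => f t * h t) (l * m).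
Proof.
  apply (filterlim_2d R (at_right 0) Rmult).
  apply continuity_2d_pt_mult; [apply continuity_2d_pt_id1|apply continuity_2d_pt_id2].
Qed.

Ltac right_lim := repeat first
  [ exact right_lim_id | apply filterlim_const | eassumption
  | apply right_lim_minus | apply right_lim_plus | apply right_lim_mult ].

Section Limits.

Variables (D : R -> R -> Prop) (x y : R).

Lemma lim_in_ext (f f' : R -> R -> R) (l : R) :
  (forall u v, D u v -> f u v = f' u v) ->
  lim_in D f x y l -> lim_in D f' x y l.
Proof.
  intros Hf. rewrite !lim_inP. intros H e He.
  destruct (H e He) as [d [Hd H']]. exists d. split; [assumption|].
  intros u v Hu Hv HD. rewrite <- Hf by assumption. now apply H'.
Qed.

Lemma lim_in_const (c : R) : lim_in D (fun _ _ => c) x y c.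
Proof.
  apply lim_inP. intros e He. exists 1. split; [lra|]. intros.
  rewrite Rminus_diag, Rabs_R0. exact He.
Qed.

Lemma lim_in_comp2 (phi f f' : R -> R -> R) (l l' : R) :
  continuity_2d_pt phi l l' ->
  lim_in D f x y l -> lim_in D f' x y l' ->
  lim_in D (fun u v => phi (f u v) (f' u v)) x y (phi l l').
Proof.
  intros Hphi H H'. apply lim_inP. intros e He.
  destruct (Hphi (mkposreal e He)) as [r Hr].
  destruct (proj1 (lim_inP _ _ _ _ _) H r (cond_pos r)) as [d [Hd H1]].
  destruct (proj1 (lim_inP _ _ _ _ _) H' r (cond_pos r)) as [d' [Hd' H1']].
  exists (Rmin d d'). split; [now apply Rmin_pos|]. intros u v Hu Hv HD.
  Rmin_bounds (Rmin d d').
  apply Hr; [apply H1|apply H1']; lra || assumption.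
Qed.

Lemma lim_in_plus (f f' : R -> R -> R) (l l' : R) :
  lim_in D f x y l -> lim_in D f' x y l' ->
  lim_in D (fun u v => f u v + f' u v) x y (l + l').
Proof.
  apply (lim_in_comp2 (fun u v => u + v)).
  apply continuity_2d_pt_plus; [apply continuity_2d_pt_id1|apply continuity_2d_pt_id2].
Qed.

Lemma lim_in_mult (f f' : R -> R -> R) (l l' : R) :
  lim_in D f x y l -> lim_in D f' x y l' ->
  lim_in D (fun u v => f u v * f' u v) x y (l * l').
Proof.
  apply (lim_in_comp2 (fun u v => u * v)).
  apply continuity_2d_pt_mult; [apply continuity_2d_pt_id1|apply continuity_2d_pt_id2].
Qed.

Lemma lim_in_along (T : Type) (F : (T -> Prop) -> Prop) {FF : Filter F}
    (f : R -> R -> R) (l : R) (X Y : T -> R) :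
  lim_in D f x y l ->
  filterlim X F (locally x) -> filterlim Y F (locally y) ->
  F (fun t => D (X t) (Y t)) ->
  filterlim (fun t => f (X t) (Y t)) F (locally l).
Proof.
  intros Hf HX HY HD. apply filterlim_locally. intros e.
  apply lim_inP with (e := pos e) in Hf; [|apply cond_pos].
  destruct Hf as [d [Hd Hf]].
  pose proof (proj1 (filterlim_locally _ _) HX (mkposreal d Hd)) as HX'.
  pose proof (proj1 (filterlim_locally _ _) HY (mkposreal d Hd)) as HY'.
  generalize (filter_and _ _ HD (filter_and _ _ HX' HY')).
  apply filter_imp. intros t [H1 [H2 H3]]. now apply Hf.
Qed.

End Limits.

(** * Differentiability in two variables *)

Definition diff2 (f : R -> R -> R) (x y : R) : Prop :=
  differentiable_pt_lim f x y (d1 f x y) (d2 f x y).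

Lemma diff2_of_lim (f : R -> R -> R) (x y l l' : R) :
  differentiable_pt_lim f x y l l' ->
  diff2 f x y /\ d1 f x y = l /\ d2 f x y = l'.
Proof.
  intros H. destruct (differentiable_pt_lim_unique _ _ _ _ _ H) as [H1 H2].
  unfold diff2, d1, d2. rewrite H1, H2. auto.
Qed.

(** Existence and continuity nearby are required of the first partial derivative
    only: for the integral of the sound speed, the other one comes from
    differentiation under the integral sign. *)
Lemma differentiable_of_partials (f fx : R -> R -> R) (x y ly : R) :
  locally_2d (fun u v => is_derive (fun z => f z v) u (fx u v)) x y ->
  is_derive (fun z => f x z) y ly ->
  continuity_2d_pt fx x y ->
  differentiable_pt_lim f x y (fx x y) ly.
Proof.
  intros [d Hd] H2 H3. apply filterdiff_differentiable_pt_lim.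
  eapply filterdiff_ext_lin.
  - apply (is_derive_filterdiff f x y fx ly).
    + exists d. intros [u v] [Hu Hv]. apply Hd; assumption.
    + exact H2.
    + apply continuity_2d_pt_filterlim in H3. exact H3.
  - intros [u v]. reflexivity.
Qed.

Lemma diff2_C1 (f : R -> R -> R) (x y : R) :
  locally_2d (fun u v => ex_diff_n f 1 u v) x y -> diff2 f x y.
Proof.
  intros [d Hd]. apply differentiable_of_partials.
  - exists d. intros u v Hu Hv. apply Derive_correct.
    apply (Hd u v Hu Hv).
  - apply Derive_correct.
    assert (H0 : forall z, Rabs (z - z) < d)
      by (intros z; rewrite Rminus_diag, Rabs_R0; apply cond_pos).
    apply (Hd x y (H0 x) (H0 y)).
  - assert (H0 : forall z, Rabs (z - z) < d)
      by (intros z; rewrite Rminus_diag, Rabs_R0; apply cond_pos).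
    apply (Hd x y (H0 x) (H0 y)).
Qed.

Lemma diff2_derive1 (f : R -> R -> R) (x y : R) :
  diff2 f x y -> is_derive (fun z => f z y) x (d1 f x y).
Proof.
  intros H. apply is_derive_Reals.
  replace (d1 f x y) with (d1 f x y * 1 + d2 f x y * 0) by ring.
  apply (derivable_pt_lim_comp_2d f (fun z => z) (fun _ => y)).
  - exact H.
  - apply derivable_pt_lim_id.
  - apply derivable_pt_lim_const.
Qed.

Lemma diff2_derive2 (f : R -> R -> R) (x y : R) :
  diff2 f x y -> is_derive (fun z => f x z) y (d2 f x y).
Proof.
  intros H. apply is_derive_Reals.
  replace (d2 f x y) with (d1 f x y * 0 + d2 f x y * 1) by ring.
  apply (derivable_pt_lim_comp_2d f (fun _ => x) (fun z => z)).
  - exact H.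
  - apply derivable_pt_lim_const.
  - apply derivable_pt_lim_id.
Qed.

Lemma is_derive_Rplus (f h : R -> R) (x f' h' : R) :
  is_derive f x f' -> is_derive h x h' ->
  is_derive (fun z => f z + h z) x (f' + h').
Proof. apply (is_derive_plus f h). Qed.

Lemma is_derive_Rminus (f h : R -> R) (x f' h' : R) :
  is_derive f x f' -> is_derive h x h' ->
  is_derive (fun z => f z - h z) x (f' - h').
Proof. apply (is_derive_minus f h). Qed.

Lemma is_derive_Rmult (f h : R -> R) (x f' h' : R) :
  is_derive f x f' -> is_derive h x h' ->
  is_derive (fun z => f z * h z) x (f' * h x + f x * h').
Proof. intros Hf Hh. apply (is_derive_mult f h); auto. apply Rmult_comm. Qed.

Lemma is_derive_Rscal (f : R -> R) (x f' k : R) :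
  is_derive f x f' -> is_derive (fun z => k * f z) x (k * f').
Proof. intros Hf. apply (is_derive_scal f x k f' Hf). Qed.

Lemma is_derive_path (f : R -> R -> R) (X Y : R -> R) (s lx ly X' Y' : R) :
  differentiable_pt_lim f (X s) (Y s) lx ly ->
  is_derive X s X' -> is_derive Y s Y' ->
  is_derive (fun s => f (X s) (Y s)) s (lx * X' + ly * Y').
Proof.
  intros H HX HY. apply is_derive_Reals.
  apply derivable_pt_lim_comp_2d; [exact H| |]; now apply is_derive_Reals.
Qed.

Lemma mvt (f df : R -> R) (a b : R) :
  a < b -> (forall x, a <= x <= b -> is_derive f x (df x)) ->
  exists c, a < c < b /\ f b - f a = df c * (b - a).
Proof.
  intros Hab H. destruct (MVT_cor2 f df a b Hab) as [c [H1 H2]].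
  - intros c Hc. now apply is_derive_Reals, H.
  - now exists c.
Qed.

Lemma mvt_bound (f df : R -> R) (a b k e : R) :
  a <= b -> (forall x, a <= x <= b -> is_derive f x (df x)) ->
  (forall x, a < x < b -> Rabs (df x - k) <= e) ->
  Rabs (f b - f a - k * (b - a)) <= e * (b - a).
Proof.
  intros Hab H He. destruct Hab as [Hab| ->].
  - destruct (mvt f df a b Hab H) as [c [Hc ->]].
    rewrite <- Rmult_minus_distr_r, Rabs_mult, (Rabs_pos_eq (b - a)) by lra.
    apply Rmult_le_compat_r; [lra|]. now apply He.
  - replace (f b - f b - k * (b - b)) with 0 by ring. rewrite Rabs_R0. lra.
Qed.

(** Compactness of a segment, without subdivisions. It serves for bounds of
    continuous functions, for uniformity in [beta], and for adding up local
    errors of a total error proportional to the length. *)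
Lemma cousin (P : R -> R -> Prop) (a b : R) :
  a <= b ->
  (forall x, a <= x <= b -> exists d, 0 < d /\ forall u v,
     x - d < u <= x -> x <= v < x + d -> a <= u -> v <= b -> P u v) ->
  (forall u v w, a <= u <= v -> v <= w <= b -> P u v -> P v w -> P u w) ->
  P a b.
Proof.
  intros Hab Hloc Hadd.
  set (E := fun v => a <= v <= b /\ P a v).
  assert (Ea : E a).
  { split; [lra|]. destruct (Hloc a) as [d [Hd H]]; [lra|]. apply H; lra. }
  destruct (completeness E) as [m [Hm1 Hm2]].
  - exists b. intros v [Hv _]. lra.
  - now exists a.
  - assert (Hma : a <= m) by now apply Hm1.
    assert (Hmb : m <= b) by (apply Hm2; intros v [Hv _]; lra).
    destruct (Hloc m) as [d [Hd H]]; [lra|].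
    assert (Hv : exists v, E v /\ m - d < v).
    { apply NNPP. intros HN. apply (Rlt_irrefl m).
      apply Rle_lt_trans with (m - d); [|lra]. apply Hm2. intros v HE.
      apply Rnot_lt_le. intros Hv. apply HN. now exists v. }
    destruct Hv as [v [[Hv HP] Hvd]].
    assert (Hvm : v <= m) by now apply Hm1.
    set (z := Rmin b (m + d / 2)).
    assert (Hz : m <= z <= b /\ z < m + d).
    { unfold z. min_lra. }
    assert (HPz : P a z).
    { apply (Hadd a v z); try lra; [exact HP|]. apply H; lra. }
    assert (Hzm : z <= m) by (apply Hm1; split; [lra|exact HPz]).
    replace b with z; [exact HPz|].
    unfold z, Rmin in *. destruct Rle_dec; lra.
Qed.

(** * Increments along a curve issuing from the origin *)

(** The curve can be shifted into the region by a small amount. The amount is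
    uniform only on time intervals away from the origin, since the curves meet
    there. *)
Definition room (D : R -> R -> Prop) (X : R -> R) (tau e : R) : Prop :=
  forall t1 t2, 0 < t1 -> t1 <= t2 -> t2 < tau ->
  exists n0, 0 < n0 /\ forall n t, 0 < n < n0 -> t1 <= t <= t2 ->
    D (X t + e * n) t.

(** The value of [f] on a curve issuing from the origin, when the curve can be
    shifted sideways into a region where [f] is [C1] up to the origin: the
    increments along the shifted curves are given by the mean value theorem,
    and only the continuity of [f] is needed to come back to the curve. *)
Section Edge.

Variables (D : R -> R -> Prop) (f : R -> R -> R) (X X' : R -> R) (tau e : R).
Variables (l l1 l2 v : R).

Hypothesis tau_pos : 0 < tau.
Hypothesis D_pos : forall x t, D x t -> 0 < t.
Hypothesis side : e = 1 \/ e = -1.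
Hypothesis f_cont : forall t, 0 < t < tau -> continuity_2d_pt f (X t) t.
Hypothesis X_orig : rlim X 0.
Hypothesis X_room : room D X tau e.

Lemma edge_shift (t : R) : 0 < t < tau ->
  rlim (fun n => f (X t + e * n) t) (f (X t) t).
Proof.
  intros Ht. apply (filterlim_2d R (at_right 0) f (fun n => X t + e * n) (fun _ => t));
    [now apply f_cont| |apply filterlim_const].
  replace (X t) with (X t + e * 0) by ring.
  apply right_lim_plus; [replace (X t + e * 0) with (X t) by ring; apply filterlim_const|].
  apply right_lim_mult; [apply filterlim_const|exact right_lim_id].
Qed.

Lemma edge_near (d : R) : 0 < d -> exists d', 0 < d' <= tau /\
  forall t1 t2, 0 < t1 -> t1 <= t2 -> t2 < d' ->
  at_right 0 (fun n => forall t, t1 <= t <= t2 ->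
    Rabs (X t + e * n - 0) < d /\ Rabs (t - 0) < d /\ D (X t + e * n) t).
Proof.
  intros Hd.
  destruct (proj1 (right_limP _ _) X_orig (d / 2)) as [d' [Hd' HX]]; [lra|].
  exists (Rmin (Rmin d d') tau).
  split; [split; [repeat apply Rmin_pos; assumption|apply Rmin_r]|].
  intros t1 t2 Ht1 Ht12 Ht2.
  assert (Ht2' : t2 < d /\ t2 < d' /\ t2 < tau) by (revert Ht2; min_lra).
  destruct (X_room t1 t2) as [n0 [Hn0 Hn]]; try lra.
  apply near_right. exists (Rmin n0 (d / 2)). split; [apply Rmin_pos; lra|].
  intros n Hnn t Ht. Rmin_bounds (Rmin n0 (d / 2)).
  specialize (HX t ltac:(lra)). split; [|split; [abs_lra|apply Hn; lra]].
  destruct side as [-> | ->]; abs_lra.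
Qed.

Lemma edge_value :
  lim_in D f 0 0 l -> rlim (fun t => f (X t) t) l.
Proof.
  intros Hl. apply right_limP. intros r Hr.
  destruct (proj1 (lim_inP _ _ _ _ _) Hl (r / 2)) as [d [Hd H]]; [lra|].
  destruct (edge_near d Hd) as [d' [Hd' Hn]].
  exists d'. split; [lra|]. intros t Ht. apply Rle_lt_trans with (r / 2); [|lra].
  apply (lim_abs_le (fun n => f (X t + e * n) t - l) (fun _ => r / 2)).
  - apply right_lim_minus; [apply edge_shift; lra|apply filterlim_const].
  - apply filterlim_const.
  - generalize (Hn t t ltac:(lra) ltac:(lra) ltac:(lra)). apply filter_imp.
    intros n HD. destruct (HD t) as [H1 [H2 H3]]; [lra|]. left. now apply H.
Qed.

Hypothesis f_diff : forall x t, D x t -> diff2 f x t.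
Hypothesis f_1 : lim_in D (d1 f) 0 0 l1.
Hypothesis f_2 : lim_in D (d2 f) 0 0 l2.
Hypothesis X_der : forall t, 0 < t < tau -> is_derive X t (X' t).
Hypothesis X_speed : rlim X' v.

(** The derivative of [f] along the shifted curves tends to [l2 + v l1] at the
    origin; the mean value theorem is used before the shift tends to zero. *)
Lemma edge_increment (r : R) : 0 < r -> exists d, 0 < d /\
  forall t1 t2, 0 < t1 -> t1 <= t2 -> t2 < d ->
    Rabs (f (X t2) t2 - f (X t1) t1 - (l2 + v * l1) * (t2 - t1))
    <= r * (t2 - t1).
Proof.
  intros Hr.
  assert (Hm : lim_in D (fun x t => d1 f x t * X' t + d2 f x t) 0 0 (l1 * v + l2)).
  { apply lim_in_plus; [|exact f_2]. apply lim_in_mult; [exact f_1|].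
    apply lim_inP. intros r' Hr'.
    destruct (proj1 (right_limP _ _) X_speed r' Hr') as [d [Hd H]].
    exists d. split; [assumption|]. intros x t _ Ht HD. apply H.
    apply D_pos in HD. rewrite Rminus_0_r, Rabs_pos_eq in Ht; lra. }
  destruct (proj1 (lim_inP _ _ _ _ _) Hm r Hr) as [d [Hd H]].
  destruct (edge_near d Hd) as [d' [Hd' Hn]].
  exists d'. split; [lra|]. intros t1 t2 Ht1 Ht12 Ht2.
  replace (l2 + v * l1) with (l1 * v + l2) by ring.
  apply (lim_abs_le (fun n => f (X t2 + e * n) t2 - f (X t1 + e * n) t1
                              - (l1 * v + l2) * (t2 - t1)) (fun _ => r * (t2 - t1))).
  - repeat apply right_lim_minus; try apply filterlim_const; apply edge_shift; lra.
  - apply filterlim_const.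
  - generalize (Hn t1 t2 Ht1 Ht12 Ht2). apply filter_imp. intros n HD.
    apply (mvt_bound (fun t => f (X t + e * n) t)
       (fun t => d1 f (X t + e * n) t * X' t + d2 f (X t + e * n) t) t1 t2); [lra| |].
    + intros t Ht.
      replace (d2 f (X t + e * n) t) with (d2 f (X t + e * n) t * 1) by ring.
      apply (is_derive_path f (fun t => X t + e * n) (fun t => t)).
      * apply f_diff, HD, Ht.
      * replace (X' t) with (X' t + 0) by ring.
        apply (is_derive_plus X (fun _ => e * n)); [apply X_der; lra|].
        apply @is_derive_const.
      * apply @is_derive_id.
    + intros t Ht. destruct (HD t) as [H1 [H2 H3]]; [lra|]. left. now apply H.
Qed.

Lemma edge_quotient :
  lim_in D f 0 0 l ->
  rlim (fun t => (f (X t) t - l) / t) (l2 + v * l1).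
Proof.
  intros Hl. apply right_limP. intros r Hr.
  destruct (edge_increment (r / 2)) as [d [Hd H]]; [lra|].
  exists d. split; [assumption|]. intros t Ht.
  assert (HB : Rabs (f (X t) t - l - (l2 + v * l1) * (t - 0)) <= r / 2 * (t - 0)).
  { apply (lim_abs_le (fun t1 => f (X t) t - f (X t1) t1 - (l2 + v * l1) * (t - t1))
      (fun t1 => r / 2 * (t - t1))).
    - right_lim. now apply edge_value.
    - right_lim.
    - apply near_right. exists t. split; [lra|]. intros t1 Ht1. apply H; lra. }
  rewrite Rminus_0_r in HB.
  replace ((f (X t) t - l) / t - (l2 + v * l1))
    with ((f (X t) t - l - (l2 + v * l1) * t) / t) by (field; lra).
  apply Rabs_div_lt; [lra|]. nra.
Qed.

End Edge.

(** * Functions on a segment *)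

Section Segment.

Variables (lo hi : R).
Hypothesis lohi : lo < hi.

Definition cont_on (f : R -> R) : Prop := forall b, lo <= b <= hi ->
  filterlim f (within (fun z => lo <= z <= hi) (locally b)) (locally (f b)).

Lemma cont_onP (f : R -> R) (b e : R) :
  cont_on f -> lo <= b <= hi -> 0 < e -> exists d, 0 < d /\
    forall z, lo <= z <= hi -> Rabs (z - b) < d -> Rabs (f z - f b) < e.
Proof.
  intros Hf Hb He.
  destruct (proj1 (filterlim_locally _ _) (Hf b Hb) (mkposreal e He)) as [d Hd].
  exists d. split; [apply cond_pos|]. intros z Hz Hzb. now apply (Hd z).
Qed.

Lemma cont_on_intro (f : R -> R) :
  (forall b e, lo <= b <= hi -> 0 < e -> exists d, 0 < d /\
    forall z, lo <= z <= hi -> Rabs (z - b) < d -> Rabs (f z - f b) < e) ->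
  cont_on f.
Proof.
  intros H b Hb. apply filterlim_locally. intros e.
  destruct (H b e Hb (cond_pos e)) as [d [Hd H']].
  exists (mkposreal d Hd). intros z Hz HI. now apply H'.
Qed.

Lemma cont_on_2d (phi : R -> R -> R) (f h : R -> R) :
  (forall b, lo <= b <= hi -> continuity_2d_pt phi (f b) (h b)) ->
  cont_on f -> cont_on h -> cont_on (fun b => phi (f b) (h b)).
Proof.
  intros Hphi Hf Hh b Hb. apply filterlim_2d; auto. apply within_filter, locally_filter.
Qed.

Lemma cont_on_continuous (f : R -> R) :
  (forall b, lo <= b <= hi -> continuous f b) -> cont_on f.
Proof.
  intros H b Hb. eapply filterlim_filter_le_1; [|exact (H b Hb)].
  intros P [d Hd]. exists d. intros z Hz _. now apply Hd.
Qed.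

Lemma cont_on_const (k : R) : cont_on (fun _ => k).
Proof. apply cont_on_continuous. intros b _. apply continuous_const. Qed.

Lemma cont_on_mult (f h : R -> R) :
  cont_on f -> cont_on h -> cont_on (fun b => f b * h b).
Proof.
  apply (cont_on_2d Rmult). intros b _.
  apply continuity_2d_pt_mult; [apply continuity_2d_pt_id1|apply continuity_2d_pt_id2].
Qed.

Lemma cont_on_minus (f h : R -> R) :
  cont_on f -> cont_on h -> cont_on (fun b => f b - h b).
Proof.
  apply (cont_on_2d Rminus). intros b _.
  apply continuity_2d_pt_minus; [apply continuity_2d_pt_id1|apply continuity_2d_pt_id2].
Qed.

Lemma cont_on_inv (f : R -> R) :
  (forall b, lo <= b <= hi -> f b <> 0) -> cont_on f -> cont_on (fun b => / f b).
Proof.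
  intros H0 Hf. apply (cont_on_2d (fun x _ => / x) f f); auto.
  intros b Hb. apply continuity_2d_pt_inv; [apply continuity_2d_pt_id1|auto].
Qed.

Lemma cont_on_ext (f h : R -> R) :
  (forall b, lo <= b <= hi -> f b = h b) -> cont_on f -> cont_on h.
Proof.
  intros E Hf. apply cont_on_intro. intros b e Hb He.
  destruct (cont_onP f b e Hf Hb He) as [d [Hd H]].
  exists d. split; [assumption|]. intros z Hz Hzb.
  rewrite <- !E by assumption. now apply H.
Qed.

Lemma cont_on_bounded (f : R -> R) :
  cont_on f -> exists M, 0 < M /\ forall b, lo <= b <= hi -> Rabs (f b) <= M.
Proof.
  intros Hf.
  destruct (cousin (fun u v => exists M, 0 < M /\
    forall b, u <= b <= v -> lo <= b <= hi -> Rabs (f b) <= M) lo hi) as [M [HM H]].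
  - lra.
  - intros x Hx. destruct (cont_onP f x 1 Hf Hx Rlt_0_1) as [d [Hd H]].
    exists d. split; [assumption|]. intros u v Hu Hv _ _.
    exists (Rabs (f x) + 1). split; [pose proof (Rabs_pos (f x)); lra|].
    intros b Hb HI.
    specialize (H b HI ltac:(abs_lra)).
    pose proof (Rabs_triang (f b - f x) (f x)) as Ht.
    replace (f b - f x + f x) with (f b) in Ht by ring. lra.
  - intros u v z _ _ [M [HM H1]] [M' [HM' H2]].
    exists (M + M'). split; [lra|]. intros b Hb HI.
    destruct (Rle_dec b v).
    + specialize (H1 b ltac:(lra) HI). lra.
    + specialize (H2 b ltac:(lra) HI). lra.
  - exists M. split; [assumption|]. intros b Hb. now apply H.
Qed.

Lemma cont_on_pos_min (f : R -> R) :
  cont_on f -> (forall b, lo <= b <= hi -> 0 < f b) ->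
  exists m, 0 < m /\ forall b, lo <= b <= hi -> m <= f b.
Proof.
  intros Hf Hpos.
  destruct (cont_on_bounded (fun b => / f b)) as [M [HM H]].
  - apply cont_on_inv; [|assumption]. intros b Hb. specialize (Hpos b Hb). lra.
  - exists (/ M). split; [now apply Rinv_0_lt_compat|]. intros b Hb.
    specialize (H b Hb). specialize (Hpos b Hb).
    rewrite Rabs_pos_eq in H by (left; now apply Rinv_0_lt_compat).
    rewrite <- (Rinv_inv (f b)). apply Rinv_le_contravar; [|exact H].
    now apply Rinv_0_lt_compat.
Qed.

(** The end points, where [f] need not be differentiable, are reached by
    continuity. *)
Lemma mvt_cont_on (f df : R -> R) (u v k e : R) :
  cont_on f -> (forall b, lo < b < hi -> is_derive f b (df b)) ->
  lo <= u -> u <= v -> v <= hi ->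
  (forall b, u < b < v -> Rabs (df b - k) <= e) ->
  Rabs (f v - f u - k * (v - u)) <= e * (v - u).
Proof.
  intros Hf Hdf Hu Huv Hv Hb. destruct Huv as [Huv| ->].
  2:{ replace (f v - f v - k * (v - v)) with 0 by ring. rewrite Rabs_R0. lra. }
  assert (Hlim : forall b s, lo <= b <= hi -> (forall n, 0 < n < v - u -> lo <= b + s * n <= hi) ->
     rlim (fun n => f (b + s * n)) (f b)).
  { intros b s Hbb Hbs. apply (filterlim_comp _ _ _ (fun n => b + s * n) f _
      (within (fun z => lo <= z <= hi) (locally b))); [|now apply Hf].
    intros P HP.
    assert (HL : rlim (fun n => b + s * n) (b + s * 0)).
    { right_lim. }
    rewrite Rmult_0_r, Rplus_0_r in HL. specialize (HL _ HP). unfold filtermap in *.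
    assert (HN : at_right 0 (fun n => 0 < n < v - u))
      by (apply near_right; exists (v - u); split; [lra|auto]).
    generalize (filter_and _ _ HL HN). apply filter_imp.
    intros n [H1 H2]. now apply H1, Hbs. }
  replace (v - u) with ((v - u) - 2 * 0) by ring.
  apply (lim_abs_le (fun n => f (v + (-1) * n) - f (u + 1 * n) - k * ((v - u) - 2 * n))
    (fun n => e * ((v - u) - 2 * n))).
  - right_lim; apply Hlim; lra || (intros; lra).
  - right_lim.
  - apply near_right. exists ((v - u) / 2). split; [lra|]. intros n Hn.
    replace (v - u - 2 * n) with ((v + (-1) * n) - (u + 1 * n)) by ring.
    apply (mvt_bound f df); [lra| |].
    + intros x Hx. apply Hdf. lra.
    + intros x Hx. apply Hb. lra.
Qed.

Lemma cont_on_zero_derive (f : R -> R) (b : R) :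
  cont_on f -> (forall z, lo < z < hi -> is_derive f z 0) ->
  lo <= b <= hi -> f b = f lo.
Proof.
  intros Hf Hdf Hb.
  assert (H : Rabs (f b - f lo - 0 * (b - lo)) <= 0 * (b - lo)).
  { apply (mvt_cont_on f (fun _ => 0)); try assumption; try lra.
    intros z _. rewrite Rminus_0_r, Rabs_R0. lra. }
  rewrite !Rmult_0_l, Rminus_0_r in H.
  apply Rminus_diag_uniq, Rabs_eq_0, Rle_antisym; [exact H|apply Rabs_pos].
Qed.

(** Projection onto the segment. It turns a function that is continuous on the
    segment into one that is continuous on the line and agrees with it on the
    segment, so that integrals and primitives can be taken. *)
Definition clamp (b : R) : R := Rmax lo (Rmin b hi).

Lemma clamp_in (b : R) : lo <= clamp b <= hi.
Proof. unfold clamp, Rmax. min_lra. Qed.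

Lemma clamp_id (b : R) : lo <= b <= hi -> clamp b = b.
Proof. unfold clamp, Rmax. min_lra. Qed.

Lemma clamp_continuous (f : R -> R) (b : R) :
  cont_on f -> continuous (fun z => f (clamp z)) b.
Proof.
  intros Hf. apply filterlim_locally. intros e.
  destruct (cont_onP f (clamp b) e Hf (clamp_in b) (cond_pos e)) as [d [Hd H]].
  exists (mkposreal d Hd). intros z Hz. apply H; [apply clamp_in|].
  change (Rabs (z - b) < d) in Hz. apply Rle_lt_trans with (2 := Hz).
  unfold clamp, Rmax, Rmin, Rabs.
  repeat destruct Rle_dec; repeat destruct Rcase_abs; lra.
Qed.

Lemma cont_on_primitive (h : R -> R) :
  cont_on h -> exists Phi : R -> R,
    (forall b, is_derive Phi b (h (clamp b))) /\
    (forall b, lo <= b <= hi -> Phi b = RInt h lo b).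
Proof.
  intros Hh. exists (fun b => RInt (fun z => h (clamp z)) lo b). split.
  - intros b. apply (is_derive_RInt (fun z => h (clamp z)) _ lo).
    + apply filter_forall. intros z. apply (RInt_correct (V := CR)).
      apply (ex_RInt_continuous (V := CR)).
      intros y _. now apply clamp_continuous.
    + now apply clamp_continuous.
  - intros b Hb. apply RInt_ext. intros x Hx.
    rewrite Rmin_left, Rmax_right in Hx by lra. rewrite clamp_id; [reflexivity|lra].
Qed.

Lemma cont_on_derive (Phi dPhi : R -> R) :
  (forall b, is_derive Phi b (dPhi b)) -> cont_on Phi.
Proof.
  intros H. apply cont_on_continuous. intros b _.
  apply (ex_derive_continuous Phi b). exists (dPhi b). apply H.
Qed.

(** A continuous injective function on an interval is monotone: otherwise the
    increment between two moving points would vanish. *)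
Lemma injective_increasing (f : R -> R) (p q u v : R) :
  (forall b, lo < b < hi -> continuous f b) ->
  (forall b b', lo < b < hi -> lo < b' < hi -> f b = f b' -> b = b') ->
  lo < p -> p < q -> q < hi -> f p < f q ->
  lo < u -> u < v -> v < hi -> f u < f v.
Proof.
  intros Hc Hinj Hp Hpq Hq Hf Hu Huv Hv.
  apply Rnot_le_lt. intros Hle.
  assert (Hlt : f v < f u).
  { destruct Hle as [H|H]; [assumption|]. apply Hinj in H; lra. }
  (* Two points moving from [p < q] to [u < v] without meeting. *)
  set (U := fun s => p + s * (u - p)). set (V := fun s => q + s * (v - q)).
  assert (HUV : forall s, 0 <= s <= 1 -> lo < U s /\ U s < V s /\ V s < hi).
  { intros s Hs.
    assert (Hmix : forall x y, 0 < x -> 0 < y -> 0 < x + s * (y - x)).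
    { intros x y Hx Hy. destruct (Rle_dec x y); nra. }
    pose proof (Hmix (p - lo) (u - lo) ltac:(lra) ltac:(lra)).
    pose proof (Hmix (q - p) (v - u) ltac:(lra) ltac:(lra)).
    pose proof (Hmix (hi - q) (hi - v) ltac:(lra) ltac:(lra)).
    unfold U, V. lra. }
  destruct (Ranalysis5.IVT_interv (fun s => f (U s) - f (V s)) 0 1) as [s [Hs Hs0]].
  - intros s Hs. apply HUV in Hs.
    assert (HUc : continuous U s).
    { apply (ex_derive_continuous U s). unfold U. auto_derive. auto. }
    assert (HVc : continuous V s).
    { apply (ex_derive_continuous V s). unfold V. auto_derive. auto. }
    apply continuity_pt_minus; apply continuity_pt_filterlim.
    + apply (continuous_comp U f s); [exact HUc|]. apply Hc. lra.
    + apply (continuous_comp V f s); [exact HVc|]. apply Hc. lra.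
  - lra.
  - unfold U, V. rewrite !Rmult_0_l, !Rplus_0_r. lra.
  - unfold U, V. replace (p + 1 * (u - p)) with u by ring.
    replace (q + 1 * (v - q)) with v by ring. lra.
  - apply HUV in Hs. assert (HE : U s = V s) by (apply Hinj; lra). lra.
Qed.

End Segment.

(** * Difference quotients at the origin *)

(** The mean value inequality from the origin, where only a limit is available:
    the characteristic coordinates degenerate there, and the states form a whole
    fan. *)
Lemma origin_increment (f df : R -> R) (l k e a : R) :
  0 < a -> rlim f l ->
  (forall z, 0 < z <= a -> is_derive f z (df z)) ->
  (forall z, 0 < z < a -> Rabs (df z - k) <= e) ->
  Rabs (f a - l - k * a) <= e * a.
Proof.
  intros Ha Hl Hdf Hb. replace a with (a - 0) at 2 3 by ring.
  apply (lim_abs_le (fun z => f a - f z - k * (a - z)) (fun z => e * (a - z))).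
  - right_lim.
  - right_lim.
  - apply near_right. exists a. split; [assumption|]. intros z Hz.
    apply (mvt_bound f df); [lra| |].
    + intros x Hx. apply Hdf. lra.
    + intros x Hx. apply Hb. lra.
Qed.

Lemma increments_unique (F : R -> R) (m m' : R) :
  (forall r, 0 < r -> exists d, 0 < d /\ forall t1 t2, 0 < t1 -> t1 <= t2 -> t2 < d ->
     Rabs (F t2 - F t1 - m * (t2 - t1)) <= r * (t2 - t1)) ->
  (forall r, 0 < r -> exists d, 0 < d /\ forall t1 t2, 0 < t1 -> t1 <= t2 -> t2 < d ->
     Rabs (F t2 - F t1 - m' * (t2 - t1)) <= r * (t2 - t1)) ->
  m = m'.
Proof.
  intros H H'. apply cond_eq. intros e He.
  destruct (H (e / 4)) as [d [Hd HF]]; [lra|].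
  destruct (H' (e / 4)) as [d' [Hd' HF']]; [lra|].
  set (t2 := Rmin d d' / 2). set (t1 := t2 / 2).
  assert (Ht : 0 < t1 /\ t2 = 2 * t1 /\ t2 < d /\ t2 < d').
  { unfold t1, t2. min_lra. }
  specialize (HF t1 t2 ltac:(lra) ltac:(lra) ltac:(lra)).
  specialize (HF' t1 t2 ltac:(lra) ltac:(lra) ltac:(lra)).
  replace (t2 - t1) with t1 in * by lra.
  apply Rabs_le_between in HF. apply Rabs_le_between in HF'.
  apply Rabs_lt_between. split; nra.
Qed.

Lemma derive_small (F : R -> R) (L r : R) :
  is_derive F 0 L -> 0 < r -> exists d, 0 < d /\ forall x, Rabs x < d ->
    Rabs (F x - F 0 - L * x) <= r * Rabs x.
Proof.
  intros HF Hr. apply is_derive_Reals in HF. destruct (HF r Hr) as [d Hd].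
  exists d. split; [apply cond_pos|]. intros x Hx.
  destruct (Req_dec x 0) as [-> |Hx0].
  - replace (F 0 - F 0 - L * 0) with 0 by ring. rewrite Rabs_R0. lra.
  - specialize (Hd x Hx0 Hx). rewrite Rplus_0_l in Hd.
    replace (F x - F 0 - L * x) with (((F x - F 0) / x - L) * x) by (field; assumption).
    rewrite Rabs_mult. apply Rmult_le_compat_r; [apply Rabs_pos|lra].
Qed.

Lemma origin_quotient (f df : R -> R) (l k r : R) :
  0 < r -> rlim f l ->
  (forall z, 0 < z < r -> is_derive f z (df z)) ->
  rlim df k ->
  rlim (fun a => (f a - l) / a) k.
Proof.
  intros Hr Hl Hdf Hk. apply right_limP. intros e He.
  destruct (proj1 (right_limP _ _) Hk (e / 2)) as [d [Hd H]]; [lra|].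
  exists (Rmin d r). split; [now apply Rmin_pos|]. intros a Ha.
  Rmin_bounds (Rmin d r).
  assert (HB : Rabs (f a - l - k * a) <= e / 2 * a).
  { apply (origin_increment f df); [lra|exact Hl| |].
    - intros z Hz. apply Hdf. lra.
    - intros z Hz. left. apply H. lra. }
  replace ((f a - l) / a - k) with ((f a - l - k * a) / a) by (field; lra).
  apply Rabs_div_lt; [lra|]. nra.
Qed.

(** The chain rule, for a function [F] whose increments are compared with those
    of [A]. *)
Lemma derive_of_increments (F A : R -> R) (b k A' : R) :
  (forall e, 0 < e -> exists d, 0 < d /\ forall z, Rabs (z - b) < d ->
    Rabs (F z - F b - k * (A z - A b)) <= e * Rabs (A z - A b)) ->
  is_derive A b A' -> is_derive F b (k * A').
Proof.
  intros H HA. apply is_derive_Reals. apply is_derive_Reals in HA.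
  intros e He. set (K := Rabs A' + 1 + Rabs k).
  assert (HK : 1 <= K) by (pose proof (Rabs_pos A'); pose proof (Rabs_pos k); unfold K; lra).
  destruct (small_factor 1 K e Rlt_0_1 He) as [n [Hn HnK]].
  destruct (H n) as [d [Hd HF]]; [lra|]. destruct (HA n) as [d' HA']; [lra|].
  assert (Hr : 0 < Rmin d d') by (apply Rmin_pos; [assumption|apply cond_pos]).
  exists (mkposreal _ Hr). simpl. intros h Hh0 Hh.
  Rmin_bounds (Rmin d d').
  specialize (HA' h Hh0 ltac:(lra)).
  specialize (HF (b + h) ltac:(replace (b + h - b) with h by ring; lra)).
  set (q := (A (b + h) - A b) / h) in *.
  assert (Hq : A (b + h) - A b = q * h) by (unfold q; field; assumption).
  rewrite Hq, Rabs_mult in HF.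
  set (p := (F (b + h) - F b) / h).
  assert (Hp : F (b + h) - F b = p * h) by (unfold p; field; assumption).
  rewrite Hp in HF.
  replace (p * h - k * (q * h)) with ((p - k * q) * h) in HF by ring.
  rewrite Rabs_mult, <- Rmult_assoc in HF.
  apply Rmult_le_reg_r in HF; [|now apply Rabs_pos_lt].
  assert (Hqb : Rabs q <= Rabs A' + 1).
  { replace q with (A' + (q - A')) by ring.
    apply Rle_trans with (1 := Rabs_triang _ _). lra. }
  replace (p - k * A') with ((p - k * q) + k * (q - A')) by ring.
  apply Rle_lt_trans with (1 := Rabs_triang _ _). rewrite (Rabs_mult k).
  apply Rle_lt_trans with (2 := HnK).
  apply Rle_trans with (n * (Rabs A' + 1) + Rabs k * n).
  - apply Rplus_le_compat.
    + apply Rle_trans with (1 := HF). apply Rmult_le_compat_l; lra.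
    + apply Rmult_le_compat_l; [apply Rabs_pos|lra].
  - unfold K. lra.
Qed.

(** The chain rule for difference quotients at the origin. It gives those of psi
    along an edge of the wave from those of density and entropy. *)
Lemma quotient_chain (Psi : R -> R -> R) (x y : R -> R) (x0 y0 lx ly p q : R) :
  differentiable_pt_lim Psi x0 y0 lx ly ->
  rlim (fun t => (x t - x0) / t) p ->
  rlim (fun t => (y t - y0) / t) q ->
  rlim (fun t => (Psi (x t) (y t) - Psi x0 y0) / t) (lx * p + ly * q).
Proof.
  intros HPsi Hx Hy.
  apply (filterlim_ext_loc (fun t =>
    (Psi (x t) (y t) - Psi x0 y0 - (lx * (x t - x0) + ly * (y t - y0))) / t
    + (lx * ((x t - x0) / t) + ly * ((y t - y0) / t)))).
  { apply near_right. exists 1. split; [lra|]. intros t Ht. field. lra. }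
  rewrite <- (Rplus_0_l (lx * p + ly * q)). apply right_lim_plus.
  2:{ apply right_lim_plus; apply (right_lim_mult (fun _ => _));
      try apply filterlim_const; assumption. }
  set (k := Rabs p + Rabs q + 1).
  assert (Hk : 0 < k) by (pose proof (Rabs_pos p); pose proof (Rabs_pos q); unfold k; lra).
  apply right_limP. intros e He.
  assert (Hek : 0 < e / (2 * k)) by (apply Rdiv_lt_0_compat; lra).
  destruct (HPsi (mkposreal _ Hek)) as [r Hr]. simpl in Hr.
  destruct (proj1 (right_limP _ _) Hx 1 Rlt_0_1) as [d1 [Hd1 H1]].
  destruct (proj1 (right_limP _ _) Hy 1 Rlt_0_1) as [d2 [Hd2 H2]].
  assert (Hrk : 0 < r / k) by (apply Rdiv_lt_0_compat; [apply cond_pos|lra]).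
  exists (Rmin (Rmin d1 d2) (r / k)). split; [repeat apply Rmin_pos; assumption|].
  intros t Ht.
  assert (Ht' : 0 < t /\ t < d1 /\ t < d2 /\ t < r / k).
  { revert Ht. min_lra. }
  assert (Hkt : k * t < r).
  { apply Rmult_lt_div; lra. }
  assert (Hinc : forall z l, Rabs (z / t - l) < 1 -> Rabs l + 1 <= k -> Rabs z <= k * t).
  { intros z l Hz Hl. replace z with ((l + (z / t - l)) * t) by (field; lra).
    rewrite Rabs_mult, (Rabs_pos_eq t) by lra. apply Rmult_le_compat_r; [lra|].
    apply Rle_trans with (1 := Rabs_triang _ _). lra. }
  pose proof (Rabs_pos p). pose proof (Rabs_pos q).
  assert (Bx : Rabs (x t - x0) <= k * t).
  { apply (Hinc _ p); [apply H1; lra|unfold k; lra]. }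
  assert (By : Rabs (y t - y0) <= k * t).
  { apply (Hinc _ q); [apply H2; lra|unfold k; lra]. }
  specialize (Hr (x t) (y t) ltac:(lra) ltac:(lra)).
  rewrite Rminus_0_r. apply Rabs_div_lt; [lra|].
  apply Rle_lt_trans with (1 := Hr).
  apply Rle_lt_trans with (e / (2 * k) * (k * t)).
  - apply Rmult_le_compat_l; [lra|]. now apply Rmax_lub.
  - replace (e / (2 * k) * (k * t)) with (e * t / 2) by (field; lra). nra.
Qed.

Lemma quotient_diff (f h : R -> R) (l p q : R) :
  rlim (fun a => (f a - l) / a) p -> rlim (fun a => (h a - l) / a) q ->
  rlim (fun a => (h a - f a) / a) (q - p).
Proof.
  intros Hf Hh. apply (filterlim_ext (fun a => (h a - l) / a - (f a - l) / a)).
  - intros a. unfold Rdiv. ring.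
  - now apply right_lim_minus.
Qed.

Lemma quotient_diff0 (f h : R -> R) (p q : R) :
  rlim (fun a => f a / a) p -> rlim (fun a => h a / a) q ->
  rlim (fun a => (h a - f a) / a) (q - p).
Proof.
  intros Hf Hh. apply (quotient_diff f h 0);
  [apply filterlim_ext with (2 := Hf)|apply filterlim_ext with (2 := Hh)];
  intros a; now rewrite Rminus_0_r.
Qed.

(** * Equation of state *)

Section Eos.

Variable (g : eos).
Hypothesis Hg : eos_ok g.

Lemma locally_pos (P : R -> R -> Prop) (r s : R) :
  0 < r -> (forall r' s', 0 < r' -> P r' s') -> locally_2d P r s.
Proof.
  intros Hr HP. exists (mkposreal r Hr). simpl. intros u v Hu _. apply HP.
  abs_lra.
Qed.

Lemma pr_diff (r s : R) : 0 < r -> diff2 (pr g) r s.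
Proof.
  intros Hr. apply diff2_C1, locally_pos; [assumption|]. intros.
  apply (ex_diff_n_m 2 1); [auto|]. now apply pr_C2.
Qed.

Lemma en_diff (r s : R) : 0 < r -> diff2 (en g) r s.
Proof.
  intros Hr. apply diff2_C1, locally_pos; [assumption|]. intros.
  now apply en_C1.
Qed.

Lemma pr_1_cont (r s : R) : 0 < r -> continuity_2d_pt (d1 (pr g)) r s.
Proof. intros Hr. apply (pr_C2 g Hg r s Hr). Qed.

Lemma pr_2_cont (r s : R) : 0 < r -> continuity_2d_pt (d2 (pr g)) r s.
Proof. intros Hr. apply (pr_C2 g Hg r s Hr). Qed.

Lemma sound_pos (r s : R) : 0 < r -> 0 < sound g r s.
Proof. intros Hr. apply sqrt_lt_R0. now apply pr_incr. Qed.

Lemma sound_sqr (r s : R) : 0 < r -> d1 (pr g) r s = sound g r s * sound g r s.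
Proof.
  intros Hr. symmetry. apply sqrt_sqrt. left. now apply pr_incr.
Qed.

Lemma sound_cont (r s : R) : 0 < r -> continuity_2d_pt (sound g) r s.
Proof.
  intros Hr. apply (continuity_1d_2d_pt_comp sqrt (d1 (pr g))).
  - apply continuity_pt_sqrt. left. now apply pr_incr.
  - now apply pr_1_cont.
Qed.

(** * Euler equations in primitive variables *)

Section Primitive.

Variables (W : R -> state) (z r' v' s' : R).
Hypothesis pos : 0 < rho (W z).
Hypothesis dr : is_derive (fun y => rho (W y)) z r'.
Hypothesis dv : is_derive (fun y => vel (W y)) z v'.
Hypothesis ds : is_derive (fun y => ent (W y)) z s'.

Let p' := d1 (pr g) (rho (W z)) (ent (W z)) * r'
          + d2 (pr g) (rho (W z)) (ent (W z)) * s'.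
Let E' := vel (W z) * v' + pressure g (W z) / rho (W z) ^ 2 * r'
          + temp g (rho (W z)) (ent (W z)) * s'.

Lemma pressure_derive : is_derive (fun y => pressure g (W y)) z p'.
Proof.
  apply (is_derive_path (pr g) (fun y => rho (W y)) (fun y => ent (W y)));
    [now apply pr_diff|exact dr|exact ds].
Qed.

Lemma energy_derive : is_derive (fun y => energy g (W y)) z E'.
Proof.
  unfold energy, E'.
  evar_last.
  - apply is_derive_Rplus.
    + apply (is_derive_ext (fun y => / 2 * (vel (W y) * vel (W y)))).
      { intros y. change (/ 2 * (vel (W y) * vel (W y)) = vel (W y) ^ 2 / 2). field. }
      apply is_derive_Rscal. apply is_derive_Rmult; exact dv.
    + apply (is_derive_path (en g) (fun y => rho (W y)) (fun y => ent (W y)));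
        [now apply en_diff|exact dr|exact ds].
  - rewrite (gibbs_rho g Hg), (gibbs_ent g Hg) by assumption.
    unfold pressure. field. lra.
Qed.

Definition density_rate (k : law) : R :=
  match k with
  | Mass => r'
  | Momentum => r' * vel (W z) + rho (W z) * v'
  | Energy => r' * energy g (W z) + rho (W z) * E'
  end.

Definition flux_rate (k : law) : R :=
  match k with
  | Mass => r' * vel (W z) + rho (W z) * v'
  | Momentum => r' * vel (W z) ^ 2 + 2 * rho (W z) * vel (W z) * v' + p'
  | Energy => v' * (rho (W z) * energy g (W z) + pressure g (W z))
              + vel (W z) * (r' * energy g (W z) + rho (W z) * E' + p')
  end.

Lemma density_derive (k : law) :
  is_derive (fun y => density g k (W y)) z (density_rate k).
Proof.
  destruct k; simpl.
  - exact dr.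
  - now apply is_derive_Rmult.
  - apply is_derive_Rmult; [exact dr|exact energy_derive].
Qed.

Lemma flux_derive (k : law) :
  is_derive (fun y => flux g k (W y)) z (flux_rate k).
Proof.
  destruct k; simpl.
  - now apply is_derive_Rmult.
  - apply is_derive_Rplus; [|exact pressure_derive].
    evar_last.
    + apply is_derive_Rmult; [exact dr|].
      apply is_derive_Rmult; [exact dv|].
      apply is_derive_Rmult; [exact dv|]. apply @is_derive_const.
    + unfold zero; simpl. ring.
  - apply (is_derive_Rmult (fun y => vel (W y))
      (fun y => rho (W y) * energy g (W y) + pressure g (W y))); [exact dv|].
    apply (is_derive_Rplus (fun y => rho (W y) * energy g (W y)));
      [|exact pressure_derive].
    apply is_derive_Rmult; [exact dr|exact energy_derive].
Qed.

End Primitive.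

Set Implicit Arguments.

(** Mass, momentum and entropy equations for the values and the partial
    derivatives of a solution at a point, [1] and [2] referring to [x] and [t].
    They are stated on numbers so that they also apply to limits at the origin. *)
Record euler_jet (U : state) (r1 r2 v1 v2 s1 s2 : R) : Prop := {
  jet_mass : r2 + vel U * r1 + rho U * v1 = 0;
  jet_momentum : rho U * (v2 + vel U * v1) + csound g U * csound g U * r1
    + d2 (pr g) (rho U) (ent U) * s1 = 0;
  jet_entropy : s2 + vel U * s1 = 0 }.

Unset Implicit Arguments.

(** By the Gibbs relation, the energy equation minus suitable multiples of the
    mass and momentum equations is [rho T (s_t + u s_x) = 0]. *)
Lemma euler_primitive (D : R -> R -> Prop) (w : R -> R -> state) (x t : R) :
  euler_on g D w -> D x t -> 0 < rho (w x t) ->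
  diff2 (fun y h => rho (w y h)) x t ->
  diff2 (fun y h => vel (w y h)) x t ->
  diff2 (fun y h => ent (w y h)) x t ->
  euler_jet (w x t)
    (d1 (fun y h => rho (w y h)) x t) (d2 (fun y h => rho (w y h)) x t)
    (d1 (fun y h => vel (w y h)) x t) (d2 (fun y h => vel (w y h)) x t)
    (d1 (fun y h => ent (w y h)) x t) (d2 (fun y h => ent (w y h)) x t).
Proof.
  intros HE HD Hp Hr Hv Hs.
  set (r1 := d1 (fun y h => rho (w y h)) x t).
  set (r2 := d2 (fun y h => rho (w y h)) x t).
  set (v1 := d1 (fun y h => vel (w y h)) x t).
  set (v2 := d2 (fun y h => vel (w y h)) x t).
  set (s1 := d1 (fun y h => ent (w y h)) x t).
  set (s2 := d2 (fun y h => ent (w y h)) x t).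
  assert (H : forall k, density_rate (fun h => w x h) t r2 v2 s2 k
                        + flux_rate (fun y => w y t) x r1 v1 s1 k = 0).
  { intros k. rewrite <- (HE k x t HD). unfold d1, d2. f_equal; symmetry.
    - apply is_derive_unique, density_derive; [exact Hp| | |].
      + exact (diff2_derive2 _ _ _ Hr).
      + exact (diff2_derive2 _ _ _ Hv).
      + exact (diff2_derive2 _ _ _ Hs).
    - apply is_derive_unique, flux_derive; [exact Hp| | |].
      + exact (diff2_derive1 _ _ _ Hr).
      + exact (diff2_derive1 _ _ _ Hv).
      + exact (diff2_derive1 _ _ _ Hs). }
  pose proof (H Mass) as HM. pose proof (H Momentum) as HP.
  pose proof (H Energy) as HEn. simpl in HM, HP, HEn.
  pose proof (sound_sqr _ (ent (w x t)) Hp) as Hc.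
  pose proof (temp_pos g Hg _ (ent (w x t)) Hp) as HT.
  assert (J1 : r2 + vel (w x t) * r1 + rho (w x t) * v1 = 0) by lra.
  assert (J2 : rho (w x t) * (v2 + vel (w x t) * v1)
     + csound g (w x t) * csound g (w x t) * r1
    + d2 (pr g) (rho (w x t)) (ent (w x t)) * s1 = 0).
  { unfold csound. rewrite <- Hc.
    replace 0 with (0 - vel (w x t) * 0) by ring.
    rewrite <- J1 at 2. rewrite <- HP. ring. }
  split; [exact J1|exact J2|].
  set (R := rho (w x t)) in *. set (V := vel (w x t)) in *.
  set (T := temp g R (ent (w x t))) in *.
  set (P := pressure g (w x t)) in *.
  assert (HH : R * T * (s2 + V * s1) = 0).
  { unfold csound in J2. fold R in J2. rewrite <- Hc in J2.
    transitivity (0 - (energy g (w x t) + P / R) * 0 - V * 0); [|ring].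
    rewrite <- HEn at 1. rewrite <- J1 at 1. rewrite <- J2.
    field. lra. }
  apply Rmult_integral in HH. destruct HH as [HH|HH]; [|exact HH].
  apply Rmult_integral in HH. lra.
Qed.

End Eos.

(** * Potentials for the isentropic part of psi *)

(** [Psi] and [K] such that [d Psi = (c / rho) drho + (K + p_s / (rho c)) ds];
    then [d (u + Psi) = du + dp / (rho c) + K ds]. *)
Definition potential (g : eos) (Psi K : R -> R -> R) : Prop :=
  forall r s, 0 < r ->
    differentiable_pt_lim Psi r s (sound g r s / r)
      (K r s + / (r * sound g r s) * d2 (pr g) r s) /\
    continuity_2d_pt K r s.

Section JetAlgebra.

Variables (g : eos) (U : state) (r1 r2 v1 v2 s1 s2 K : R).
Hypothesis HJ : euler_jet g U r1 r2 v1 v2 s1 s2.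
Hypothesis Hr : 0 < rho U.
Hypothesis Hc : 0 < csound g U.

Let c := csound g U.
Let ps := d2 (pr g) (rho U) (ent U).
Let Psi_s := K + / (rho U * c) * ps.

(** The derivative of psi along [dx/dt = u + c] is the source [c K s_x]. *)
Lemma jet_plus :
  (v2 + (vel U + c) * v1) + c / rho U * (r2 + (vel U + c) * r1)
    + Psi_s * (s2 + (vel U + c) * s1) = c * K * s1.
Proof.
  destruct HJ as [JM JP JS]. fold c in JP, Hc. fold ps in JP.
  assert (ER : r2 = - (vel U * r1) - rho U * v1) by lra.
  assert (ES : s2 = - (vel U * s1)) by lra.
  assert (EV : v2 = - (vel U * v1) - (c * c * r1 + ps * s1) / rho U).
  { apply Rmult_eq_reg_l with (rho U); [|lra].
    transitivity (rho U * v2 - 0); [ring|]. rewrite <- JP at 1. field. lra. }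
  unfold Psi_s. rewrite ER, ES, EV. field. lra.
Qed.

(** The derivatives of psi along the two families differ by [2 c psi_x]. At the
    head, this expresses the one along [u - c] by the initial data. *)
Lemma jet_minus :
  (v2 + (vel U - c) * v1) + c / rho U * (r2 + (vel U - c) * r1)
    + Psi_s * (s2 + (vel U - c) * s1)
  = - 2 * c * (v1 + c / rho U * r1 + Psi_s * s1) + c * K * s1.
Proof.
  pose proof jet_plus as H. lra.
Qed.

(** At the tail, the same derivative yields the combination of material
    derivatives that the theorem is about. *)
Lemma jet_material :
  (v2 + (vel U - c) * v1) + c / rho U * (r2 + (vel U - c) * r1)
    + Psi_s * (s2 + (vel U - c) * s1)
  = 2 * ((v2 + vel U * v1) + / (rho U * c) *
         (c * c * r2 + ps * s2 + vel U * (c * c * r1 + ps * s1)))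
    + K * (s2 + (vel U - c) * s1).
Proof.
  pose proof (jet_momentum HJ) as JP. fold c in JP, Hc. fold ps in JP.
  pose proof (jet_mass HJ) as JM.
  pose proof (jet_entropy HJ) as JS.
  assert (ER : r2 = - (vel U * r1) - rho U * v1) by lra.
  assert (ES : s2 = - (vel U * s1)) by lra.
  assert (EV : v2 = - (vel U * v1) - (c * c * r1 + ps * s1) / rho U).
  { apply Rmult_eq_reg_l with (rho U); [|lra].
    transitivity (rho U * v2 - 0); [ring|]. rewrite <- JP at 1. field. lra. }
  unfold Psi_s. rewrite ER, ES, EV. field. lra.
Qed.

End JetAlgebra.

(** * The integral of the sound speed *)

Lemma continuous_slice (h : R -> R -> R) (o s : R) :
  continuity_2d_pt h o s -> continuous (fun z => h z s) o.
Proof.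
  intros H. apply (filterlim_2d R (locally o) h (fun z => z) (fun _ => s)); auto.
  - apply filterlim_id.
  - apply filterlim_const.
Qed.

Lemma ex_RInt_pos (h : R -> R -> R) (a b s : R) :
  (forall o s, 0 < o -> continuity_2d_pt h o s) -> 0 < a -> 0 < b ->
  ex_RInt (fun o => h o s) a b.
Proof.
  intros Hh Ha Hb. apply (ex_RInt_continuous (V := CR)).
  intros z Hz. apply continuous_slice, Hh.
  apply Rlt_le_trans with (2 := proj1 Hz). now apply Rmin_glb_lt.
Qed.

(** Uniform continuity of the integrand controls the change of parameter, a
    bound of the integrand the change of end point. *)
Lemma RInt_param_continuous (h : R -> R -> R) (r0 r s : R) :
  (forall o s, 0 < o -> continuity_2d_pt h o s) -> 0 < r0 -> 0 < r ->
  continuity_2d_pt (fun r s => RInt (fun o => h o s) r0 r) r s.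
Proof.
  intros Hh Hr0 Hr e.
  set (a := Rmin r0 (r / 2)). set (b := Rmax r0 (2 * r)).
  assert (Hab : 0 < a /\ a <= r0 /\ a <= r / 2 /\ r0 <= b /\ 2 * r <= b).
  { split; [apply Rmin_pos; lra|]. split; [apply Rmin_l|]. split; [apply Rmin_r|].
    split; [apply Rmax_l|apply Rmax_r]. }
  pose proof (cond_pos e) as He.
  assert (HB : exists B, 0 < B /\ forall o, a <= o <= b -> Rabs (h o s) <= B).
  { apply (cont_on_bounded a b); [lra|]. apply cont_on_continuous.
    intros o Ho. apply continuous_slice, Hh. lra. }
  destruct HB as [B [HB HBb]].
  destruct (small_factor 1 (b - a) (e / 2) Rlt_0_1 ltac:(lra)) as [n [Hn HnK]].
  destruct (uniform_continuity_2d_1d h a b s (fun o Ho => Hh o s ltac:(lra))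
    (mkposreal n (proj1 Hn))) as [d Hd]. simpl in Hd. pose proof (cond_pos d) as Hdp.
  assert (Hdiff : forall o v, a <= o <= b -> Rabs (v - s) < d -> Rabs (h o v - h o s) <= n).
  { intros o v Ho Hv. left. apply Rabs_lt_between in Hv.
    apply Hd; try lra. rewrite Rminus_diag, Rabs_R0. lra. }
  destruct (small_factor (Rmin d (r / 2)) (B + 1) (e / 2)) as [q [Hq HqB]];
    [apply Rmin_pos; lra|lra|].
  Rmin_bounds (Rmin d (r / 2)).
  exists (mkposreal q (proj1 Hq)). simpl. intros r' s' Hr' Hs'.
  assert (Hr'b : r / 2 < r' /\ r' < 2 * r) by (apply Rabs_lt_between in Hr'; lra).
  rewrite <- (RInt_Chasles (V := CR) (fun o => h o s') r0 r r')
    by (apply ex_RInt_pos; auto; lra).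
  assert (E1 : Rabs (RInt (fun o => h o s') r0 r - RInt (fun o => h o s) r0 r) <= n * (b - a)).
  { pose proof (RInt_minus (V := CR) (fun o => h o s') (fun o => h o s) r0 r
      (ex_RInt_pos h r0 r s' Hh Hr0 Hr) (ex_RInt_pos h r0 r s Hh Hr0 Hr)) as EM.
    change (RInt (fun o => h o s') r0 r - RInt (fun o => h o s) r0 r)
      with (minus (RInt (V := CR) (fun o => h o s') r0 r)
                  (RInt (V := CR) (fun o => h o s) r0 r)).
    rewrite <- EM.
    apply Rle_trans with (Rabs (r - r0) * n).
    - apply (norm_RInt_le_const_abs (V := R_NormedModule) (fun o => minus (h o s') (h o s)) r0 r).
      + intros o Ho. apply Hdiff; [|lra].
        unfold Rmin, Rmax in Ho. repeat destruct Rle_dec; lra.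
      + apply (RInt_correct (V := CR)).
        apply (ex_RInt_minus (V := R_NormedModule)); now apply ex_RInt_pos.
    - rewrite Rmult_comm. apply Rmult_le_compat_l; [lra|].
      abs_lra. }
  assert (E2 : Rabs (RInt (fun o => h o s') r r') <= Rabs (r' - r) * (B + n)).
  { apply (norm_RInt_le_const_abs (V := R_NormedModule) (fun o => h o s') r r').
    - intros o Ho.
      assert (Hob : a <= o <= b) by (unfold Rmin, Rmax in Ho; repeat destruct Rle_dec; lra).
      change (Rabs (h o s') <= B + n).
      replace (h o s') with (h o s + (h o s' - h o s)) by ring.
      apply Rle_trans with (1 := Rabs_triang _ _).
      apply Rplus_le_compat; [now apply HBb|]. apply Hdiff; [exact Hob|lra].
    - apply (RInt_correct (V := CR)). apply ex_RInt_pos; auto; lra. }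
  assert (E3 : Rabs (r' - r) * (B + n) <= e / 2).
  { apply Rle_trans with (q * (B + 1)); [|lra].
    apply Rmult_le_compat; try lra. apply Rabs_pos. }
  change (Rabs (RInt (fun o => h o s') r0 r + RInt (fun o => h o s') r r'
                - RInt (fun o => h o s) r0 r) < e).
  abs_lra.
Qed.

Section Generic.

Variables (g : eos) (b : lower_limit).
Hypothesis Hg : eos_ok g.
Hypothesis Hb : admissible g b.

Lemma sound_ent_derive (r s : R) : 0 < r ->
  is_derive (fun z => sound g r z) s (d2 (d1 (pr g)) r s / (2 * sound g r s)).
Proof.
  intros Hr.
  assert (HD : is_derive (fun z => d1 (pr g) r z) s (d2 (d1 (pr g)) r s)).
  { apply Derive_correct. apply (pr_C2 g Hg r s Hr). }
  evar_last.
  - apply (is_derive_comp sqrt (fun z => d1 (pr g) r z) s); [|exact HD].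
    apply is_derive_Reals, derivable_pt_lim_sqrt. now apply pr_incr.
  - unfold scal; simpl; unfold mult; simpl. unfold sound, Rdiv. ring.
Qed.

Lemma sound_2E (r s : R) : 0 < r ->
  d2 (sound g) r s = d2 (d1 (pr g)) r s / (2 * sound g r s).
Proof. intros Hr. apply is_derive_unique. now apply sound_ent_derive. Qed.

Lemma inv_cont (r s : R) : 0 < r -> continuity_2d_pt (fun o _ => / o) r s.
Proof. intros Hr. apply continuity_2d_pt_inv; [apply continuity_2d_pt_id1|lra]. Qed.

Lemma sound_2_cont (r s : R) : 0 < r -> continuity_2d_pt (d2 (sound g)) r s.
Proof.
  intros Hr.
  apply (continuity_2d_pt_ext_loc (fun r s => d2 (d1 (pr g)) r s * / (2 * sound g r s))).
  { apply locally_pos; [assumption|]. intros. now rewrite sound_2E. }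
  apply continuity_2d_pt_mult.
  - apply (pr_C2 g Hg r s Hr).
  - apply continuity_2d_pt_inv.
    + apply continuity_2d_pt_mult; [apply continuity_2d_pt_const|now apply sound_cont].
    + pose proof (sound_pos g Hg r s Hr). lra.
Qed.

Lemma sound_ratio_cont (r s : R) : 0 < r -> continuity_2d_pt (fun o s => sound g o s / o) r s.
Proof.
  intros Hr. apply continuity_2d_pt_mult; [now apply sound_cont|now apply inv_cont].
Qed.

Lemma sound_ent_ratio_cont (r s : R) : 0 < r ->
  continuity_2d_pt (fun o s => / o * d2 (sound g) o s) r s.
Proof.
  intros Hr. apply continuity_2d_pt_mult; [now apply inv_cont|now apply sound_2_cont].
Qed.

Lemma lower_proper : ProperFilter' (lower_filter b).
Proof.
  destruct b as [r0|]; simpl.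
  - apply Proper_StrongProper, at_point_filter.
  - apply Proper_StrongProper, at_right_proper_filter.
Qed.

Lemma lower_ex (r s : R) : 0 < r ->
  ex_RInt_gen (fun o => sound g o s / o) (lower_filter b) (at_point r).
Proof.
  intros Hr. destruct b as [r0|]; simpl in *.
  - exists (RInt (fun o => sound g o s / o) r0 r).
    apply is_RInt_gen_at_point, (RInt_correct (V := CR)).
    now apply (ex_RInt_pos (fun o s => sound g o s / o) r0 r s sound_ratio_cont).
  - apply (Hb r s Hr).
Qed.

(** Whatever the lower limit, the dependence on the density is that of an
    integral between positive densities. *)
Lemma sound_int_split (r z s : R) : 0 < r -> 0 < z ->
  sound_int g b z s = sound_int g b r s + RInt (fun o => sound g o s / o) r z.
Proof.
  intros Hr Hz.
  pose proof (ex_RInt_pos (fun o s => sound g o s / o) r z s sound_ratio_cont Hr Hz) as EX.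
  cbv beta in EX.
  rewrite <- (RInt_gen_at_point (V := CR) _ r z EX).
  symmetry. apply (@RInt_gen_Chasles CR (lower_filter b) (at_point z)
      lower_proper (Proper_StrongProper _ (at_point_filter z))
      (fun o => sound g o s / o) r (lower_ex r s Hr)).
  exists (RInt (fun o => sound g o s / o) r z).
  now apply is_RInt_gen_at_point, (RInt_correct (V := CR)).
Qed.

Lemma sound_int_1 (r s : R) : 0 < r ->
  is_derive (fun z => sound_int g b z s) r (sound g r s / r).
Proof.
  intros Hr.
  apply (is_derive_ext_loc (fun z => sound_int g b r s + RInt (fun o => sound g o s / o) r z)).
  { exists (mkposreal r Hr). intros z Hz. change (Rabs (z - r) < r) in Hz.
    apply Rabs_lt_between in Hz. symmetry. apply sound_int_split; lra. }
  replace (sound g r s / r) with (0 + sound g r s / r) by ring.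
  apply is_derive_Rplus; [apply @is_derive_const|].
  apply (is_derive_RInt (fun o => sound g o s / o) _ r).
  - exists (mkposreal r Hr). intros z Hz. change (Rabs (z - r) < r) in Hz.
    apply Rabs_lt_between in Hz. apply (RInt_correct (V := CR)).
    apply (ex_RInt_pos (fun o s => sound g o s / o) r z s sound_ratio_cont Hr). lra.
  - apply (continuous_slice (fun o s => sound g o s / o)). now apply sound_ratio_cont.
Qed.

(** Differentiation under the integral sign for a positive reference density;
    for the vacuum, part of admissibility. *)
Lemma sound_int_2 (r s : R) : 0 < r ->
  is_derive (fun z => sound_int g b r z) s (sound_ent_int g b r s) /\
  continuity_2d_pt (sound_ent_int g b) r s.
Proof.
  intros Hr. destruct b as [r0|]; [|apply (Hb r s Hr)]. simpl in Hb.
  assert (E : forall r s, 0 < r ->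
    sound_ent_int g (Density r0) r s = RInt (fun o => / o * d2 (sound g) o s) r0 r).
  { intros r' s' Hr'. apply (RInt_gen_at_point (V := CR)).
    now apply (ex_RInt_pos (fun o s => / o * d2 (sound g) o s) r0 r' s' sound_ent_ratio_cont). }
  split.
  - apply (is_derive_ext (fun z => RInt (fun o => sound g o z / o) r0 r)).
    { intros z. symmetry. apply (RInt_gen_at_point (V := CR)).
      now apply (ex_RInt_pos (fun o s => sound g o s / o) r0 r z sound_ratio_cont). }
    assert (HD : forall o z, 0 < o ->
      is_derive (fun s => sound g o s / o) z (/ o * d2 (sound g) o z)).
    { intros o z Ho. rewrite sound_2E by assumption.
      apply (is_derive_ext (fun s => / o * sound g o s)).
      { intros y. apply Rmult_comm. }
      apply is_derive_Rscal. now apply sound_ent_derive. }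
    assert (Hpos : forall o, Rmin r0 r <= o <= Rmax r0 r -> 0 < o).
    { intros o Ho. apply Rlt_le_trans with (2 := proj1 Ho). now apply Rmin_glb_lt. }
    rewrite E by assumption.
    replace (RInt (fun o => / o * d2 (sound g) o s) r0 r)
      with (RInt (fun o => Derive (fun z => sound g o z / o) s) r0 r).
    + apply (is_derive_RInt_param (fun z o => sound g o z / o) r0 r s).
      * apply filter_forall. intros z o Ho. eexists. now apply HD, Hpos.
      * intros o Ho. specialize (Hpos o Ho).
        apply (continuity_2d_pt_ext_loc (fun z o => / o * d2 (sound g) o z)).
        { exists (mkposreal o Hpos). simpl. intros z o' _ Ho'.
          apply Rabs_lt_between in Ho'. symmetry. apply is_derive_unique, HD. lra. }
        intros e. destruct (sound_ent_ratio_cont o s Hpos e) as [d Hd].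
        exists d. intros z o' Hz Ho'. now apply Hd.
      * apply filter_forall. intros z.
        now apply (ex_RInt_pos (fun o s => sound g o s / o) r0 r z sound_ratio_cont).
    + apply RInt_ext. intros o Ho. apply is_derive_unique, HD, Hpos. lra.
  - apply (continuity_2d_pt_ext_loc (fun r s => RInt (fun o => / o * d2 (sound g) o s) r0 r)).
    { apply locally_pos; [assumption|]. intros. now rewrite E. }
    apply (RInt_param_continuous (fun o s => / o * d2 (sound g) o s)); auto.
    exact sound_ent_ratio_cont.
Qed.

Lemma generic_potential : potential g (sound_int g b) (Kfun g b).
Proof.
  intros r s Hr. split.
  - replace (Kfun g b r s + / (r * sound g r s) * d2 (pr g) r s)
      with (sound_ent_int g b r s) by (unfold Kfun; ring).
    apply (differentiable_of_partials _ (fun r s => sound g r s / r)).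
    + apply locally_pos; [assumption|]. intros. now apply sound_int_1.
    + now apply sound_int_2.
    + now apply sound_ratio_cont.
  - apply continuity_2d_pt_plus; [|now apply sound_int_2].
    apply continuity_2d_pt_opp, continuity_2d_pt_mult; [|now apply pr_2_cont].
    apply continuity_2d_pt_inv.
    + apply continuity_2d_pt_mult; [apply continuity_2d_pt_id1|now apply sound_cont].
    + pose proof (sound_pos g Hg r s Hr). nra.
Qed.

End Generic.

(** * The potential of a polytropic gas *)

Section Polytropic.

Variables (g : eos) (gamma cv : R) (A : R -> R).
Hypothesis Hg : eos_ok g.
Hypothesis Hgamma : 1 < gamma.
Hypothesis Hcv : 0 < cv.
Hypothesis Hpoly : forall r s, 0 < r ->
  pr g r s = A s * Rpower r gamma /\
  en g r s = pr g r s / ((gamma - 1) * r) /\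
  en g r s = cv * temp g r s.

Let k := gamma * (gamma - 1).

(** [T = kappa c^2] and [K = T / c = kappa c]. *)
Definition kappa : R := / (gamma * (gamma - 1) * cv).

(** [c^2 = gamma p / rho = gamma (gamma - 1) e], and [e] is proportional to [T]. *)
Lemma polytropic_sound (r s : R) : 0 < r ->
  sound g r s * sound g r s = k * en g r s /\ 0 < en g r s /\
  temp g r s = kappa * (sound g r s * sound g r s) /\
  pr g r s = (gamma - 1) * r * en g r s.
Proof.
  intros Hr. destruct (Hpoly r s Hr) as [E1 [E2 E3]].
  pose proof (temp_pos g Hg r s Hr) as HT.
  assert (HE : 0 < en g r s) by (rewrite E3; now apply Rmult_lt_0_compat).
  assert (EP : pr g r s = (gamma - 1) * r * en g r s) by (rewrite E2; field; lra).
  assert (ES : sound g r s * sound g r s = k * en g r s).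
  { rewrite <- (sound_sqr g Hg) by assumption.
    assert (HD : is_derive (fun z => pr g z s) r (A s * (gamma * Rpower r (gamma - 1)))).
    { apply (is_derive_ext_loc (fun z => A s * Rpower z gamma)).
      - exists (mkposreal r Hr). intros z Hz. change (Rabs (z - r) < r) in Hz.
        apply Rabs_lt_between in Hz. symmetry. apply (Hpoly z s). lra.
      - apply is_derive_Rscal. now apply is_derive_Reals, derivable_pt_lim_power. }
    rewrite (is_derive_unique _ _ _ HD : d1 (pr g) r s = _).
    unfold Rminus. rewrite Rpower_plus, Rpower_Ropp, Rpower_1 by assumption.
    rewrite E2, E1. unfold k. field. lra. }
  split; [exact ES|]. split; [exact HE|]. split; [|exact EP].
  rewrite ES, E3. unfold kappa, k. field. lra.
Qed.

(** The sound speed is a function of [e] alone, so that its differential is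
    given by the Gibbs relation; [p_s = (gamma - 1) rho T] because
    [p = (gamma - 1) rho e]. *)
Lemma polytropic_potential :
  potential g (fun r s => 2 * sound g r s / (gamma - 1)) (fun r s => kappa * sound g r s).
Proof.
  intros r s Hr. split.
  2:{ apply continuity_2d_pt_mult; [apply continuity_2d_pt_const|now apply sound_cont]. }
  destruct (polytropic_sound r s Hr) as [ES [HE [HT EP]]].
  pose proof (sound_pos g Hg r s Hr) as Hc.
  assert (Hk : 0 < k) by (unfold k; apply Rmult_lt_0_compat; lra).
  assert (Esqrt : forall r s, 0 < r -> sqrt (k * en g r s) = sound g r s).
  { intros r' s' Hr'. destruct (polytropic_sound r' s' Hr') as [<- _].
    apply sqrt_square. left. now apply sound_pos. }
  apply (differentiable_pt_lim_ext (fun r s => 2 / (gamma - 1) * sqrt (k * en g r s))).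
  { apply locally_pos; [assumption|]. intros r' s' Hr'. rewrite Esqrt by assumption.
    field. lra. }
  assert (HD : is_derive (fun u => 2 / (gamma - 1) * sqrt (k * u)) (en g r s)
                 (gamma / sound g r s)).
  { evar_last.
    - apply is_derive_Rscal.
      apply (is_derive_comp sqrt (fun u => k * u)).
      + apply is_derive_Reals, derivable_pt_lim_sqrt. now apply Rmult_lt_0_compat.
      + apply is_derive_Rscal. apply @is_derive_id.
    - unfold scal, one; simpl; unfold mult, one; simpl. rewrite Esqrt by assumption.
      unfold k. field. lra. }
  pose proof (differentiable_pt_lim_comp (fun u _ => 2 / (gamma - 1) * sqrt (k * u))
    (en g) (en g) r s _ _ _ _ _ _
    (differentiable_pt_lim_proj1_0 (fun u => 2 / (gamma - 1) * sqrt (k * u)) _ (en g r s) _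
      (proj1 (is_derive_Reals _ _ _) HD))
    (en_diff g Hg r s Hr) (en_diff g Hg r s Hr)) as HF.
  rewrite (gibbs_rho g Hg), (gibbs_ent g Hg) in HF by assumption.
  assert (Eps : d2 (pr g) r s = (gamma - 1) * r * temp g r s).
  { rewrite <- (gibbs_ent g Hg) by assumption. unfold d2.
    rewrite <- Derive_scal. apply Derive_ext. intros z.
    now destruct (polytropic_sound r z Hr) as [_ [_ [_ ->]]]. }
  rewrite Eps.
  replace (sound g r s / r) with (gamma / sound g r s * (pr g r s / r ^ 2) + 0 * (pr g r s / r ^ 2)).
  2:{ rewrite EP. apply Rmult_eq_reg_l with (sound g r s * r); [|nra].
      transitivity (k * en g r s); [unfold k; field; lra|]. rewrite <- ES. field. lra. }
  replace (kappa * sound g r s + / (r * sound g r s) * ((gamma - 1) * r * temp g r s))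
    with (gamma / sound g r s * temp g r s + 0 * temp g r s); [exact HF|].
  rewrite HT. field. lra.
Qed.

End Polytropic.

(** * One-sided jets at the origin *)

Definition near_origin (D : R -> R -> Prop) : Prop :=
  forall d, 0 < d -> exists x t, Rabs x < d /\ Rabs t < d /\ D x t.

Lemma lim_in_unique (D : R -> R -> Prop) (f : R -> R -> R) (l l' : R) :
  near_origin D -> lim_in D f 0 0 l -> lim_in D f 0 0 l' -> l = l'.
Proof.
  intros HD H H'.
  assert (Hle : forall a b, lim_in D f 0 0 a -> lim_in D f 0 0 b -> a <= b).
  { intros a b Ha Hb. apply le_epsilon. intros e He.
    destruct (proj1 (lim_inP _ _ _ _ _) Ha (e / 2)) as [d [Hd Ha']]; [lra|].
    destruct (proj1 (lim_inP _ _ _ _ _) Hb (e / 2)) as [d' [Hd' Hb']]; [lra|].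
    destruct (HD (Rmin d d')) as [x [t [Hx [Ht HDx]]]]; [now apply Rmin_pos|].
    Rmin_bounds (Rmin d d').
    specialize (Ha' x t). specialize (Hb' x t). rewrite !Rminus_0_r in *.
    specialize (Ha' ltac:(lra) ltac:(lra) HDx).
    specialize (Hb' ltac:(lra) ltac:(lra) HDx).
    abs_lra. }
  apply Rle_antisym; apply Hle; assumption.
Qed.

Section Germ.

Variables (g : eos) (D : R -> R -> Prop) (w : R -> R -> state) (U : state).

Set Implicit Arguments.

(** The first-order jet of the solution at the origin, as seen from the region
    [D]: [U] is the limit of the state, the other arguments are the limits of
    its derivatives. *)
Record germ (r1 r2 v1 v2 s1 s2 : R) : Prop := {
  germ_near : near_origin D;
  germ_time : forall x t, D x t -> 0 < t;
  germ_pos : forall x t, D x t -> 0 < rho (w x t);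
  germ_pos0 : 0 < rho U;
  germ_lim : lim_state D w 0 0 U;
  germ_drho : forall x t, D x t -> diff2 (fun y h => rho (w y h)) x t;
  germ_dvel : forall x t, D x t -> diff2 (fun y h => vel (w y h)) x t;
  germ_dent : forall x t, D x t -> diff2 (fun y h => ent (w y h)) x t;
  germ_r1 : lim_in D (d1 (fun y h => rho (w y h))) 0 0 r1;
  germ_r2 : lim_in D (d2 (fun y h => rho (w y h))) 0 0 r2;
  germ_v1 : lim_in D (d1 (fun y h => vel (w y h))) 0 0 v1;
  germ_v2 : lim_in D (d2 (fun y h => vel (w y h))) 0 0 v2;
  germ_s1 : lim_in D (d1 (fun y h => ent (w y h))) 0 0 s1;
  germ_s2 : lim_in D (d2 (fun y h => ent (w y h))) 0 0 s2 }.

Unset Implicit Arguments.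

Hypothesis Hg : eos_ok g.
Variables (r1 r2 v1 v2 s1 s2 : R).
Hypothesis HJ : germ r1 r2 v1 v2 s1 s2.

Lemma germ_state (phi : R -> R -> R) :
  continuity_2d_pt phi (rho U) (ent U) ->
  lim_in D (fun x t => phi (rho (w x t)) (ent (w x t))) 0 0 (phi (rho U) (ent U)).
Proof.
  intros H. apply lim_in_comp2; [exact H| |]; apply (germ_lim HJ).
Qed.

(** The equations hold in [D] and each of their terms has a limit. *)
Lemma germ_euler : euler_on g D w -> euler_jet g U r1 r2 v1 v2 s1 s2.
Proof.
  intros HE.
  destruct (germ_lim HJ) as [Lr [Lv Ls]].
  pose proof (germ_pos0 HJ) as HU.
  assert (HP : forall x t, D x t -> euler_jet g (w x t)
    (d1 (fun y h => rho (w y h)) x t) (d2 (fun y h => rho (w y h)) x t)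
    (d1 (fun y h => vel (w y h)) x t) (d2 (fun y h => vel (w y h)) x t)
    (d1 (fun y h => ent (w y h)) x t) (d2 (fun y h => ent (w y h)) x t)).
  { intros x t HD. apply (euler_primitive g Hg D w x t HE HD).
    - exact (germ_pos HJ HD).
    - exact (germ_drho HJ HD).
    - exact (germ_dvel HJ HD).
    - exact (germ_dent HJ HD). }
  pose proof (germ_r1 HJ) as L1.
  pose proof (germ_r2 HJ) as L2.
  pose proof (germ_v1 HJ) as L3.
  pose proof (germ_v2 HJ) as L4.
  pose proof (germ_s1 HJ) as L5.
  pose proof (germ_s2 HJ) as L6.
  pose proof (germ_state (sound g) (sound_cont g Hg _ _ HU)) as Lc.
  pose proof (germ_state _ (pr_2_cont g Hg _ (ent U) HU)) as Lp.
  split; symmetry; apply (lim_in_unique D (fun _ _ => 0));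
    try exact (germ_near HJ); try apply lim_in_const.
  - eapply lim_in_ext; [intros x t HD; exact (jet_mass (HP x t HD))|].
    apply lim_in_plus; [apply lim_in_plus; [exact L2|]|]; apply lim_in_mult; assumption.
  - eapply lim_in_ext; [intros x t HD; exact (jet_momentum (HP x t HD))|].
    apply lim_in_plus; [apply lim_in_plus|]; apply lim_in_mult; try assumption.
    + apply lim_in_plus; [exact L4|]. apply lim_in_mult; assumption.
    + apply lim_in_mult; exact Lc.
  - eapply lim_in_ext; [intros x t HD; exact (jet_entropy (HP x t HD))|].
    apply lim_in_plus; [exact L6|]. apply lim_in_mult; assumption.
Qed.

Let q1 := csound g U * csound g U * r1 + d2 (pr g) (rho U) (ent U) * s1.
Let q2 := csound g U * csound g U * r2 + d2 (pr g) (rho U) (ent U) * s2.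

Lemma pressure_partials (x t : R) : D x t ->
  diff2 (fun y h => pressure g (w y h)) x t /\
  d1 (fun y h => pressure g (w y h)) x t =
    d1 (pr g) (rho (w x t)) (ent (w x t)) * d1 (fun y h => rho (w y h)) x t
    + d2 (pr g) (rho (w x t)) (ent (w x t)) * d1 (fun y h => ent (w y h)) x t /\
  d2 (fun y h => pressure g (w y h)) x t =
    d1 (pr g) (rho (w x t)) (ent (w x t)) * d2 (fun y h => rho (w y h)) x t
    + d2 (pr g) (rho (w x t)) (ent (w x t)) * d2 (fun y h => ent (w y h)) x t.
Proof.
  intros HD. apply diff2_of_lim.
  apply (differentiable_pt_lim_comp (pr g) (fun y h => rho (w y h)) (fun y h => ent (w y h))).
  - apply pr_diff; [exact Hg|]. exact (germ_pos HJ HD).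
  - exact (germ_drho HJ HD).
  - exact (germ_dent HJ HD).
Qed.

Lemma germ_pressure :
  lim_in D (d1 (fun y h => pressure g (w y h))) 0 0 q1 /\
  lim_in D (d2 (fun y h => pressure g (w y h))) 0 0 q2.
Proof.
  pose proof (germ_pos0 HJ) as HU.
  pose proof (germ_state _ (pr_1_cont g Hg _ (ent U) HU)) as L1.
  pose proof (germ_state _ (pr_2_cont g Hg _ (ent U) HU)) as L2.
  rewrite (sound_sqr g Hg) in L1 by exact HU.
  split.
  - eapply lim_in_ext.
    { intros x t HD. symmetry. apply (pressure_partials x t HD). }
    apply lim_in_plus; apply lim_in_mult; try assumption.
    + exact (germ_r1 HJ).
    + exact (germ_s1 HJ).
  - eapply lim_in_ext.
    { intros x t HD. symmetry. apply (pressure_partials x t HD). }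
    apply lim_in_plus; apply lim_in_mult; try assumption.
    + exact (germ_r2 HJ).
    + exact (germ_s2 HJ).
Qed.

End Germ.

(** * Regions of the wave pattern *)

Lemma curve_to_origin (X : R -> R) (k : R) : curve_from_origin X k -> rlim X 0.
Proof.
  intros [_ H]. assert (L : rlim (fun t => X t / t * t) (k * 0)) by right_lim.
  rewrite Rmult_0_r in L. apply filterlim_ext_loc with (2 := L).
  apply near_right. exists 1. split; [lra|]. intros t Ht. field. lra.
Qed.

Lemma curve_below_ray (X : R -> R) (k a : R) :
  curve_from_origin X k -> k < a -> at_right 0 (fun t => X t < a * t).
Proof.
  intros [_ H] Hka.
  destruct (proj1 (right_limP _ _) H (a - k)) as [d [Hd H']]; [lra|].
  apply near_right. exists d. split; [assumption|]. intros t Ht.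
  specialize (H' t Ht). apply Rabs_lt_between in H'.
  replace (X t) with (X t / t * t) by (field; lra).
  apply Rmult_lt_compat_r; lra.
Qed.

Lemma curve_above_ray (X : R -> R) (k a : R) :
  curve_from_origin X k -> a < k -> at_right 0 (fun t => a * t < X t).
Proof.
  intros [_ H] Hka.
  destruct (proj1 (right_limP _ _) H (k - a)) as [d [Hd H']]; [lra|].
  apply near_right. exists d. split; [assumption|]. intros t Ht.
  specialize (H' t Ht). apply Rabs_lt_between in H'.
  replace (X t) with (X t / t * t) by (field; lra).
  apply Rmult_lt_compat_r; lra.
Qed.

Lemma between_open (G : grp) (A B : R -> R) (x t : R) :
  continuity_pt A t -> continuity_pt B t ->
  between G A B x t -> locally_2d (between G A B) x t.
Proof.
  intros HA HB [Ht Hx].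
  assert (CA : continuity_2d_pt (fun u v => u - A v) x t).
  { apply continuity_2d_pt_minus; [apply continuity_2d_pt_id1|].
    apply (continuity_1d_2d_pt_comp A (fun _ v => v)); [exact HA|].
    apply continuity_2d_pt_id2. }
  assert (CB : continuity_2d_pt (fun u v => B v - u) x t).
  { apply continuity_2d_pt_minus; [|apply continuity_2d_pt_id1].
    apply (continuity_1d_2d_pt_comp B (fun _ v => v)); [exact HB|].
    apply continuity_2d_pt_id2. }
  assert (PA : 0 < x - A t) by lra. assert (PB : 0 < B t - x) by lra.
  destruct (CA (mkposreal _ PA)) as [ra Hra].
  destruct (CB (mkposreal _ PB)) as [rb Hrb]. simpl in Hra, Hrb.
  pose proof (cond_pos ra). pose proof (cond_pos rb).
  set (d := Rmin (Rmin ra rb) (Rmin t (tau G - t))).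
  assert (Hd : 0 < d /\ d <= ra /\ d <= rb /\ d <= t /\ d <= tau G - t).
  { unfold d. min_lra. }
  exists (mkposreal d ltac:(lra)). simpl. intros u v Hu Hv.
  specialize (Hra u v ltac:(lra) ltac:(lra)).
  specialize (Hrb u v ltac:(lra) ltac:(lra)).
  apply Rabs_lt_between in Hra. apply Rabs_lt_between in Hrb.
  apply Rabs_lt_between in Hv. split; lra.
Qed.

(** On a compact interval of times, the gap between the two curves has a
    positive minimum. *)
Lemma between_room (G : grp) (A B : R -> R) :
  (forall t, 0 < t < tau G -> continuity_pt A t /\ continuity_pt B t /\ A t < B t) ->
  room (between G A B) A (tau G) 1 /\ room (between G A B) B (tau G) (-1).
Proof.
  intros H.
  assert (HR : forall t1 t2, 0 < t1 -> t1 <= t2 -> t2 < tau G -> exists n0, 0 < n0 /\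
    forall n t, 0 < n < n0 -> t1 <= t <= t2 ->
    between G A B (A t + 1 * n) t /\ between G A B (B t + -1 * n) t).
  { intros t1 t2 H1 H12 H2.
    destruct (continuity_ab_min (fun t => B t - A t) t1 t2 H12) as [m [Hm Hm']].
    { intros c Hc. apply continuity_pt_minus; apply H; lra. }
    exists (B m - A m). split; [destruct (H m) as [_ [_ H']]; lra|].
    intros n t Hn Ht. specialize (Hm t Ht). unfold between. lra. }
  split; intros t1 t2 H1 H12 H2;
  destruct (HR t1 t2 H1 H12 H2) as [n0 [Hn0 Hn]];
  exists n0; (split; [assumption|]); intros n t Hn' Ht; now apply Hn.
Qed.

(** * The self-similar solution and the regions next to the wave *)

Section Solution.

Variables (g : eos) (G : grp).
Hypothesis Hg : eos_ok g.
Hypothesis HG : grp_solution g G.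

Let Hriem := grp_riemann g G HG.
Let HW := grp_pattern g G HG.
Let HS := grp_smooth g G HG.
Let HC := grp_coords g G HG.
Let Hfan := rs_rarefaction _ _ _ _ _ _ _ Hriem.

Definition fan_c (b : R) : R := vel (fan G b) - b.

Lemma beta_order : betaL g G < bstar G.
Proof. exact (fan_order _ _ _ _ Hfan). Qed.

Lemma fan_rho_pos (b : R) : betaL g G <= b <= bstar G -> 0 < rho (fan G b).
Proof. apply (fan_pos _ _ _ _ Hfan). Qed.

Lemma fan_entropy (b : R) :
  betaL g G <= b <= bstar G -> ent (fan G b) = ent (UL G).
Proof. apply (fan_ent _ _ _ _ Hfan). Qed.

Lemma fan_at_head : fan G (betaL g G) = UL G.
Proof. apply (fan_head _ _ _ _ Hfan). Qed.

Lemma fan_cE (b : R) : betaL g G <= b <= bstar G -> csound g (fan G b) = fan_c b.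
Proof.
  intros Hb. pose proof (fan_speed _ _ _ _ Hfan b Hb). unfold fan_c. lra.
Qed.

Lemma fan_c_pos (b : R) : betaL g G <= b <= bstar G -> 0 < fan_c b.
Proof.
  intros Hb. rewrite <- fan_cE by assumption.
  apply sound_pos; [exact Hg|]. now apply fan_rho_pos.
Qed.

Lemma speeds_order :
  bstar G < vel (U1star G) /\ vel (U1star G) = vel (U2star G) /\
  vel (U2star G) < sigma G.
Proof.
  pose proof beta_order as Hb.
  assert (Hb' : betaL g G <= bstar G <= bstar G) by lra.
  pose proof (fan_c_pos _ Hb') as Hc. unfold fan_c in Hc. unfold U1star.
  split; [lra|]. split.
  - apply (rs_contact _ _ _ _ _ _ _ Hriem).
  - apply (rs_shock _ _ _ _ _ _ _ Hriem).
Qed.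

Lemma curves_continuous (t : R) : 0 < t < tau G ->
  continuity_pt (Xhead G) t /\ continuity_pt (Xtail G) t /\
  continuity_pt (Xcontact G) t /\ continuity_pt (Xshock G) t.
Proof.
  intros Ht.
  assert (HD : forall X l, is_derive X t l -> continuity_pt X t).
  { intros X l H. apply continuity_pt_filterlim.
    apply (ex_derive_continuous X t). now exists l. }
  destruct (shock_curve g G HW t Ht) as [Ul [Ur [v [_ [_ [HX _]]]]]].
  repeat split; eapply HD.
  - apply (head_curve g G HW t Ht).
  - apply (tail_curve g G HW t Ht).
  - apply (contact_curve g G HW t Ht).
  - exact HX.
Qed.

Lemma in_box (x t : R) :
  Dleft G x t \/ Dwave G x t \/ D1 G x t \/ D2 G x t ->
  0 < t < tau G /\ - delta G < x < delta G /\ 0 < rho (w G x t).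
Proof.
  intros H.
  assert (HB : 0 < t < tau G /\ - delta G < x < delta G).
  { unfold Dleft, Dwave, D1, D2, between in H.
    destruct H as [H|[H|[H|H]]]; pose proof (curve_order g G HW t ltac:(lra)); lra. }
  split; [apply HB|]. split; [apply HB|]. now apply (no_vacuum g G HS).
Qed.

(** The one-sided limits exist by smoothness up to the boundary. The state is
    identified by the self-similar solution along a ray [x = a t] inside the
    region. *)
Lemma region_germ (A B : R -> R) (U : state) (a : R) :
  (forall t, 0 < t < tau G -> continuity_pt A t /\ continuity_pt B t) ->
  (forall x t, between G A B x t -> 0 < rho (w G x t)) ->
  smooth_up_to (between G A B) (between_closed G A B) (w G) ->
  A 0 <= 0 <= B 0 ->
  at_right 0 (fun t => between G A B (a * t) t) ->
  a <> vel (U2star G) -> a <> sigma G ->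
  RA g (UL G) (UR G) (fan G) (bstar G) (U2star G) (sigma G) a = U ->
  0 < rho U ->
  exists r1 r2 v1 v2 s1 s2, germ (between G A B) (w G) U r1 r2 v1 v2 s1 s2.
Proof.
  intros Hcont Hpos [[Sr Sr'] [[Sv Sv'] [Ss Ss']]] H0 Hray Ha1 Ha2 HRA HU.
  assert (H00 : between_closed G A B 0 0).
  { split; [|exact H0]. pose proof (box_pos g G HW). lra. }
  destruct (Sr' 0 0 H00) as [r [r1 [r2 [Lr [Lr1 Lr2]]]]].
  destruct (Sv' 0 0 H00) as [v [v1 [v2 [Lv [Lv1 Lv2]]]]].
  destruct (Ss' 0 0 H00) as [s [s1 [s2 [Ls [Ls1 Ls2]]]]].
  exists r1, r2, v1, v2, s1, s2.
  pose proof right_lim_id as Hid.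
  assert (Hat : rlim (fun t : R => a * t) 0).
  { rewrite <- (Rmult_0_r a) at 2. right_lim. }
  destruct (grp_rays g G HG a Ha1 Ha2) as [Rr [Rv Rs]]. rewrite HRA in Rr, Rv, Rs.
  assert (Hal : forall f l, lim_in (between G A B) f 0 0 l ->
     rlim (fun t => f (a * t) t) l).
  { intros f l Hf.
    apply (lim_in_along (between G A B) 0 0 R (at_right 0) f l (fun t => a * t) (fun t => t));
      assumption. }
  assert (Hr : r = rho U) by (eapply right_limU; [apply (Hal _ _ Lr)|exact Rr]).
  assert (Hv : v = vel U) by (eapply right_limU; [apply (Hal _ _ Lv)|exact Rv]).
  assert (Hs : s = ent U) by (eapply right_limU; [apply (Hal _ _ Ls)|exact Rs]).
  subst r v s.
  assert (Hop : forall x t, between G A B x t -> locally_2d (between G A B) x t).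
  { intros x t HD. apply between_open; [apply Hcont, HD|apply Hcont, HD|exact HD]. }
  assert (Hdiff : forall f, (forall x y, between G A B x y -> ex_diff_n f 1 x y) ->
     forall x t, between G A B x t -> diff2 f x t).
  { intros f Hf x t HD. apply diff2_C1. destruct (Hop x t HD) as [d Hd].
    exists d. intros. now apply Hf, Hd. }
  split; try assumption.
  - intros d Hd. destruct (proj1 (near_right _) Hray) as [d1 [Hd1 H1]].
    destruct (proj1 (right_limP _ _) Hat d Hd) as [d2 [Hd2 H2]].
    set (t := Rmin d (Rmin d1 d2) / 2). exists (a * t), t.
    assert (Ht : 0 < t /\ t < d /\ t < d1 /\ t < d2) by (unfold t; min_lra).
    specialize (H2 t ltac:(lra)). rewrite Rminus_0_r in H2.
    split; [exact H2|]. split; [abs_lra|]. apply H1. lra.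
  - intros x t [Ht _]. lra.
  - split; [exact Lr|split; [exact Lv|exact Ls]].
  - now apply Hdiff.
  - now apply Hdiff.
  - now apply Hdiff.
Qed.

Lemma const_continuous (k t : R) : continuity_pt (fun _ => k) t.
Proof. apply continuity_pt_const. intros x y. reflexivity. Qed.

Lemma left_germ :
  exists r1 r2 v1 v2 s1 s2, germ (Dleft G) (w G) (UL G) r1 r2 v1 v2 s1 s2.
Proof.
  pose proof beta_order as Hb. pose proof speeds_order as [O1 [O2 O3]].
  pose proof (box_pos g G HW) as [Htau Hdel].
  pose proof (head_origin g G HW) as Hh.
  apply (region_germ _ _ _ (betaL g G - 1)); try lra.
  - intros t Ht. split; [apply const_continuous|now apply curves_continuous].
  - intros x t HD. apply (in_box x t). now left.
  - exact (left_smooth g G HS).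
  - rewrite (proj1 Hh). lra.
  - apply (filter_imp (fun t => 0 < t < tau G /\ - delta G < (betaL g G - 1) * t
      /\ (betaL g G - 1) * t < Xhead G t)).
    { intros t Ht. split; lra. }
    apply filter_and; [|apply filter_and].
    + apply near_right. exists (tau G). tauto.
    + apply near_right. set (k := Rabs (betaL g G - 1) + 1).
      assert (Hk : 0 < k) by (pose proof (Rabs_pos (betaL g G - 1)); unfold k; lra).
      exists (delta G / k). split; [now apply Rdiv_lt_0_compat|]. intros t Ht.
      assert (Hkt : k * t < delta G).
      { apply Rmult_lt_div; lra. }
      assert (H : Rabs ((betaL g G - 1) * t) < delta G).
      { rewrite Rabs_mult, (Rabs_pos_eq t) by lra. unfold k in Hkt. lra. }
      abs_lra.
    + apply (curve_above_ray _ _ _ Hh). lra.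
  - unfold RA. destruct Rle_dec as [H|H]; [reflexivity|].
    exfalso. apply H. unfold betaL. lra.
  - apply (rs_pos _ _ _ _ _ _ _ Hriem).
Qed.

Lemma mid1_germ :
  exists r1 r2 v1 v2 s1 s2, germ (D1 G) (w G) (U1star G) r1 r2 v1 v2 s1 s2.
Proof.
  pose proof beta_order as Hb. pose proof speeds_order as [O1 [O2 O3]].
  pose proof (box_pos g G HW) as [Htau Hdel].
  pose proof (tail_origin g G HW) as Hh. pose proof (contact_origin g G HW) as Hk.
  set (a := (bstar G + vel (U1star G)) / 2).
  assert (Ha : bstar G < a < vel (U1star G)) by (unfold a; lra).
  apply (region_germ _ _ _ a); try lra.
  - intros t Ht. split; now apply curves_continuous.
  - intros x t HD. apply (in_box x t). tauto.
  - exact (mid1_smooth g G HS).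
  - rewrite (proj1 Hh), (proj1 Hk). lra.
  - apply (filter_imp (fun t => 0 < t < tau G /\ Xtail G t < a * t
      /\ a * t < Xcontact G t)).
    { intros t Ht. split; lra. }
    apply filter_and; [|apply filter_and].
    + apply near_right. exists (tau G). tauto.
    + apply (curve_below_ray _ _ _ Hh). lra.
    + apply (curve_above_ray _ _ _ Hk). lra.
  - unfold RA. destruct Rle_dec as [H|H]; [change (a <= betaL g G) in H; lra|].
    destruct Rle_dec as [H'|H']; [lra|].
    destruct Rlt_dec as [H''|H'']; [reflexivity|lra].
  - apply fan_rho_pos. lra.
Qed.

Lemma mid2_germ :
  exists r1 r2 v1 v2 s1 s2, germ (D2 G) (w G) (U2star G) r1 r2 v1 v2 s1 s2.
Proof.
  pose proof beta_order as Hb. pose proof speeds_order as [O1 [O2 O3]].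
  pose proof (box_pos g G HW) as [Htau Hdel].
  pose proof (shock_origin g G HW) as Hh. pose proof (contact_origin g G HW) as Hk.
  set (a := (sigma G + vel (U2star G)) / 2).
  assert (Ha : vel (U2star G) < a < sigma G) by (unfold a; lra).
  apply (region_germ _ _ _ a); try lra.
  - intros t Ht. split; now apply curves_continuous.
  - intros x t HD. apply (in_box x t). tauto.
  - exact (mid2_smooth g G HS).
  - rewrite (proj1 Hh), (proj1 Hk). lra.
  - apply (filter_imp (fun t => 0 < t < tau G /\ Xcontact G t < a * t
      /\ a * t < Xshock G t)).
    { intros t Ht. split; lra. }
    apply filter_and; [|apply filter_and].
    + apply near_right. exists (tau G). tauto.
    + apply (curve_below_ray _ _ _ Hk). lra.
    + apply (curve_above_ray _ _ _ Hh). lra.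
  - unfold RA. destruct Rle_dec as [H|H]; [change (a <= betaL g G) in H; lra|].
    destruct Rle_dec as [H'|H']; [lra|].
    destruct Rlt_dec as [H''|H'']; [lra|].
    destruct Rlt_dec; [reflexivity|lra].
  - apply (rs_pos _ _ _ _ _ _ _ Hriem).
Qed.

(** Increments of [F] are limits, as [t] tends to zero, of increments of [f] in
    space, and these are controlled by the limit of [d1 f] at the origin. *)
Lemma data_derivative (F : R -> R) (f : R -> R -> R) (l1 : R) :
  (forall x t, Dleft G x t -> diff2 f x t) ->
  lim_in (Dleft G) (d1 f) 0 0 l1 ->
  (forall x, - delta G < x < 0 -> lim_in (Dleft G) f x 0 (F x)) ->
  ex_derive F 0 -> Derive F 0 = l1.
Proof.
  intros Hf H1 Hdata HF0. apply Derive_correct in HF0.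
  set (L := Derive F 0) in *. clearbody L.
  destruct (box_pos g G HW) as [Htau Hdel].
  assert (Hseg : forall x2, x2 < 0 ->
     at_right 0 (fun t => forall x, - delta G < x -> x <= x2 -> Dleft G x t)).
  { intros x2 Hx2.
    destruct (proj1 (right_limP _ _) (curve_to_origin _ _ (head_origin g G HW)) (- x2))
      as [d [Hd H]]; [lra|].
    apply near_right. exists (Rmin d (tau G)). split; [now apply Rmin_pos|].
    intros t Ht x Hx Hxx. Rmin_bounds (Rmin d (tau G)).
    specialize (H t ltac:(lra)). split; abs_lra. }
  assert (Hin : forall r, 0 < r -> exists d, 0 < d /\ forall x1 x2,
     - d < x1 -> x1 < x2 -> x2 < 0 ->
     Rabs (F x2 - F x1 - l1 * (x2 - x1)) <= r * (x2 - x1)).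
  { intros r Hr. destruct (proj1 (lim_inP _ _ _ _ _) H1 r Hr) as [d [Hd H]].
    exists (Rmin d (delta G)). split; [now apply Rmin_pos|].
    intros x1 x2 Hx1 Hx12 Hx2.
    assert (Hx1' : - d < x1 /\ - delta G < x1).
    { Rmin_bounds (Rmin d (delta G)). lra. }
    assert (Hpath : forall x, - delta G < x < 0 -> x < x2 \/ x = x2 ->
       rlim (fun t => f x t) (F x)).
    { intros x Hx Hxx.
      apply (lim_in_along (Dleft G) x 0 R (at_right 0) f (F x) (fun _ => x) (fun t => t));
        [now apply Hdata|apply filterlim_const|exact right_lim_id|].
      generalize (Hseg x2 Hx2). apply filter_imp. intros t Ht. apply Ht; lra. }
    apply (lim_abs_le (fun t => f x2 t - f x1 t - l1 * (x2 - x1)) (fun _ => r * (x2 - x1))).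
    - right_lim; apply Hpath; lra.
    - right_lim.
    - assert (Hsmall : at_right 0 (fun t => 0 < t < d))
        by (apply near_right; exists d; split; [assumption|auto]).
      generalize (filter_and _ _ (Hseg x2 Hx2) Hsmall). apply filter_imp.
      intros t [HD Ht].
      apply (mvt_bound (fun x => f x t) (fun x => d1 f x t)); [lra| |].
      + intros x Hx. apply diff2_derive1, Hf, HD; lra.
      + intros x Hx. left. apply H; [abs_lra| |apply HD; lra].
        rewrite Rminus_0_r, Rabs_pos_eq; lra. }
  apply cond_eq. intros e He.
  destruct (Hin (e / 4)) as [d [Hd HI]]; [lra|].
  destruct (derive_small F L (e / 4) HF0) as [d' [Hd' HI']]; [lra|].
  set (x1 := - (Rmin d d' / 2)).
  assert (Hx1 : x1 < 0 /\ - d < x1 /\ - d' < x1).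
  { unfold x1. min_lra. }
  assert (HFc : rlim (fun n => F (0 - n)) (F 0)).
  { apply (filterlim_comp _ _ _ (fun n => 0 - n) F _ (locally 0)).
    - replace (locally 0) with (locally (0 - 0)) by (f_equal; ring). right_lim.
    - apply (ex_derive_continuous F 0). now exists L. }
  assert (HB : Rabs (F 0 - F x1 - l1 * (0 - x1)) <= e / 4 * (0 - x1)).
  { replace (0 - x1) with (0 - 0 - x1) by ring.
    apply (lim_abs_le (fun n => F (0 - n) - F x1 - l1 * (0 - n - x1))
      (fun n => e / 4 * (0 - n - x1))).
    - right_lim.
    - right_lim.
    - apply near_right. exists (- x1). split; [lra|]. intros n Hn. apply HI; lra. }
  specialize (HI' x1 ltac:(abs_lra)).
  rewrite (Rabs_left x1) in HI' by lra.
  apply Rabs_le_between in HB. apply Rabs_le_between in HI'.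
  apply Rabs_lt_between. split; nra.
Qed.

Lemma left_jet : exists r2 v2 s2,
  germ (Dleft G) (w G) (UL G)
    (Derive (fun x => rho (initL G x)) 0) r2
    (Derive (fun x => vel (initL G x)) 0) v2
    (Derive (fun x => ent (initL G x)) 0) s2.
Proof.
  destruct left_germ as [r1 [r2 [v1 [v2 [s1 [s2 HJ]]]]]].
  exists r2, v2, s2.
  pose proof (proj1 (data_smooth g G HS) 1%nat 0) as [Er [Ev Es]].
  rewrite (data_derivative _ _ r1 (germ_drho HJ)
    (germ_r1 HJ)), (data_derivative _ _ v1 (germ_dvel HJ)
    (germ_v1 HJ)), (data_derivative _ _ s1 (germ_dent HJ)
    (germ_s1 HJ)); try assumption;
  intros x Hx; apply (data_left g G HS x Hx).
Qed.

Lemma edges_room :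
  room (Dleft G) (Xhead G) (tau G) (-1) /\
  (room (D1 G) (Xtail G) (tau G) 1 /\ room (D1 G) (Xcontact G) (tau G) (-1)) /\
  room (D2 G) (Xcontact G) (tau G) 1.
Proof.
  split; [|split]; [apply (between_room G (fun _ => - delta G) (Xhead G))
    |apply between_room|apply (between_room G (Xcontact G) (Xshock G))];
  intros t Ht; pose proof (curves_continuous t Ht);
  pose proof (curve_order g G HW t Ht);
  pose proof (const_continuous (- delta G) t); tauto.
Qed.

(** * Material derivatives on the time axis *)

Section Contact.

Variables (r1 r2 v1 v2 s1 s2 r1' r2' v1' v2' s1' s2' : R).
Hypothesis H1 : germ (D1 G) (w G) (U1star G) r1 r2 v1 v2 s1 s2.
Hypothesis H2 : germ (D2 G) (w G) (U2star G) r1' r2' v1' v2' s1' s2'.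

Lemma contact_speed :
  rlim (fun t => vel (w G (Xcontact G t) t)) (vel (U1star G)).
Proof.
  apply (edge_value (D1 G) (fun y h => vel (w G y h)) (Xcontact G) (tau G) (-1)).
  - apply (box_pos g G HW).
  - now right.
  - intros t Ht. apply (contact_curve g G HW t Ht).
  - exact (curve_to_origin _ _ (contact_origin g G HW)).
  - apply edges_room.
  - apply (germ_lim H1).
Qed.

(** A function that is continuous across the contact discontinuity has the
    same material derivative on both sides, since the contact moves with the
    fluid. *)
Lemma contact_match (f : R -> R -> R) (l1 l2 l1' l2' : R) :
  (forall t, 0 < t < tau G -> continuity_2d_pt f (Xcontact G t) t) ->
  (forall x t, D1 G x t -> diff2 f x t) ->
  (forall x t, D2 G x t -> diff2 f x t) ->
  lim_in (D1 G) (d1 f) 0 0 l1 -> lim_in (D1 G) (d2 f) 0 0 l2 ->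
  lim_in (D2 G) (d1 f) 0 0 l1' -> lim_in (D2 G) (d2 f) 0 0 l2' ->
  l2 + vel (U1star G) * l1 = l2' + vel (U1star G) * l1'.
Proof.
  intros Hc Hd1 Hd2 L1 L2 L1' L2'.
  apply (increments_unique (fun t => f (Xcontact G t) t)).
  - intros r Hr.
    apply (edge_increment (D1 G) f (Xcontact G) (fun t => vel (w G (Xcontact G t) t))
             (tau G) (-1)); try assumption.
    + apply (box_pos g G HW).
    + apply (germ_time H1).
    + now right.
    + exact (curve_to_origin _ _ (contact_origin g G HW)).
    + apply edges_room.
    + intros t Ht. apply (contact_curve g G HW t Ht).
    + exact contact_speed.
  - intros r Hr.
    apply (edge_increment (D2 G) f (Xcontact G) (fun t => vel (w G (Xcontact G t) t))
             (tau G) 1); try assumption.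
    + apply (box_pos g G HW).
    + apply (germ_time H2).
    + now left.
    + exact (curve_to_origin _ _ (contact_origin g G HW)).
    + apply edges_room.
    + intros t Ht. apply (contact_curve g G HW t Ht).
    + exact contact_speed.
Qed.

Lemma axis_limit_of_sides (f : R -> R -> R) (l : R) :
  lim_in (D1 G) f 0 0 l -> lim_in (D2 G) f 0 0 l -> axis_limit f l.
Proof.
  intros L1 L2 e He.
  destruct (proj1 (lim_inP _ _ _ _ _) L1 e He) as [d [Hd B1]].
  destruct (proj1 (lim_inP _ _ _ _ _) L2 e He) as [d' [Hd' B2]].
  pose proof (box_pos g G HW) as [Htau _].
  apply near_right. exists (Rmin (Rmin d d') (tau G)).
  split; [repeat apply Rmin_pos; assumption|]. intros t Ht.
  assert (Ht' : 0 < t /\ t < d /\ t < d' /\ t < tau G).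
  { revert Ht. min_lra. }
  pose proof (axis_intermediate g G HW t ltac:(lra)) as Hax.
  (* The punctured interval of radius [c] around [0] avoids the contact. *)
  set (c := if Req_dec_T (Xcontact G t) 0 then 1 else Rabs (Xcontact G t)).
  assert (Hc : 0 < c).
  { unfold c. destruct Req_dec_T; [lra|now apply Rabs_pos_lt]. }
  set (n := Rmin (Rmin (Rmin d d') (Rmin (- Xtail G t) (Xshock G t))) c).
  assert (Hn : 0 < n /\ n <= d /\ n <= d' /\ n <= - Xtail G t /\ n <= Xshock G t /\ n <= c).
  { unfold n. min_lra. }
  exists (mkposreal n (proj1 Hn)). intros x Hx Hx0.
  change (Rabs (x - 0) < n) in Hx.
  assert (Hxb : - n < x < n).
  { rewrite Rminus_0_r in Hx. abs_lra. }
  assert (Htb : Rabs (t - 0) = t) by (rewrite Rminus_0_r, Rabs_pos_eq; lra).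
  assert (Hsides : x < Xcontact G t \/ Xcontact G t < x).
  { unfold c in Hn. destruct Req_dec_T as [E|E].
    - rewrite E. lra.
    - assert (Hcx : x <> Xcontact G t).
      { intros E'. rewrite <- E' in Hn. rewrite Rminus_0_r in Hx. lra. }
      lra. }
  destruct Hsides as [Hs|Hs].
  - apply B1; [lra|lra|]. split; lra.
  - apply B2; [lra|lra|]. split; lra.
Qed.

Lemma material_limit (D : R -> R -> Prop) (U : state) (f : R -> R -> R) (l1 l2 : R) :
  lim_state D (w G) 0 0 U -> lim_in D (d1 f) 0 0 l1 -> lim_in D (d2 f) 0 0 l2 ->
  lim_in D (material G f) 0 0 (l2 + vel U * l1).
Proof.
  intros [_ [Hv _]] L1 L2. unfold material.
  apply lim_in_plus; [exact L2|]. apply lim_in_mult; assumption.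
Qed.

Let u := vel (U1star G).
Let c := csound g (U1star G).
Let ps := d2 (pr g) (rho (U1star G)) (ent (U1star G)).

Lemma axis_velocity :
  axis_limit (material G (fun x t => vel (w G x t))) (v2 + u * v1).
Proof.
  assert (E : v2 + u * v1 = v2' + u * v1').
  { apply (contact_match (fun x t => vel (w G x t))).
    - intros t Ht. apply (contact_curve g G HW t Ht).
    - apply (germ_dvel H1).
    - apply (germ_dvel H2).
    - apply (germ_v1 H1).
    - apply (germ_v2 H1).
    - apply (germ_v1 H2).
    - apply (germ_v2 H2). }
  apply axis_limit_of_sides.
  - apply material_limit.
    + apply (germ_lim H1).
    + apply (germ_v1 H1).
    + apply (germ_v2 H1).
  - rewrite E. unfold u. rewrite (proj1 (proj2 speeds_order)).
    apply material_limit.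
    + apply (germ_lim H2).
    + apply (germ_v1 H2).
    + apply (germ_v2 H2).
Qed.

Lemma axis_pressure :
  axis_limit (material G (fun x t => pressure g (w G x t)))
    (c * c * r2 + ps * s2 + u * (c * c * r1 + ps * s1)).
Proof.
  destruct (germ_pressure g (D1 G) (w G) (U1star G) Hg _ _ _ _ _ _ H1) as [P1 P2].
  destruct (germ_pressure g (D2 G) (w G) (U2star G) Hg _ _ _ _ _ _ H2) as [P1' P2'].
  pose proof (fun x t HD => proj1 (pressure_partials g (D1 G) (w G) (U1star G) Hg
    _ _ _ _ _ _ H1 x t HD)) as Hd1.
  pose proof (fun x t HD => proj1 (pressure_partials g (D2 G) (w G) (U2star G) Hg
    _ _ _ _ _ _ H2 x t HD)) as Hd2.
  pose proof (contact_match (fun x t => pressure g (w G x t)) _ _ _ _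
    (fun t Ht => proj2 (proj2 (contact_curve g G HW t Ht))) Hd1 Hd2 P1 P2 P1' P2') as E.
  apply axis_limit_of_sides.
  - apply material_limit; [apply (germ_lim H1)|exact P1|exact P2].
  - unfold u, c, ps. rewrite E. rewrite (proj1 (proj2 speeds_order)).
    apply material_limit; [apply (germ_lim H2)|exact P1'|exact P2'].
Qed.

End Contact.

(** * Difference quotients along the edges of the wave *)

(** Along the edges of the rarefaction wave, the difference quotients are
    computed from outside the wave, where the solution is [C1] up to the origin.
    By continuity across the edge they can be used inside. *)
Lemma wave_edge (D : R -> R -> Prop) (U : state) (X : R -> R) (e k : R)
    (r1 r2 v1 v2 s1 s2 : R) :
  germ D (w G) U r1 r2 v1 v2 s1 s2 ->
  e = 1 \/ e = -1 ->
  (forall t, 0 < t < tau G ->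
    is_derive X t (vel (w G (X t) t) - csound g (w G (X t) t)) /\
    continuous_state (w G) (X t) t) ->
  rlim X 0 ->
  room D X (tau G) e ->
  vel U - csound g U = k ->
  lim_state_right (fun t => w G (X t) t) U /\
  rlim (fun t => (rho (w G (X t) t) - rho U) / t) (r2 + k * r1) /\
  rlim (fun t => (vel (w G (X t) t) - vel U) / t) (v2 + k * v1) /\
  rlim (fun t => (ent (w G (X t) t) - ent U) / t) (s2 + k * s1).
Proof.
  intros HJ He HX H0 Hroom Hk.
  pose proof (box_pos g G HW) as [Htau _].
  destruct (germ_lim HJ) as [Lr [Lv Ls]].
  assert (HV : forall f l, (forall t, 0 < t < tau G -> continuity_2d_pt f (X t) t) ->
    lim_in D f 0 0 l -> rlim (fun t => f (X t) t) l).
  { intros f l Hc Hl. now apply (edge_value D f X (tau G) e). }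
  pose proof (HV _ _ (fun t Ht => proj1 (proj2 (HX t Ht))) Lr) as Vr.
  pose proof (HV _ _ (fun t Ht => proj1 (proj2 (proj2 (HX t Ht)))) Lv) as Vv.
  pose proof (HV _ _ (fun t Ht => proj2 (proj2 (proj2 (HX t Ht)))) Ls) as Vs.
  assert (Hspeed : rlim (fun t => vel (w G (X t) t) - csound g (w G (X t) t)) k).
  { rewrite <- Hk.
    apply right_lim_minus; [exact Vv|].
    apply (filterlim_2d R (at_right 0) (sound g)); [|exact Vr|exact Vs].
    apply sound_cont; [exact Hg|]. exact (germ_pos0 HJ). }
  assert (HQ : forall f l l1 l2, (forall t, 0 < t < tau G -> continuity_2d_pt f (X t) t) ->
    (forall x t, D x t -> diff2 f x t) ->
    lim_in D (d1 f) 0 0 l1 -> lim_in D (d2 f) 0 0 l2 -> lim_in D f 0 0 l ->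
    rlim (fun t => (f (X t) t - l) / t) (l2 + k * l1)).
  { intros f l l1 l2 Hc Hd L1 L2 Ll.
    apply (edge_quotient D f X (fun t => vel (w G (X t) t) - csound g (w G (X t) t))
      (tau G) e); auto.
    - apply (germ_time HJ).
    - intros t Ht. apply (HX t Ht). }
  split; [split; [exact Vr|split; [exact Vv|exact Vs]]|].
  split; [|split].
  - apply (HQ (fun y h => rho (w G y h)) _ r1 r2); try assumption; try apply HJ.
    intros t Ht. apply (HX t Ht).
  - apply (HQ (fun y h => vel (w G y h)) _ v1 v2); try assumption; try apply HJ.
    intros t Ht. apply (HX t Ht).
  - apply (HQ (fun y h => ent (w G y h)) _ s1 s2); try assumption; try apply HJ.
    intros t Ht. apply (HX t Ht).
Qed.

Local Notation lo := (betaL g G).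
Local Notation hi := (bstar G).
Local Notation T := (tab G).
Local Notation X := (xab G).
Local Notation strip := (coord_strip g G).
Local Notation W := (fun a b => w G (xab G a b) (tab G a b)).

Let lohi : lo < hi := beta_order.

(** * Characteristic coordinates near the origin *)

(** Limits at the origin inside the wave. Uniformity in [beta] is what
    integration along the lines of constant [alpha] requires. *)
Definition unif_lim (f : R -> R -> R) (f0 : R -> R) : Prop :=
  forall e, 0 < e -> exists d, 0 < d /\
    forall a b, strip a b -> a < d -> Rabs (f a b - f0 b) < e.

Lemma eps_positive : 0 < eps G.
Proof. exact (eps_pos g G HC). Qed.

Lemma strip_near (b d : R) : lo <= b <= hi -> 0 < d ->
  exists b', lo < b' < hi /\ Rabs (b' - b) < d.
Proof.
  intros Hb Hd.
  destruct (small_factor (1 / 2) (hi - lo) d ltac:(lra) Hd) as [n [Hn Hnd]].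
  exists (b + n * ((lo + hi) / 2 - b)). split; [split; nra|].
  replace (b + n * ((lo + hi) / 2 - b) - b) with (n * ((lo + hi) / 2 - b)) by ring.
  apply Rabs_lt_between. split; nra.
Qed.

Lemma strip_dense (a b d : R) : 0 <= a < eps G -> lo <= b <= hi -> 0 < d ->
  exists a' b', strip a' b' /\ Rabs (a' - a) < d /\ Rabs (b' - b) < d.
Proof.
  intros Ha Hb Hd. destruct (strip_near b d Hb Hd) as [b' [Hb' Hbd]].
  set (n := Rmin d (eps G - a) / 2).
  assert (Hn : 0 < n /\ n < d /\ n < eps G - a).
  { unfold n. min_lra. }
  exists (a + n), b'. split; [split; lra|]. split; [|assumption].
  replace (a + n - a) with n by ring. rewrite Rabs_pos_eq; lra.
Qed.

(** By compactness of the segment [alpha = 0], a property that holds near each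
    of its points holds on a whole strip. *)
Lemma tube (P : R -> R -> Prop) :
  (forall b, lo <= b <= hi -> exists d, 0 < d /\ forall u v,
     Rabs (u - 0) < d -> Rabs (v - b) < d -> strip u v -> P u v) ->
  exists d, 0 < d /\ forall u v, strip u v -> u < d -> P u v.
Proof.
  intros H.
  destruct (cousin (fun u v => exists d, 0 < d /\ forall a b,
    strip a b -> a < d -> u <= b <= v -> P a b) lo hi) as [d [Hd HP]].
  - lra.
  - intros x Hx. destruct (H x Hx) as [d [Hd HP]]. exists d. split; [assumption|].
    intros u v Hu Hv _ _. exists d. split; [assumption|].
    intros a b Hab Had Hb. apply HP; [| |assumption].
    + destruct Hab as [Ha _]. rewrite Rminus_0_r, Rabs_pos_eq; lra.
    + abs_lra.
  - intros u v z _ _ [d [Hd H1]] [d' [Hd' H2]].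
    exists (Rmin d d'). split; [now apply Rmin_pos|].
    intros a b Hab Ha Hb. Rmin_bounds (Rmin d d').
    destruct (Rle_dec b v).
    + apply H1; [assumption|lra|lra].
    + apply H2; [assumption|lra|lra].
  - exists d. split; [assumption|]. intros u v Huv Hu. apply HP; [assumption..|].
    destruct Huv. lra.
Qed.

(** Limits taken jointly in [alpha] and [beta] are locally uniform, and
    continuous in [beta]. *)
Lemma unif_lim_of_pointwise (f : R -> R -> R) (f0 : R -> R) :
  (forall b, lo <= b <= hi -> lim_in strip f 0 b (f0 b)) ->
  unif_lim f f0 /\ cont_on lo hi f0.
Proof.
  intros H.
  assert (Hc : cont_on lo hi f0).
  { apply cont_on_intro. intros b e Hb He.
    destruct (proj1 (lim_inP _ _ _ _ _) (H b Hb) (e / 2)) as [d [Hd Hbd]]; [lra|].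
    exists (d / 2). split; [lra|]. intros z Hz Hzb.
    destruct (proj1 (lim_inP _ _ _ _ _) (H z Hz) (e / 2)) as [d' [Hd' Hzd]]; [lra|].
    destruct (strip_dense 0 z (Rmin (d / 2) d')) as [a' [b' [Hs [Ha' Hb']]]];
      [pose proof eps_positive; lra|assumption|apply Rmin_pos; lra|].
    Rmin_bounds (Rmin (d / 2) d').
    specialize (Hzd a' b' ltac:(lra) ltac:(lra) Hs).
    specialize (Hbd a' b' ltac:(lra)).
    assert (Hb'b : Rabs (b' - b) < d).
    { abs_lra. }
    specialize (Hbd Hb'b Hs).
    abs_lra. }
  split; [|exact Hc]. intros e He. apply tube. intros b Hb.
  destruct (proj1 (lim_inP _ _ _ _ _) (H b Hb) (e / 2)) as [d [Hd Hbd]]; [lra|].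
  destruct (cont_onP lo hi f0 b (e / 2) Hc Hb) as [d' [Hd' Hcd]]; [lra|].
  exists (Rmin d d'). split; [now apply Rmin_pos|]. intros u v Hu Hv Huv.
  Rmin_bounds (Rmin d d').
  specialize (Hbd u v ltac:(lra) ltac:(lra) Huv).
  assert (Hvb : lo <= v <= hi) by (destruct Huv; lra).
  specialize (Hcd v Hvb ltac:(lra)).
  abs_lra.
Qed.

(** Uniform convergence extends to the edges of the wave. *)
Lemma unif_lim_closed (f : R -> R -> R) (f0 : R -> R) (b : R) :
  unif_lim f f0 -> cont_on lo hi f0 ->
  (forall a, 0 < a < eps G -> lim_in strip f a b (f a b)) ->
  lo <= b <= hi -> rlim (fun a => f a b) (f0 b).
Proof.
  intros Hf Hc Hl Hb. apply right_limP. intros e He.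
  destruct (Hf (e / 3)) as [d [Hd H]]; [lra|].
  destruct (cont_onP lo hi f0 b (e / 3) Hc Hb) as [d' [Hd' Hcd]]; [lra|].
  pose proof eps_positive as He0.
  exists (Rmin d (eps G)). split; [now apply Rmin_pos|]. intros a Ha.
  Rmin_bounds (Rmin d (eps G)).
  destruct (proj1 (lim_inP _ _ _ _ _) (Hl a ltac:(lra)) (e / 3)) as [r [Hr HL]]; [lra|].
  destruct (strip_near b (Rmin r d') Hb) as [b' [Hb' Hbb]]; [now apply Rmin_pos|].
  Rmin_bounds (Rmin r d').
  assert (Hs : strip a b') by (split; lra).
  specialize (H a b' Hs ltac:(lra)).
  specialize (Hcd b' ltac:(lra) ltac:(lra)).
  specialize (HL a b' ltac:(rewrite Rminus_diag, Rabs_R0; lra) ltac:(lra) Hs).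
  abs_lra.
Qed.

Lemma coord_derive (f : R -> R -> R) (a b : R) :
  f = T \/ f = X -> strip a b ->
  is_derive (fun z => f z b) a (d1 f a b) /\
  is_derive (fun z => f a z) b (d2 f a b) /\
  diff2 f a b /\ continuity_2d_pt f a b.
Proof.
  intros Hf Hab.
  assert (HE : forall a b, strip a b -> ex_diff_n f 1 a b).
  { intros u v Huv. apply (ex_diff_n_m 2 1); [auto|].
    destruct (coord_C2 g G HC u v Huv). now destruct Hf as [-> | ->]. }
  assert (HD : diff2 f a b).
  { apply diff2_C1. destruct Hab as [Ha Hb].
    set (d := Rmin (Rmin a (eps G - a)) (Rmin (b - lo) (hi - b))).
    assert (Hd : 0 < d /\ d <= a /\ d <= eps G - a /\ d <= b - lo /\ d <= hi - b).
    { unfold d. min_lra. }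
    exists (mkposreal d (proj1 Hd)). simpl. intros u v Hu Hv. apply HE.
    apply Rabs_lt_between in Hu. apply Rabs_lt_between in Hv. split; lra. }
  split; [now apply diff2_derive1|]. split; [now apply diff2_derive2|].
  split; [exact HD|]. now apply HE.
Qed.

Lemma coord_to_origin (f : R -> R -> R) (b : R) :
  f = T \/ f = X -> lo < b < hi ->
  rlim (fun a => f a b) 0.
Proof.
  intros Hf Hb.
  assert (HL : lim_in strip f 0 b 0).
  { pose proof eps_positive as He.
    destruct (coord_cont g G HC 0 b) as [HX HT]; [split; lra|].
    destruct (coord_origin g G HC b) as [EX ET]; [lra|].
    rewrite EX in HX. rewrite ET in HT. now destruct Hf as [-> | ->]. }
  apply right_limP. intros e He.
  destruct (proj1 (lim_inP _ _ _ _ _) HL e He) as [d [Hd H]].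
  pose proof eps_positive as He0.
  exists (Rmin d (eps G)). split; [now apply Rmin_pos|]. intros a Ha.
  Rmin_bounds (Rmin d (eps G)).
  apply H.
  - rewrite Rminus_0_r, Rabs_pos_eq; lra.
  - rewrite Rminus_diag, Rabs_R0. assumption.
  - split; lra.
Qed.

Lemma tab_pos (a b : R) : 0 < a < eps G -> lo <= b <= hi -> 0 < T a b < tau G.
Proof.
  intros Ha Hb. destruct (Req_dec b lo) as [-> |Hlo].
  - apply (coord_head g G HC a Ha).
  - destruct (Req_dec b hi) as [-> |Hhi].
    + apply (coord_tail g G HC a Ha).
    + apply (coord_in g G HC a b). split; lra.
Qed.

(** The limits of [t_alpha] at the origin form a continuous function of [beta].
    The quotients [t / alpha] have the same limits, which are nonnegative as
    [t > 0] inside the wave, and nonzero by regularity of the coordinates. *)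
Lemma time_rate_exists : exists A : R -> R,
  cont_on lo hi A /\ (forall b, lo <= b <= hi -> 0 < A b) /\
  unif_lim (d1 T) A /\ unif_lim (fun a b => T a b / a) A /\
  (forall b, lo <= b <= hi ->
     rlim (fun a => T a b / a) (A b)).
Proof.
  assert (Hex : forall b, exists l, lo <= b <= hi ->
     lim_in strip (d1 T) 0 b l /\ l <> 0).
  { intros b. destruct (classic (lo <= b <= hi)) as [Hb|Hb].
    - destruct (coord_regular g G HC b Hb) as [l H]. now exists l.
    - exists 0. tauto. }
  set (A := fun b => proj1_sig (constructive_indefinite_description _ (Hex b))).
  assert (HA : forall b, lo <= b <= hi -> lim_in strip (d1 T) 0 b (A b) /\ A b <> 0).
  { intros b. exact (proj2_sig (constructive_indefinite_description _ (Hex b))). }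
  clearbody A.
  destruct (unif_lim_of_pointwise (d1 T) A) as [HU Hc].
  { intros b Hb. apply (HA b Hb). }
  assert (HQ : unif_lim (fun a b => T a b / a) A).
  { intros e He. destruct (HU (e / 2)) as [d [Hd H]]; [lra|].
    exists d. split; [assumption|]. intros a b Hab Had.
    assert (HB : Rabs (T a b - 0 - A b * a) <= e / 2 * a).
    { destruct Hab as [Ha Hb].
      apply (origin_increment (fun z => T z b) (fun z => d1 T z b)); [lra| | |].
      - apply coord_to_origin; [now left|assumption].
      - intros z Hz. apply (coord_derive T z b); [now left|]. split; lra.
      - intros z Hz. left. apply H; [split; lra|lra]. }
    destruct Hab as [Ha Hb].
    replace (T a b / a - A b) with ((T a b - 0 - A b * a) / a) by (field; lra).
    apply Rabs_div_lt; [lra|]. nra. }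
  assert (HL : forall b, lo <= b <= hi ->
     rlim (fun a => T a b / a) (A b)).
  { intros b Hb. apply (unif_lim_closed (fun a b => T a b / a)); try assumption.
    intros a Ha. unfold Rdiv. apply lim_in_mult.
    - apply (coord_cont g G HC a b). split; lra.
    - apply lim_inP. intros e He.
      assert (Hca : continuous Rinv a) by (apply continuous_Rinv; lra).
      destruct (proj1 (filterlim_locally _ _) Hca (mkposreal e He)) as [d Hd].
      exists d. split; [apply cond_pos|]. intros u v Hu _ _. now apply Hd. }
  exists A. split; [exact Hc|]. split; [|split; [exact HU|split; [exact HQ|exact HL]]].
  intros b Hb. destruct (HA b Hb) as [_ H0].
  destruct (Rtotal_order (A b) 0) as [H|[H|H]]; [exfalso|contradiction|exact H].
  destruct (proj1 (right_limP _ _) (HL b Hb) (- A b)) as [d [Hd HLd]]; [lra|].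
  pose proof eps_positive as He0.
  set (a := Rmin d (eps G) / 2).
  assert (Ha : 0 < a /\ a < d /\ a < eps G).
  { unfold a. min_lra. }
  specialize (HLd a ltac:(lra)). apply Rabs_lt_between in HLd.
  pose proof (tab_pos a b ltac:(lra) Hb) as HT.
  assert (0 < T a b / a) by (apply Rdiv_lt_0_compat; lra). lra.
Qed.

Definition rate : R -> R :=
  proj1_sig (constructive_indefinite_description _ time_rate_exists).

Local Notation A := rate.

Lemma rate_spec :
  cont_on lo hi A /\ (forall b, lo <= b <= hi -> 0 < A b) /\
  unif_lim (d1 T) A /\ unif_lim (fun a b => T a b / a) A /\
  (forall b, lo <= b <= hi ->
     rlim (fun a => T a b / a) (A b)).
Proof. exact (proj2_sig (constructive_indefinite_description _ time_rate_exists)). Qed.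

Let A_cont := proj1 rate_spec.
Let A_pos := proj1 (proj2 rate_spec).
Let A_unif := proj1 (proj2 (proj2 rate_spec)).
Let A_quot_unif := proj1 (proj2 (proj2 (proj2 rate_spec))).
Let A_quot := proj2 (proj2 (proj2 (proj2 rate_spec))).

(** The linear rate is what makes [x - beta t] of second order in [alpha]. *)
Lemma bounded_rate (q : R -> R -> R) (q0 : R -> R) :
  alpha_derivative_bounded g G q ->
  (forall b, lo < b < hi ->
     rlim (fun a => in_coords G q a b) (q0 b)) ->
  exists M d, 0 < M /\ 0 < d /\ forall a b, strip a b -> a < d ->
    Rabs (in_coords G q a b - q0 b) <= M * a.
Proof.
  intros [M [d [Hd H]]] Hl. exists (Rabs M + 1), d.
  split; [pose proof (Rabs_pos M); lra|]. split; [assumption|].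
  intros a b [Ha Hb] Had.
  replace (in_coords G q a b - q0 b) with (in_coords G q a b - q0 b - 0 * a) by ring.
  apply (origin_increment (fun z => in_coords G q z b) (fun z => d1 (in_coords G q) z b));
    [lra|now apply Hl| |].
  - intros z Hz. apply Derive_correct. apply H; [split; lra|lra].
  - intros z Hz. rewrite Rminus_0_r.
    destruct (H z b) as [_ HB]; [split; lra|lra|]. pose proof (Rle_abs M). lra.
Qed.

Lemma rate_unif (f : R -> R -> R) (f0 : R -> R) (M d : R) :
  0 < M -> 0 < d ->
  (forall a b, strip a b -> a < d -> Rabs (f a b - f0 b) <= M * a) ->
  unif_lim f f0.
Proof.
  intros HM Hd H e He. exists (Rmin d (e / M)).
  split; [apply Rmin_pos; [assumption|now apply Rdiv_lt_0_compat]|].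
  intros a b Hab Ha. Rmin_bounds (Rmin d (e / M)).
  apply Rle_lt_trans with (1 := H a b Hab ltac:(lra)).
  apply Rmult_lt_div; lra.
Qed.

(** By the Cauchy criterion, increments in [alpha] being bounded by a multiple
    of [alpha]. *)
Lemma bounded_limit (q : R -> R -> R) (b : R) :
  alpha_derivative_bounded g G q -> lo < b < hi ->
  exists l, rlim (fun a => in_coords G q a b) l.
Proof.
  intros [M [d [Hd H]]] Hb.
  apply (filterlim_locally_cauchy (F := at_right 0) (fun a => in_coords G q a b)).
  intros e. set (K := Rabs M + 1).
  assert (HK : 0 < K) by (pose proof (Rabs_pos M); unfold K; lra).
  assert (Hle : forall u v, 0 < u -> u <= v -> v < d -> v < eps G ->
     Rabs (in_coords G q v b - in_coords G q u b) <= K * v).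
  { intros u v Hu Huv Hvd Hve.
    replace (in_coords G q v b - in_coords G q u b) with
      (in_coords G q v b - in_coords G q u b - 0 * (v - u)) by ring.
    apply Rle_trans with (K * (v - u)); [|nra].
    apply (mvt_bound (fun z => in_coords G q z b) (fun z => d1 (in_coords G q) z b));
      [assumption| |].
    - intros z Hz. apply Derive_correct. apply H; [split; lra|lra].
    - intros z Hz. rewrite Rminus_0_r.
      destruct (H z b) as [_ HB]; [split; lra|lra|]. pose proof (Rle_abs M).
      unfold K. lra. }
  pose proof eps_positive as He0. pose proof (cond_pos e) as He.
  set (r := Rmin (Rmin d (eps G)) (e / K)).
  assert (Hr : 0 < r /\ r <= d /\ r <= eps G /\ r <= e / K).
  { assert (0 < e / K) by now apply Rdiv_lt_0_compat.
    unfold r. min_lra. }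
  exists (fun a => 0 < a < r). split; [apply near_right; exists r; split; [apply Hr|auto]|].
  assert (Hball : forall u v, 0 < u -> u <= v -> v < r ->
     Rabs (in_coords G q v b - in_coords G q u b) < e).
  { intros u v Hu Huv Hv. apply Rle_lt_trans with (1 := Hle u v Hu Huv ltac:(lra) ltac:(lra)).
    apply Rmult_lt_div; lra. }
  intros u v Hu Hv. change (Rabs (in_coords G q v b - in_coords G q u b) < e).
  destruct (Rle_dec u v).
  - apply Hball; lra.
  - rewrite Rabs_minus_sym. apply Hball; lra.
Qed.

Definition speed_minus (a b : R) : R := vel (W a b) - csound g (W a b).
Definition speed_plus (a b : R) : R := vel (W a b) + csound g (W a b).

Lemma wave_state_limit (phi : R -> R -> R) (b : R) :
  lo <= b <= hi -> continuity_2d_pt phi (rho (fan G b)) (ent (fan G b)) ->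
  rlim (fun a => phi (rho (W a b)) (ent (W a b))) (phi (rho (fan G b)) (ent (fan G b))).
Proof.
  intros Hb Hphi. destruct (coord_limit g G HC b Hb) as [Lr [_ Ls]].
  now apply (filterlim_2d R (at_right 0) phi).
Qed.

Lemma wave_sound_limit (b : R) : lo <= b <= hi ->
  rlim (fun a => csound g (W a b)) (fan_c b).
Proof.
  intros Hb. rewrite <- (fan_cE b Hb).
  apply (wave_state_limit (sound g)); [assumption|].
  apply sound_cont; [exact Hg|]. now apply fan_rho_pos.
Qed.

Lemma speed_rates : exists M d, 0 < M /\ 0 < d /\ forall a b, strip a b -> a < d ->
  Rabs (speed_minus a b - b) <= M * a /\
  Rabs (speed_plus a b - (b + 2 * fan_c b)) <= M * a.
Proof.
  destruct (bounded_rate _ (fun b => b) (bounded_minus g G HC)) as [M [d [HM [Hd H]]]].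
  { intros b Hb. replace b with (vel (fan G b) - fan_c b) by (unfold fan_c; ring).
    apply right_lim_minus.
    - replace (vel (fan G b) - fan_c b) with b by (unfold fan_c; ring).
      apply (coord_limit g G HC b). lra.
    - replace (vel (fan G b) - fan_c b) with b by (unfold fan_c; ring).
      apply wave_sound_limit. lra. }
  destruct (bounded_rate _ (fun b => b + 2 * fan_c b) (bounded_plus g G HC))
    as [M' [d' [HM' [Hd' H']]]].
  { intros b Hb.
    replace (b + 2 * fan_c b) with (vel (fan G b) + fan_c b) by (unfold fan_c; ring).
    apply right_lim_plus; [|apply wave_sound_limit; lra].
    apply (coord_limit g G HC b). lra. }
  exists (M + M'), (Rmin d d'). split; [lra|]. split; [now apply Rmin_pos|].
  intros a b Hab Ha. Rmin_bounds (Rmin d d').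
  specialize (H a b Hab ltac:(lra)). specialize (H' a b Hab ltac:(lra)).
  unfold in_coords in H, H'. destruct Hab as [Ha' _].
  unfold speed_minus, speed_plus. split; nra.
Qed.

Lemma wave_sound_pos (a b : R) : strip a b -> 0 < csound g (W a b).
Proof.
  intros Hab. apply sound_pos; [exact Hg|].
  apply (in_box (X a b) (T a b)). right. left. now apply (coord_in g G HC).
Qed.

(** [x - beta t] is of second order because its derivative in [alpha] is
    [(u - c - beta) t_alpha]. *)
Lemma time_bounds : exists m M C d, 0 < m /\ 0 < M /\ 0 < C /\ 0 < d /\ d <= eps G /\
  forall a b, strip a b -> a < d ->
    m <= d1 T a b <= M /\ m * a <= T a b <= M * a /\
    Rabs (X a b - b * T a b) <= C * a * a.
Proof.
  destruct (cont_on_pos_min lo hi lohi A A_cont A_pos) as [m [Hm Hmb]].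
  destruct (cont_on_bounded lo hi lohi A A_cont) as [M [HM HMb]].
  destruct (A_unif (m / 2)) as [da [Hda HUa]]; [lra|].
  destruct (A_quot_unif (m / 2)) as [dq [Hdq HQa]]; [lra|].
  destruct speed_rates as [L [ds [HL [Hds Hsp]]]].
  pose proof (eps_pos g G HC) as He.
  set (d := Rmin (Rmin da dq) (Rmin ds (eps G))).
  assert (Hd : 0 < d /\ d <= da /\ d <= dq /\ d <= ds /\ d <= eps G).
  { unfold d. min_lra. }
  assert (H1 : forall a b, strip a b -> a < d -> m / 2 <= d1 T a b <= M + m).
  { intros a b Hab Ha. specialize (HUa a b Hab ltac:(lra)).
    destruct Hab as [_ Hb]. specialize (Hmb b ltac:(lra)). specialize (HMb b ltac:(lra)).
    abs_lra. }
  exists (m / 2), (M + m), (L * (M + m)), d.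
  split; [lra|]. split; [lra|]. split; [nra|]. split; [lra|]. split; [lra|].
  intros a b Hab Ha. split; [now apply H1|]. split.
  - specialize (HQa a b Hab ltac:(lra)).
    destruct Hab as [Ha' Hb]. specialize (Hmb b ltac:(lra)). specialize (HMb b ltac:(lra)).
    apply Rabs_lt_between in HQa. apply Rabs_le_between in HMb.
    replace (T a b) with (T a b / a * a) by (field; lra). split; nra.
  - destruct Hab as [Ha' Hb].
    replace (X a b - b * T a b) with (X a b - b * T a b - 0 - 0 * a) by ring.
    apply (origin_increment (fun z => X z b - b * T z b)
      (fun z => (speed_minus z b - b) * d1 T z b)); [lra| | |].
    + replace 0 with (0 - b * 0) at 2 by ring.
      apply right_lim_minus; [apply coord_to_origin; auto|].
      apply (right_lim_mult (fun _ => b)); [apply filterlim_const|].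
      apply coord_to_origin; auto.
    + intros z Hz. assert (Hzb : strip z b) by (split; lra).
      replace ((speed_minus z b - b) * d1 T z b) with (d1 X z b - b * d1 T z b).
      * apply is_derive_Rminus; [apply coord_derive; auto|].
        apply is_derive_Rscal. apply coord_derive; auto.
      * rewrite (beta_curve g G HC z b Hzb). unfold speed_minus. ring.
    + intros z Hz. rewrite Rminus_0_r, Rabs_mult.
      assert (Hzb : strip z b) by (split; lra).
      destruct (Hsp z b Hzb ltac:(lra)) as [Hs _].
      pose proof (H1 z b Hzb ltac:(lra)) as HT.
      rewrite (Rabs_pos_eq (d1 T z b)) by lra.
      apply Rle_trans with (L * z * (M + m)).
      * apply Rmult_le_compat; [apply Rabs_pos|lra|exact Hs|lra].
      * replace (L * (M + m) * a) with (L * a * (M + m)) by ring.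
        apply Rmult_le_compat_r; [lra|]. apply Rmult_le_compat_l; lra.
Qed.

(** * Monotonicity of time along the lines of constant alpha *)

(** On the lines of constant time near the origin, [x] increases with [beta]: it
    is an injective function of [beta], as the coordinates are injective, and
    [x / t] tends to [beta]. *)
Lemma level_lines : exists d0 m, 0 < d0 /\ d0 <= eps G /\ 0 < m /\
  (forall a b, strip a b -> a < d0 -> m <= d1 T a b) /\
  forall a0 b0, strip a0 b0 -> a0 < d0 ->
  exists N : R -> R, N b0 = a0 /\
    (forall b, lo < b < hi -> 0 < N b < eps G /\ T (N b) b = T a0 b0) /\
    (forall b b', lo < b < hi -> lo < b' < hi ->
       m * Rabs (N b' - N b) <= Rabs (T (N b) b' - T (N b) b)) /\
    (forall b b', lo < b -> b < b' -> b' < hi -> X (N b) b < X (N b') b').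
Proof.
  destruct time_bounds as [m [M [C [d [Hm [HM [HC0 [Hd [Hde HB]]]]]]]]].
  set (p := (2 * lo + hi) / 3). set (q := (lo + 2 * hi) / 3).
  (* Up to the time [tau0], the level lines exist for all [beta] with
     [alpha <= d / 2], and the error [C alpha^2] of [x = beta t] is too small to
     reverse the order of the points at [p] and [q]. *)
  set (tau0 := Rmin (m * (d / 2)) ((q - p) * (m * m) / (4 * C))).
  assert (Hpq : lo < p /\ p < q /\ q < hi) by (unfold p, q; lra).
  assert (Hq4 : 0 < (q - p) * (m * m) / (4 * C)).
  { apply Rdiv_lt_0_compat; [apply Rmult_lt_0_compat; [lra|nra]|lra]. }
  assert (Htau0 : 0 < tau0 /\ tau0 <= m * (d / 2) /\
                  tau0 <= (q - p) * (m * m) / (4 * C)).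
  { split; [apply Rmin_pos; [nra|assumption]|]. split; [apply Rmin_l|apply Rmin_r]. }
  set (d0 := Rmin (d / 2) (tau0 / M)).
  assert (HtM : 0 < tau0 / M) by (apply Rdiv_lt_0_compat; lra).
  assert (Hd0 : 0 < d0 /\ d0 <= d / 2 /\ d0 <= tau0 / M).
  { split; [apply Rmin_pos; lra|]. split; [apply Rmin_l|apply Rmin_r]. }
  assert (Hinc : forall z z' b, lo < b < hi -> 0 < z -> z <= z' -> z' < d ->
     m * (z' - z) <= T z' b - T z b).
  { intros z z' b Hb Hz Hzz Hz'. destruct Hzz as [Hzz| <-]; [|lra].
    destruct (mvt (fun s => T s b) (fun s => d1 T s b) z z' Hzz) as [c [Hc ->]].
    - intros s Hs. apply coord_derive; [auto|]. split; lra.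
    - apply Rmult_le_compat_r; [lra|]. apply HB; [split; lra|lra]. }
  assert (Habs : forall z z' b, lo < b < hi -> 0 < z < d -> 0 < z' < d ->
     m * Rabs (z' - z) <= Rabs (T z' b - T z b)).
  { intros z z' b Hb Hz Hz'. destruct (Rle_dec z z') as [H|H].
    - rewrite (Rabs_pos_eq (z' - z)) by lra.
      apply Rle_trans with (2 := Rle_abs _). apply Hinc; lra.
    - rewrite (Rabs_minus_sym z'), (Rabs_minus_sym (T z' b)).
      rewrite (Rabs_pos_eq (z - z')) by lra.
      apply Rle_trans with (2 := Rle_abs _). apply Hinc; lra. }
  exists d0, m. split; [lra|]. split; [lra|]. split; [assumption|].
  split; [intros a b Hab Ha; apply HB; [assumption|lra]|].
  intros a0 b0 Hab0 Ha0. set (t := T a0 b0).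
  assert (Ht : 0 < t /\ t < tau0).
  { destruct (HB a0 b0 Hab0 ltac:(lra)) as [_ [HT _]]. destruct Hab0 as [Ha0' _].
    split; [unfold t; nra|].
    apply Rle_lt_trans with (M * a0); [apply HT|].
    apply Rmult_lt_div; lra. }
  assert (Hex : forall b, exists z, lo < b < hi -> 0 < z <= d / 2 /\ T z b = t).
  { intros b. destruct (classic (lo < b < hi)) as [Hb|Hb]; [|exists 0; tauto].
    set (z0 := Rmin (t / (2 * M)) (d / 4)).
    assert (HtM2 : 0 < t / (2 * M)) by (apply Rdiv_lt_0_compat; lra).
    assert (Hz0 : 0 < z0 /\ z0 <= t / (2 * M) /\ z0 <= d / 4).
    { split; [apply Rmin_pos; lra|]. split; [apply Rmin_l|apply Rmin_r]. }
    destruct (Ranalysis5.IVT_interv (fun z => T z b - t) z0 (d / 2)) as [z [Hz Hz']].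
    - intros z Hz. apply continuity_pt_filterlim.
      apply (ex_derive_continuous (fun z => T z b - t) z).
      exists (d1 T z b - 0). apply is_derive_Rminus; [|apply @is_derive_const].
      apply coord_derive; [auto|]. split; lra.
    - lra.
    - destruct (HB z0 b) as [_ [HT _]]; [split; lra|lra|].
      assert (M * z0 <= t / 2).
      { apply Rle_trans with (M * (t / (2 * M))); [apply Rmult_le_compat_l; lra|].
        right. field. lra. }
      lra.
    - destruct (HB (d / 2) b) as [_ [HT _]]; [split; lra|lra|]. lra.
    - exists z. intros _. split; [lra|]. lra. }
  set (N := fun b => proj1_sig (constructive_indefinite_description _ (Hex b))).
  assert (HN : forall b, lo < b < hi -> 0 < N b <= d / 2 /\ T (N b) b = t).
  { intros b. exact (proj2_sig (constructive_indefinite_description _ (Hex b))). }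
  clearbody N.
  assert (HNk : forall b b', lo < b < hi -> lo < b' < hi ->
     m * Rabs (N b' - N b) <= Rabs (T (N b) b' - T (N b) b)).
  { intros b b' Hb Hb'. destruct (HN b Hb) as [HNb ->].
    destruct (HN b' Hb') as [HNb' <-].
    rewrite (Rabs_minus_sym (T (N b) b')). apply Habs; lra. }
  assert (HNc : forall b, lo < b < hi -> continuous N b).
  { intros b Hb. destruct (HN b Hb) as [HNb HTb].
    apply filterlim_locally. intros e.
    assert (HTc : continuous (fun y => T (N b) y) b).
    { apply (ex_derive_continuous (fun y => T (N b) y) b).
      exists (d2 T (N b) b). apply coord_derive; [auto|]. split; lra. }
    assert (Hme : 0 < m * e) by (apply Rmult_lt_0_compat; [lra|apply cond_pos]).
    destruct (proj1 (filterlim_locally _ _) HTc (mkposreal _ Hme)) as [r Hr].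
    set (r' := Rmin r (Rmin (b - lo) (hi - b))).
    pose proof (cond_pos r) as Hrp.
    assert (Hr' : 0 < r' /\ r' <= r /\ r' <= b - lo /\ r' <= hi - b).
    { unfold r'. min_lra. }
    exists (mkposreal r' (proj1 Hr')). intros z Hz.
    change (Rabs (z - b) < r') in Hz.
    assert (Hzb : lo < z < hi) by abs_lra.
    change (Rabs (N z - N b) < e). apply Rmult_lt_reg_l with m; [lra|].
    apply Rle_lt_trans with (1 := HNk b z Hb Hzb).
    apply (Hr z). change (Rabs (z - b) < r). lra. }
  exists N. split; [|split; [|split; [exact HNk|]]].
  - destruct Hab0 as [Ha0' Hb0]. destruct (HN b0 Hb0) as [HN0 HT0].
    specialize (Habs a0 (N b0) b0 Hb0 ltac:(lra) ltac:(lra)).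
    rewrite HT0 in Habs. unfold t in Habs. rewrite Rminus_diag, Rabs_R0 in Habs.
    apply Rminus_diag_uniq, Rabs_eq_0, Rle_antisym; [|apply Rabs_pos].
    apply Rmult_le_reg_l with m; [lra|]. now rewrite Rmult_0_r.
  - intros b Hb. destruct (HN b Hb) as [HNb HTb]. split; [lra|exact HTb].
  - intros u v Hu Huv Hv.
    apply (injective_increasing lo hi (fun b => X (N b) b) p q u v); try lra.
    + intros b Hb. destruct (HN b Hb) as [HNb _].
      apply (filterlim_2d R (locally b) X N (fun b => b)).
      * apply coord_derive; [auto|]. split; lra.
      * now apply HNc.
      * apply filterlim_id.
    + intros b b' Hb Hb' E. destruct (HN b Hb) as [HNb HTb].
      destruct (HN b' Hb') as [HNb' HTb'].
      apply (coord_inj g G HC (N b) b (N b') b'); try (split; lra); try lra.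
    + destruct (HN p) as [HNp HTp]; [lra|]. destruct (HN q) as [HNq HTq]; [lra|].
      destruct (HB (N p) p) as [_ [Tp Xp]]; [split; lra|lra|].
      destruct (HB (N q) q) as [_ [Tq Xq]]; [split; lra|lra|].
      rewrite HTp in Tp, Xp. rewrite HTq in Tq, Xq.
      assert (Hsq : forall z, 0 < z -> m * z <= t -> C * z * z < (q - p) * t / 2).
      { intros z Hz Hzt.
        apply Rmult_lt_reg_l with (m * m); [nra|].
        assert (H1 : (m * z) * (m * z) <= t * t)
          by (apply Rmult_le_compat; nra).
        assert (H2 : 4 * C * t < (q - p) * (m * m)).
        { apply Rlt_le_trans with (4 * C * ((q - p) * (m * m) / (4 * C))).
          - apply Rmult_lt_compat_l; lra.
          - right. field. lra. }
        replace (m * m * (C * z * z)) with (C * ((m * z) * (m * z))) by ring.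
        apply Rle_lt_trans with (C * (t * t)); [apply Rmult_le_compat_l; lra|].
        assert (H3 : 4 * C * t * t < (q - p) * (m * m) * t)
          by (apply Rmult_lt_compat_r; lra).
        assert (H4 : 0 < (q - p) * (m * m) * t)
          by (apply Rmult_lt_0_compat; [apply Rmult_lt_0_compat; nra|lra]).
        lra. }
      pose proof (Hsq (N p) ltac:(lra) ltac:(lra)).
      pose proof (Hsq (N q) ltac:(lra) ltac:(lra)).
      abs_lra.
Qed.

(** Where [t_beta] were negative, [x] would decrease along the line of constant
    time, on which [dx = (x_beta - (u - c) t_beta) dbeta = 2 c t_beta dbeta]. *)
Lemma time_beta_nonneg : exists d, 0 < d /\ d <= eps G /\
  forall a b, strip a b -> a < d -> 0 <= d2 T a b.
Proof.
  destruct (level_lines) as [d0 [m [Hd0 [Hde [Hm [HB HN]]]]]].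
  exists d0. split; [assumption|]. split; [assumption|].
  intros a b Hab Ha. apply Rnot_lt_le. intros Hneg.
  destruct (HN a b Hab Ha) as [N [HNb [HNt [HNk HNx]]]].
  pose proof (wave_sound_pos a b Hab) as Hc.
  set (c := csound g (w G (X a b) (T a b))) in *.
  set (lam := vel (w G (X a b) (T a b)) - c).
  set (P := d1 T a b). set (Q := - d2 T a b).
  assert (HQ : 0 < Q) by (unfold Q; lra).
  (* A step [h] in [beta] along the level line changes [alpha] by at most
     [B h], so that the remainders of the first-order expansions of [t] and [x]
     are at most [e (B + 1) h]. *)
  set (B := (Q + 1) / m).
  assert (HBp : 0 < B) by (apply Rdiv_lt_0_compat; lra).
  pose proof (Rabs_pos lam) as Hlam.
  destruct (small_factor 1 ((1 + Rabs lam) * (B + 1)) (2 * c * Q)) as [e [He HeK]];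
    [lra|apply Rmult_lt_0_compat; lra|].
  destruct (coord_derive T a b) as [_ [DTb [DT _]]]; auto.
  destruct (coord_derive X a b) as [_ [_ [DX _]]]; auto.
  destruct (DT (mkposreal e (proj1 He))) as [rT HT].
  destruct (DX (mkposreal e (proj1 He))) as [rX HX]. simpl in HT, HX.
  destruct (proj1 (is_derive_Reals _ _ _) DTb 1 Rlt_0_1) as [rD HD].
  pose proof (cond_pos rD).
  destruct Hab as [Ha' Hb].
  set (r := Rmin rT rX / (B + 1)).
  assert (Hr : 0 < r).
  { apply Rdiv_lt_0_compat; [apply Rmin_pos; apply cond_pos|lra]. }
  set (h := Rmin r (Rmin rD (hi - b)) / 2).
  assert (Hh : 0 < h /\ h < r /\ h < rD /\ h < hi - b).
  { unfold h. min_lra. }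
  assert (HBh : (B + 1) * h < Rmin rT rX) by (apply Rmult_lt_div; unfold r in Hh; lra).
  Rmin_bounds (Rmin rT rX).
  set (k := N (b + h) - a).
  assert (Hbh : Rabs (b + h - b) = h).
  { replace (b + h - b) with h by ring. apply Rabs_pos_eq. lra. }
  assert (Hk : Rabs k <= B * h).
  { assert (HTh : Rabs (T a (b + h) - T a b) <= (Q + 1) * h).
    { specialize (HD h ltac:(lra) ltac:(abs_lra)).
      replace (T a (b + h) - T a b) with ((T a (b + h) - T a b) / h * h) by (field; lra).
      rewrite Rabs_mult, (Rabs_pos_eq h) by lra. apply Rmult_le_compat_r; [lra|].
      unfold Q. abs_lra. }
    specialize (HNk b (b + h) Hb ltac:(lra)). rewrite HNb in HNk. fold k in HNk.
    apply Rmult_le_reg_l with m; [lra|].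
    replace (m * (B * h)) with ((Q + 1) * h) by (unfold B; field; lra). lra. }
  assert (Hmax : Rmax (Rabs k) (Rabs (b + h - b)) <= (B + 1) * h).
  { rewrite Hbh. apply Rmax_lub; nra. }
  specialize (HT (N (b + h)) (b + h) ltac:(fold k; lra) ltac:(nra)).
  specialize (HX (N (b + h)) (b + h) ltac:(fold k; lra) ltac:(nra)).
  destruct (HNt (b + h)) as [_ ET]; [lra|].
  specialize (HNx b (b + h) ltac:(lra) ltac:(lra) ltac:(lra)). rewrite HNb in HNx.
  rewrite ET in HT. fold k in HT, HX.
  rewrite (beta_curve g G HC a b (conj Ha' Hb)), (alpha_curve g G HC a b (conj Ha' Hb)) in HX.
  fold c in HX. fold lam in HX. fold P in HX, HT.
  replace (vel (w G (X a b) (T a b)) + c) with (lam + 2 * c) in HX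
    by (unfold lam; ring).
  replace (d2 T a b) with (- Q) in HT, HX by (unfold Q; ring).
  set (E := e * ((B + 1) * h)).
  assert (HT' : Rabs (P * k - Q * h) <= E).
  { replace (P * k - Q * h) with (- (T a b - T a b - (P * k + - Q * (b + h - b)))) by ring.
    rewrite Rabs_Ropp. apply Rle_trans with (1 := HT). apply Rmult_le_compat_l; lra. }
  assert (HX' : X (N (b + h)) (b + h) - X a b <= lam * (P * k - Q * h) - 2 * c * Q * h + E).
  { assert (HE : e * Rmax (Rabs k) (Rabs (b + h - b)) <= E)
      by (apply Rmult_le_compat_l; lra).
    abs_lra. }
  assert (Hlast : lam * (P * k - Q * h) <= Rabs lam * E).
  { apply Rle_trans with (1 := Rle_abs _). rewrite Rabs_mult.
    apply Rmult_le_compat_l; [lra|exact HT']. }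
  assert (HeKh : e * ((1 + Rabs lam) * (B + 1)) * h < 2 * c * Q * h)
    by (apply Rmult_lt_compat_r; lra).
  replace (e * ((1 + Rabs lam) * (B + 1)) * h) with ((1 + Rabs lam) * E) in HeKh
    by (unfold E; ring).
  lra.
Qed.

(** * Quantities transported along the characteristics of u + c *)

(** Along a line of constant [alpha], increments of [f] are controlled by those
    of [t], which is monotone there. *)
Lemma stieltjes (d a b1 b2 k e : R) (f h : R -> R -> R) :
  (forall a b, strip a b -> a < d -> 0 <= d2 T a b) ->
  0 < a < eps G -> a < d -> lo <= b1 -> b1 <= b2 -> b2 <= hi ->
  (forall b, lo < b < hi -> is_derive (fun z => f a z) b (h a b * d2 T a b)) ->
  (forall b, lo <= b <= hi -> lim_in strip f a b (f a b)) ->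
  (forall b, b1 < b < b2 -> Rabs (h a b - k) <= e) ->
  Rabs (f a b2 - f a b1 - k * (T a b2 - T a b1)) <= e * (T a b2 - T a b1).
Proof.
  intros Hmon Ha Had Hb1 Hb12 Hb2 Hf Hlim Hh.
  destruct Hb12 as [Hb12| ->].
  2:{ replace (f a b2 - f a b2 - k * (T a b2 - T a b2)) with 0 by ring.
      rewrite Rabs_R0. lra. }
  assert (Hin : forall u v, b1 < u -> u < v -> v < b2 ->
     Rabs (f a v - f a u - k * (T a v - T a u)) <= e * (T a v - T a u)).
  { intros u v Hu Huv Hv.
    (* The functions [e t - s (f - k t)] are nondecreasing in [beta]. *)
    assert (HD : forall s, s = 1 \/ s = -1 ->
       0 <= e * (T a v - T a u) - s * (f a v - f a u - k * (T a v - T a u))).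
    { intros s Hs.
      destruct (mvt (fun z => e * T a z - s * (f a z - k * T a z))
        (fun z => (e - s * (h a z - k)) * d2 T a z) u v Huv) as [c [Hc E]].
      - intros z Hz. assert (Hz' : strip a z) by (split; lra).
        assert (DT : is_derive (fun z => T a z) z (d2 T a z))
          by (apply coord_derive; auto).
        replace ((e - s * (h a z - k)) * d2 T a z) with
          (e * d2 T a z - s * (h a z * d2 T a z - k * d2 T a z)) by ring.
        apply is_derive_Rminus; [now apply is_derive_Rscal|].
        apply is_derive_Rscal. apply is_derive_Rminus; [apply Hf; lra|].
        now apply is_derive_Rscal.
      - assert (Hz' : strip a c) by (split; lra).
        assert (0 <= (e - s * (h a c - k)) * d2 T a c * (v - u)).
        { apply Rmult_le_pos; [|lra]. apply Rmult_le_pos; [|now apply Hmon].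
          specialize (Hh c ltac:(lra)). apply Rabs_le_between in Hh.
          destruct Hs as [-> | ->]; lra. }
        lra. }
    pose proof (HD 1 (or_introl eq_refl)). pose proof (HD (-1) (or_intror eq_refl)).
    abs_lra. }
  assert (HT : forall b, lo <= b <= hi -> lim_in strip T a b (T a b)).
  { intros b Hb. apply (coord_cont g G HC a b). split; lra. }
  assert (Hpath : forall (q : R -> R -> R) b s, lo <= b <= hi -> lim_in strip q a b (q a b) ->
     (forall n, 0 < n < b2 - b1 -> lo < b + s * n < hi) ->
     rlim (fun n => q a (b + s * n)) (q a b)).
  { intros q b s Hb Hq Hs.
    apply (lim_in_along strip a b R (at_right 0) q (q a b) (fun _ => a) (fun n => b + s * n));
      [exact Hq|apply filterlim_const| |].
    - assert (HL : rlim (fun n => b + s * n) (b + s * 0))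
        by right_lim.
      now rewrite Rmult_0_r, Rplus_0_r in HL.
    - apply near_right. exists (b2 - b1). split; [lra|]. intros n Hn.
      split; [exact Ha|now apply Hs]. }
  assert (Hb : lo <= b1 <= hi /\ lo <= b2 <= hi) by lra. destruct Hb as [Hb1' Hb2'].
  pose proof (Hpath f b1 1 Hb1' (Hlim b1 Hb1') ltac:(intros; lra)).
  pose proof (Hpath f b2 (-1) Hb2' (Hlim b2 Hb2') ltac:(intros; lra)).
  pose proof (Hpath T b1 1 Hb1' (HT b1 Hb1') ltac:(intros; lra)).
  pose proof (Hpath T b2 (-1) Hb2' (HT b2 Hb2') ltac:(intros; lra)).
  apply (lim_abs_le
    (fun n => f a (b2 + -1 * n) - f a (b1 + 1 * n) - k * (T a (b2 + -1 * n) - T a (b1 + 1 * n)))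
    (fun n => e * (T a (b2 + -1 * n) - T a (b1 + 1 * n)))).
  - right_lim.
  - right_lim.
  - apply near_right. exists ((b2 - b1) / 2). split; [lra|]. intros n Hn. apply Hin; lra.
Qed.

(** [h] is the derivative of [f] with respect to time along [dx/dt = u + c]. The
    second part gives a meaning to the values of [f] on the edges. *)
Definition transported (f h : R -> R -> R) : Prop :=
  (forall a b, strip a b -> is_derive (fun z => f a z) b (h a b * d2 T a b)) /\
  (forall a b, 0 < a < eps G -> lo <= b <= hi -> lim_in strip f a b (f a b)).

Lemma time_transported : transported T (fun _ _ => 1).
Proof.
  split.
  - intros a b Hab. rewrite Rmult_1_l. apply coord_derive; auto.
  - intros a b Ha Hb. apply (coord_cont g G HC a b). split; lra.
Qed.

Lemma fan_c_cont : cont_on lo hi fan_c.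
Proof.
  apply cont_on_continuous. intros b Hb. unfold fan_c.
  apply (continuous_minus (fun b => vel (fan G b)) (fun b => b)).
  - apply (fan_cont _ _ _ _ Hfan b Hb).
  - apply continuous_id.
Qed.

Lemma fan_c_inv_cont : cont_on lo hi (fun b => / (2 * fan_c b)).
Proof.
  apply cont_on_inv.
  - intros b Hb. pose proof (fan_c_pos b Hb). lra.
  - apply (cont_on_mult lo hi (fun _ => 2)); [apply cont_on_const|exact fan_c_cont].
Qed.

Lemma cont_on_interior (f : R -> R) (b : R) :
  cont_on lo hi f -> lo < b < hi -> continuous f b.
Proof.
  intros Hf Hb. apply filterlim_locally. intros e.
  destruct (cont_onP lo hi f b e Hf ltac:(lra) (cond_pos e)) as [d [Hd H]].
  set (r := Rmin d (Rmin (b - lo) (hi - b))).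
  assert (Hr : 0 < r /\ r <= d /\ r <= b - lo /\ r <= hi - b).
  { unfold r. min_lra. }
  exists (mkposreal r (proj1 Hr)). intros z Hz. change (Rabs (z - b) < r) in Hz.
  apply H; [abs_lra|lra].
Qed.

Lemma speed_unif :
  unif_lim speed_plus (fun b => b + 2 * fan_c b).
Proof.
  destruct speed_rates as [M [d [HM [Hd H]]]].
  apply (rate_unif _ _ M d); auto. intros a b Hab Ha. now apply H.
Qed.

Lemma space_transported : transported X speed_plus.
Proof.
  split.
  - intros a b Hab. unfold speed_plus.
    rewrite <- (alpha_curve g G HC a b Hab). apply coord_derive; auto.
  - intros a b Ha Hb. apply (coord_cont g G HC a b). split; lra.
Qed.

Definition ent_x (x t : R) : R := d1 (fun y h => ent (w G y h)) x t.

Lemma wave_open (x t : R) : Dwave G x t -> locally_2d (Dwave G) x t.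
Proof.
  intros HD. apply between_open; [| |exact HD];
  apply (curves_continuous t); apply HD.
Qed.

Lemma wave_diff (x t : R) : Dwave G x t ->
  diff2 (fun y h => rho (w G y h)) x t /\ diff2 (fun y h => vel (w G y h)) x t /\
  diff2 (fun y h => ent (w G y h)) x t /\ continuity_2d_pt ent_x x t.
Proof.
  intros HD. destruct (wave_open x t HD) as [d Hd].
  assert (HE : forall f, (forall y h, Dwave G y h -> ex_diff_n f 2 y h) -> diff2 f x t).
  { intros f Hf. apply diff2_C1. exists d. intros u v Hu Hv.
    apply (ex_diff_n_m 2 1); [auto|]. now apply Hf, Hd. }
  split; [|split; [|split]].
  - apply HE. intros y h H. apply (wave_smooth g G HS y h H).
  - apply HE. intros y h H. apply (wave_smooth g G HS y h H).
  - apply HE. intros y h H. apply (wave_smooth g G HS y h H).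
  - apply (wave_smooth g G HS x t HD).
Qed.

Lemma wave_state_continuous (a b : R) : 0 < a < eps G -> lo <= b <= hi ->
  continuous_state (w G) (X a b) (T a b) /\ 0 < rho (W a b).
Proof.
  intros Ha Hb.
  assert (HP : forall x t, 0 < t < tau G -> Xhead G t <= x <= Xtail G t ->
     0 < rho (w G x t)).
  { intros x t Ht Hx. pose proof (curve_order g G HW t Ht).
    apply (no_vacuum g G HS); lra. }
  destruct (Req_dec b lo) as [-> |Hlo].
  { destruct (coord_head g G HC a Ha) as [Ht ->].
    pose proof (curve_order g G HW _ Ht).
    split; [apply (head_curve g G HW _ Ht)|]. apply HP; lra. }
  destruct (Req_dec b hi) as [-> |Hhi].
  { destruct (coord_tail g G HC a Ha) as [Ht ->].
    pose proof (curve_order g G HW _ Ht).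
    split; [apply (tail_curve g G HW _ Ht)|]. apply HP; lra. }
  assert (HD : Dwave G (X a b) (T a b)) by (apply (coord_in g G HC); split; lra).
  destruct (wave_smooth g G HS _ _ HD) as [Sr [Sv Ss]].
  split; [split; [apply Sr|split; [apply Sv|apply Ss]]|].
  apply HP; [apply HD|]. destruct HD as [_ HD]. lra.
Qed.

Lemma coords_lim_in (q : R -> R -> R) (a b : R) :
  0 < a < eps G -> lo <= b <= hi -> continuity_2d_pt q (X a b) (T a b) ->
  lim_in strip (fun a b => q (X a b) (T a b)) a b (q (X a b) (T a b)).
Proof.
  intros Ha Hb Hq. destruct (coord_cont g G HC a b) as [LX LT]; [split; lra|].
  now apply lim_in_comp2.
Qed.

Lemma wave_lim_in (phi : R -> R -> R) (a b : R) :
  0 < a < eps G -> lo <= b <= hi ->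
  continuity_2d_pt phi (rho (W a b)) (ent (W a b)) ->
  lim_in strip (fun a b => phi (rho (W a b)) (ent (W a b))) a b
    (phi (rho (W a b)) (ent (W a b))).
Proof.
  intros Ha Hb Hphi. destruct (wave_state_continuous a b Ha Hb) as [[Cr [_ Cs]] _].
  apply lim_in_comp2; [exact Hphi| |].
  - now apply (coords_lim_in (fun x t => rho (w G x t))).
  - now apply (coords_lim_in (fun x t => ent (w G x t))).
Qed.

Lemma wave_jet (a b : R) : strip a b ->
  let x := X a b in let t := T a b in
  euler_jet g (w G x t)
    (d1 (fun y h => rho (w G y h)) x t) (d2 (fun y h => rho (w G y h)) x t)
    (d1 (fun y h => vel (w G y h)) x t) (d2 (fun y h => vel (w G y h)) x t)
    (ent_x x t) (d2 (fun y h => ent (w G y h)) x t).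
Proof.
  intros Hab x t. assert (HD : Dwave G x t) by now apply (coord_in g G HC).
  destruct (wave_diff x t HD) as [Dr [Dv [Ds _]]].
  apply (euler_primitive g Hg (Dwave G) (w G) x t); auto.
  - exact (euler_wave g G HS).
  - apply (in_box x t). tauto.
Qed.

Lemma beta_derive (q : R -> R -> R) (a b : R) : strip a b -> diff2 q (X a b) (T a b) ->
  is_derive (fun z => q (X a z) (T a z)) b
    ((d2 q (X a b) (T a b) + speed_plus a b * d1 q (X a b) (T a b)) * d2 T a b).
Proof.
  intros Hab Hq.
  replace ((d2 q (X a b) (T a b) + speed_plus a b * d1 q (X a b) (T a b)) * d2 T a b)
    with (d1 q (X a b) (T a b) * d2 X a b + d2 q (X a b) (T a b) * d2 T a b).
  - apply (is_derive_path q (fun z => X a z) (fun z => T a z)); [exact Hq| |];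
    apply coord_derive; auto.
  - rewrite (alpha_curve g G HC a b Hab). unfold speed_plus. ring.
Qed.

Lemma alpha_derive (q : R -> R -> R) (a b : R) : strip a b -> diff2 q (X a b) (T a b) ->
  is_derive (fun z => q (X z b) (T z b)) a
    ((d2 q (X a b) (T a b) + speed_minus a b * d1 q (X a b) (T a b)) * d1 T a b).
Proof.
  intros Hab Hq.
  replace ((d2 q (X a b) (T a b) + speed_minus a b * d1 q (X a b) (T a b)) * d1 T a b)
    with (d1 q (X a b) (T a b) * d1 X a b + d2 q (X a b) (T a b) * d1 T a b).
  - apply (is_derive_path q (fun z => X z b) (fun z => T z b)); [exact Hq| |];
    apply coord_derive; auto.
  - rewrite (beta_curve g G HC a b Hab). unfold speed_minus. ring.
Qed.

(** The quantity [c s_x], in characteristic coordinates. *)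
Definition ent_flux (a b : R) : R := csound g (W a b) * ent_x (X a b) (T a b).

(** As [s_t + u s_x = 0], the derivative of the entropy along [u + c] is
    [c s_x]. *)
Lemma entropy_transported : transported (fun a b => ent (W a b)) ent_flux.
Proof.
  split.
  - intros a b Hab. pose proof (wave_jet a b Hab) as HJ. simpl in HJ.
    assert (HD : Dwave G (X a b) (T a b)) by now apply (coord_in g G HC).
    destruct (wave_diff _ _ HD) as [_ [_ [Ds _]]].
    replace (ent_flux a b * d2 T a b) with
      ((d2 (fun y h => ent (w G y h)) (X a b) (T a b)
        + speed_plus a b * ent_x (X a b) (T a b)) * d2 T a b).
    + exact (beta_derive (fun y h => ent (w G y h)) a b Hab Ds).
    + f_equal. pose proof (jet_entropy HJ).
      unfold ent_flux, speed_plus. lra.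
  - intros a b Ha Hb. apply (coords_lim_in (fun x t => ent (w G x t))); auto.
    apply (wave_state_continuous a b Ha Hb).
Qed.

(** In the same way, the derivative of the entropy along [u - c] is [- c s_x]. *)
Lemma entropy_alpha (a b : R) : strip a b ->
  is_derive (fun z => ent (W z b)) a (- ent_flux a b * d1 T a b).
Proof.
  intros Hab. pose proof (wave_jet a b Hab) as HJ. simpl in HJ.
  assert (HD : Dwave G (X a b) (T a b)) by now apply (coord_in g G HC).
  destruct (wave_diff _ _ HD) as [_ [_ [Ds _]]].
  replace (- ent_flux a b * d1 T a b) with
    ((d2 (fun y h => ent (w G y h)) (X a b) (T a b)
        + speed_minus a b * ent_x (X a b) (T a b)) * d1 T a b).
  - exact (alpha_derive (fun y h => ent (w G y h)) a b Hab Ds).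
  - f_equal. pose proof (jet_entropy HJ).
    unfold ent_flux, speed_minus. lra.
Qed.

Lemma ent_flux_continuous (a b : R) : strip a b -> continuous (ent_flux a) b.
Proof.
  intros Hab. assert (HD : Dwave G (X a b) (T a b)) by now apply (coord_in g G HC).
  destruct (wave_diff _ _ HD) as [_ [_ [_ Cx]]].
  assert (Hab' : 0 < a < eps G /\ lo <= b <= hi) by (destruct Hab; lra).
  destruct (wave_state_continuous a b (proj1 Hab') (proj2 Hab')) as [[Cr [_ Cs]] Hp].
  assert (CX : continuous (fun z => X a z) b).
  { apply (ex_derive_continuous (fun z => X a z) b). exists (d2 X a b).
    apply coord_derive; auto. }
  assert (CT : continuous (fun z => T a z) b).
  { apply (ex_derive_continuous (fun z => T a z) b). exists (d2 T a b).
    apply coord_derive; auto. }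
  apply (continuous_mult (fun z => csound g (W a z)) (fun z => ent_x (X a z) (T a z))).
  - apply (filterlim_2d R (locally b) (sound g) (fun z => rho (W a z)) (fun z => ent (W a z))).
    + now apply sound_cont.
    + now apply (filterlim_2d R (locally b) (fun y h => rho (w G y h))).
    + now apply (filterlim_2d R (locally b) (fun y h => ent (w G y h))).
  - now apply (filterlim_2d R (locally b) ent_x).
Qed.

Lemma unif_lim_at (f : R -> R -> R) (f0 : R -> R) (b : R) :
  unif_lim f f0 -> lo < b < hi ->
  rlim (fun a => f a b) (f0 b).
Proof.
  intros H Hb. apply right_limP. intros e He. destruct (H e He) as [d [Hd HH]].
  pose proof (eps_pos g G HC) as He0.
  exists (Rmin d (eps G)). split; [now apply Rmin_pos|]. intros a Ha.
  Rmin_bounds (Rmin d (eps G)).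
  apply HH; [split; lra|lra].
Qed.

Lemma unif_lim_continuous (f : R -> R -> R) (f0 : R -> R) (b : R) :
  unif_lim f f0 -> lo < b < hi ->
  (forall a, strip a b -> continuous (f a) b) -> continuous f0 b.
Proof.
  intros H Hb Hc. apply filterlim_locally. intros e.
  destruct (H (e / 3)) as [d [Hd HH]]; [pose proof (cond_pos e); lra|].
  pose proof (eps_pos g G HC) as He0.
  set (a := Rmin d (eps G) / 2).
  assert (Ha : 0 < a /\ a < d /\ a < eps G).
  { unfold a. min_lra. }
  assert (He3 : 0 < e / 3) by (pose proof (cond_pos e); lra).
  assert (Hca : filterlim (f a) (locally b) (locally (f a b))) by (apply Hc; split; lra).
  destruct (proj1 (filterlim_locally _ _) Hca (mkposreal _ He3)) as [r Hr].
  pose proof (cond_pos r).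
  set (r' := Rmin r (Rmin (b - lo) (hi - b))).
  assert (Hr' : 0 < r' /\ r' <= r /\ r' <= b - lo /\ r' <= hi - b).
  { unfold r'. min_lra. }
  exists (mkposreal r' (proj1 Hr')). intros z Hz. change (Rabs (z - b) < r') in Hz.
  assert (Hzb : lo < z < hi) by abs_lra.
  pose proof (HH a b ltac:(split; lra) ltac:(lra)) as U1.
  pose proof (HH a z ltac:(split; lra) ltac:(lra)) as U2.
  assert (U3 : Rabs (f a z - f a b) < e / 3).
  { apply (Hr z). change (Rabs (z - b) < r). lra. }
  change (Rabs (f0 z - f0 b) < e).
  abs_lra.
Qed.

(** * The rate of time at the origin *)

(** The estimate for increments, divided by [alpha]: the quotients of [t] tend
    to the rate. *)
Lemma stieltjes_limit (f h : R -> R -> R) (h0 : R -> R) (b1 b2 k e D : R) :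
  transported f h -> unif_lim h h0 ->
  lo <= b1 -> b1 <= b2 -> b2 <= hi ->
  (forall b, b1 < b < b2 -> Rabs (h0 b - k) <= e) ->
  rlim (fun a => (f a b2 - f a b1) / a) D ->
  Rabs (D - k * (A b2 - A b1)) <= e * (A b2 - A b1).
Proof.
  intros [Hf Hlim] Hh Hb1 Hb12 Hb2 Hk HD.
  destruct time_beta_nonneg as [d [Hd [Hde Hmon]]].
  assert (HT : rlim (fun a => (T a b2 - T a b1) / a) (A b2 - A b1)).
  { apply (quotient_diff0 (fun a => T a b1) (fun a => T a b2)); apply A_quot; lra. }
  assert (Hq : forall q, 0 < q ->
    Rabs (D - k * (A b2 - A b1)) <= (e + q) * (A b2 - A b1)).
  { intros q Hq. destruct (Hh q Hq) as [d' [Hd' Hh']].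
    apply (lim_abs_le (fun a => (f a b2 - f a b1) / a - k * ((T a b2 - T a b1) / a))
      (fun a => (e + q) * ((T a b2 - T a b1) / a))).
    { apply right_lim_minus; [exact HD|]. now apply right_lim_mult; [apply filterlim_const|]. }
    { now apply right_lim_mult; [apply filterlim_const|]. }
    apply near_right. exists (Rmin d d'). split; [now apply Rmin_pos|].
    intros a Ha. Rmin_bounds (Rmin d d').
    assert (HB : Rabs (f a b2 - f a b1 - k * (T a b2 - T a b1))
                 <= (e + q) * (T a b2 - T a b1)).
    { apply (stieltjes d a b1 b2 k (e + q) f h); auto; try lra.
      - intros b Hb. apply Hf. split; lra.
      - intros b Hb. apply Hlim; lra.
      - intros b Hb. specialize (Hk b Hb).
        specialize (Hh' a b ltac:(split; lra) ltac:(lra)).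
        abs_lra. }
    replace ((f a b2 - f a b1) / a - k * ((T a b2 - T a b1) / a))
      with ((f a b2 - f a b1 - k * (T a b2 - T a b1)) * / a) by (field; lra).
    rewrite Rabs_mult, (Rabs_pos_eq (/ a)) by (left; apply Rinv_0_lt_compat; lra).
    unfold Rdiv. rewrite <- Rmult_assoc. apply Rmult_le_compat_r; [|exact HB].
    left; apply Rinv_0_lt_compat; lra. }
  apply le_epsilon. intros q Hq'.
  destruct (small_factor 1 (A b2 - A b1) q Rlt_0_1 Hq') as [n [Hn HnA]].
  specialize (Hq n (proj1 Hn)). lra.
Qed.

Lemma rate_monotone (b1 b2 : R) : lo <= b1 -> b1 <= b2 -> b2 <= hi -> A b1 <= A b2.
Proof.
  intros Hb1 Hb12 Hb2.
  assert (H : Rabs (A b2 - A b1 - 0 * (A b2 - A b1)) <= 1 * (A b2 - A b1)).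
  { apply (stieltjes_limit T (fun _ _ => 1) (fun _ => 1)); auto.
    - exact time_transported.
    - intros e He. exists 1. split; [lra|]. intros a b _ _.
      rewrite Rminus_diag, Rabs_R0. exact He.
    - intros b _. rewrite Rminus_0_r, Rabs_R1. lra.
    - apply (quotient_diff0 (fun a => T a b1) (fun a => T a b2)); apply A_quot; lra. }
  pose proof (Rabs_pos (A b2 - A b1 - 0 * (A b2 - A b1))). lra.
Qed.

(** Local form, at a point of continuity of [h0]: the derivative of [F] with
    respect to the rate is [h0]. *)
Lemma stieltjes_local (f h : R -> R -> R) (h0 F : R -> R) (b e : R) :
  transported f h -> unif_lim h h0 -> lo < b < hi -> continuous h0 b ->
  (forall b1 b2, lo < b1 -> b1 <= b2 -> b2 < hi ->
    rlim (fun a => (f a b2 - f a b1) / a) (F b2 - F b1)) ->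
  0 < e -> exists d, 0 < d /\ forall z, lo < z < hi -> Rabs (z - b) < d ->
    Rabs (F z - F b - h0 b * (A z - A b)) <= e * Rabs (A z - A b).
Proof.
  intros Hf Hh Hb Hc HF He.
  destruct (proj1 (filterlim_locally _ _) Hc (mkposreal e He)) as [d Hd].
  exists d. split; [apply cond_pos|]. intros z Hz Hzb.
  assert (Hh0 : forall y, Rmin z b < y < Rmax z b -> Rabs (h0 y - h0 b) <= e).
  { intros y Hy. left. apply (Hd y). change (Rabs (y - b) < d).
    apply Rabs_lt_between in Hzb. apply Rabs_lt_between.
    unfold Rmin, Rmax in Hy. repeat destruct Rle_dec; lra. }
  destruct (Rle_dec b z) as [Hbz|Hbz].
  - rewrite Rmin_right, Rmax_left in Hh0 by lra.
    rewrite (Rabs_pos_eq (A z - A b)).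
    + apply (stieltjes_limit f h h0); auto; try lra. apply HF; lra.
    + pose proof (rate_monotone b z). lra.
  - rewrite Rmin_left, Rmax_right in Hh0 by lra.
    rewrite Rabs_minus_sym, (Rabs_minus_sym (A z)).
    rewrite (Rabs_pos_eq (A b - A z)) by (pose proof (rate_monotone z b); lra).
    replace (h0 b * (A z - A b) - (F z - F b))
      with (F b - F z - h0 b * (A b - A z)) by ring.
    apply (stieltjes_limit f h h0); auto; try lra. apply HF; lra.
Qed.

Lemma space_quotient (b : R) : lo < b < hi -> rlim (fun a => X a b / a) (b * A b).
Proof.
  intros Hb.
  destruct time_bounds as [m [M [C [d [Hm [HM [HC0 [Hd [Hde HB]]]]]]]]].
  apply (filterlim_ext (fun a => (X a b - b * T a b) / a + b * (T a b / a))).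
  { intros a. unfold Rdiv. ring. }
  rewrite <- (Rplus_0_l (b * A b)). apply right_lim_plus.
  2:{ apply right_lim_mult; [apply filterlim_const|]. apply A_quot. lra. }
  apply right_limP. intros e He. destruct (small_factor d C e Hd He) as [n [Hn HnC]].
  exists n. split; [apply Hn|]. intros a Ha.
  destruct (HB a b) as [_ [_ HX]]; [split; lra|lra|].
  rewrite Rminus_0_r. apply Rabs_div_lt; [lra|].
  apply Rle_lt_trans with (1 := HX). apply Rmult_lt_compat_r; nra.
Qed.

(** For [x], whose quotients tend to [beta A], the local estimate reads
    [(beta A)' = (beta + 2 c) A'] up to small errors, that is [A' = A / (2 c)].
    It is solved for the difference quotient of [A], so that it also yields the
    existence of the derivative. *)
Lemma rate_derive (b : R) : lo < b < hi ->
  is_derive A b (A b / (2 * fan_c b)).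
Proof.
  intros Hb. pose proof (A_pos b ltac:(lra)) as HAb.
  pose proof (fan_c_pos b ltac:(lra)) as Hc.
  set (c := fan_c b) in *.
  apply is_derive_Reals. intros e He.
  destruct (small_factor c (A b) (e * (2 * c * c))) as [n [Hn HnA]];
    [assumption|apply Rmult_lt_0_compat; nra|].
  destruct (stieltjes_local X speed_plus (fun b => b + 2 * fan_c b)
    (fun b => b * A b) b (n / 2)) as [d [Hd HL]].
  - exact space_transported.
  - exact speed_unif.
  - exact Hb.
  - apply (continuous_plus (fun b => b) (fun b => 2 * fan_c b)); [apply continuous_id|].
    apply (continuous_scal_r 2 fan_c). apply cont_on_interior; [exact fan_c_cont|exact Hb].
  - intros b1 b2 Hb1 Hb12 Hb2.
    apply (quotient_diff0 (fun a => X a b1) (fun a => X a b2)); apply space_quotient; lra.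
  - lra.
  - set (r := Rmin (Rmin d (n / 2)) (Rmin (b - lo) (hi - b))).
    assert (Hr : 0 < r /\ r <= d /\ r <= n / 2 /\ r <= b - lo /\ r <= hi - b).
    { unfold r. min_lra. }
    exists (mkposreal r (proj1 Hr)). simpl. intros h Hh0 Hh.
    assert (Hbh : Rabs (b + h - b) < d) by (replace (b + h - b) with h by ring; lra).
    specialize (HL (b + h) ltac:(abs_lra) Hbh).
    set (q := (A (b + h) - A b) / h).
    assert (Hq' : A (b + h) - A b = q * h) by (unfold q; field; assumption).
    (* The increment of [beta A] is [q b + A b + q h] times [h]. *)
    assert (HL' : Rabs (A b - 2 * c * q) <= n * Rabs q).
    { fold c in HL. replace (A (b + h)) with (A b + q * h) in HL by lra.
      replace ((b + h) * (A b + q * h) - b * A b - (b + 2 * c) * (A b + q * h - A b))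
        with ((A b - 2 * c * q + q * h) * h) in HL by ring.
      replace (A b + q * h - A b) with (q * h) in HL by ring.
      rewrite !Rabs_mult, <- Rmult_assoc in HL.
      apply Rmult_le_reg_r in HL; [|now apply Rabs_pos_lt].
      assert (H1 : Rabs (q * h) <= Rabs q * (n / 2)).
      { rewrite Rabs_mult. apply Rmult_le_compat_l; [apply Rabs_pos|lra]. }
      abs_lra. }
    assert (Hqb : Rabs q * c <= A b).
    { assert (H1 : 2 * c * Rabs q <= A b + n * Rabs q).
      { rewrite <- (Rabs_pos_eq (2 * c)), <- Rabs_mult by lra.
        replace (2 * c * q) with (A b - (A b - 2 * c * q)) by ring.
        apply Rle_trans with (1 := Rabs_triang _ _). rewrite Rabs_Ropp.
        rewrite (Rabs_pos_eq (A b)) by lra. lra. }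
      pose proof (Rabs_pos q). nra. }
    replace (q - A b / (2 * c)) with (- (A b - 2 * c * q) / (2 * c)) by (field; lra).
    apply Rabs_div_lt; [lra|]. rewrite Rabs_Ropp.
    apply Rmult_lt_reg_r with c; [assumption|].
    replace (e * (2 * c) * c) with (e * (2 * c * c)) by ring.
    apply Rle_lt_trans with (n * Rabs q * c); [apply Rmult_le_compat_r; lra|].
    apply Rle_lt_trans with (n * A b); [|exact HnA].
    rewrite Rmult_assoc. apply Rmult_le_compat_l; lra.
Qed.

Lemma time_to_zero (b : R) : lo <= b <= hi ->
  filterlim (fun a => T a b) (at_right 0) (at_right 0).
Proof.
  intros Hb.
  assert (HL : rlim (fun a => T a b / a * a) (A b * 0)).
  { apply right_lim_mult; [now apply A_quot|exact right_lim_id]. }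
  rewrite Rmult_0_r in HL. pose proof (eps_pos g G HC) as He0.
  intros P HP. apply near_right in HP. destruct HP as [d [Hd HP]].
  destruct (proj1 (right_limP _ _) HL d Hd) as [d' [Hd' H]].
  apply near_right. exists (Rmin d' (eps G)). split; [now apply Rmin_pos|].
  intros a Ha. Rmin_bounds (Rmin d' (eps G)).
  pose proof (tab_pos a b ltac:(lra) Hb) as HT.
  apply HP. split; [apply HT|]. specialize (H a ltac:(lra)).
  replace (T a b / a * a - 0) with (T a b) in H by (field; lra).
  abs_lra.
Qed.

(** Difference quotients in [t] along an edge, expressed in [alpha]. *)
Lemma edge_alpha (F : R -> R) (f : R -> R) (l q b : R) :
  lo <= b <= hi -> (forall a, 0 < a < eps G -> f a = F (T a b)) ->
  rlim (fun t => (F t - l) / t) q ->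
  rlim (fun a => (f a - l) / a) (q * A b).
Proof.
  intros Hb Hf HF.
  apply (filterlim_ext_loc (fun a => (F (T a b) - l) / T a b * (T a b / a))).
  - pose proof (eps_pos g G HC) as He0. apply near_right.
    exists (eps G). split; [assumption|]. intros a Ha. rewrite Hf by assumption.
    pose proof (tab_pos a b Ha Hb). field. lra.
  - apply right_lim_mult; [|now apply A_quot].
    apply (filterlim_comp _ _ _ (fun a => T a b) (fun t => (F t - l) / t) _ (at_right 0));
      [now apply time_to_zero|exact HF].
Qed.

(** The product of the rate and [exp (- int 1 / (2 c))] has derivative zero. *)
Lemma rate_Pi (b : R) : lo <= b <= hi -> A b = A lo * Pi g G b.
Proof.
  intros Hb.
  destruct (cont_on_primitive lo hi lohi _ fan_c_inv_cont) as [Phi [HPhi HPhiE]].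
  assert (HP : Pi g G b = exp (Phi b)).
  { rewrite HPhiE by assumption. unfold Pi. f_equal. apply RInt_ext. intros z Hz.
    rewrite Rmin_left, Rmax_right in Hz by lra. unfold c0.
    rewrite fan_cE by lra. reflexivity. }
  assert (HPhi0 : Phi lo = 0).
  { rewrite HPhiE by lra. apply (RInt_point (V := CR)). }
  set (E := fun z => exp (- Phi z)).
  assert (HE : forall z, is_derive E z (- / (2 * fan_c (clamp lo hi z)) * E z)).
  { intros z. unfold E.
    apply (is_derive_comp exp (fun z => - Phi z) z (exp (- Phi z))
             (- / (2 * fan_c (clamp lo hi z)))).
    - apply is_derive_Reals, derivable_pt_lim_exp.
    - apply (is_derive_opp Phi). apply HPhi. }
  assert (HC0 : A b * E b = A lo * E lo).
  { apply (cont_on_zero_derive lo hi (fun z => A z * E z)); [| |assumption].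
    - apply cont_on_mult; [exact A_cont|]. exact (cont_on_derive lo hi E _ HE).
    - intros z Hz.
      replace 0 with (A z / (2 * fan_c z) * E z + A z * (- / (2 * fan_c z) * E z)).
      + apply is_derive_Rmult.
        * exact (rate_derive z Hz).
        * pose proof (HE z) as HEz. rewrite clamp_id in HEz; [exact HEz|lra].
      + pose proof (fan_c_pos z ltac:(lra)). field. lra. }
  unfold E in HC0. rewrite HPhi0, Ropp_0, exp_0, Rmult_1_r in HC0.
  rewrite <- HC0, HP, Rmult_assoc, <- exp_plus, Rplus_opp_l, exp_0. ring.
Qed.

(** On a short interval of [beta], both the increment of [f / alpha] and that of
    the primitive [Phi] of [H0 A'] are close to [k] times the increment of the
    rate, where [k] is a value of [H0]. The errors are small compared with the
    length of the interval and can be added up. By [rate_Pi], [A' = A / (2 c)]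
    is the weight [Pi / (2 c)] up to a constant. *)
Lemma transported_quotient (f h : R -> R -> R) (H0 : R -> R) :
  transported f h -> unif_lim h H0 -> cont_on lo hi H0 ->
  rlim (fun a => (f a hi - f a lo) / a)
    (A lo * RInt (fun xi => / (2 * c0 g G xi) * Pi g G xi * H0 xi) lo hi).
Proof.
  intros Hf Hh Hc0.
  set (A' := fun b => A b / (2 * fan_c b)).
  assert (HA'c : cont_on lo hi A').
  { apply (cont_on_mult lo hi A); [exact A_cont|]. exact fan_c_inv_cont. }
  assert (HA' : forall b, lo < b < hi -> is_derive A b (A' b)) by exact rate_derive.
  destruct (cont_on_bounded lo hi lohi A' HA'c) as [L [HL HLb]].
  pose proof (A_pos lo ltac:(lra)) as Plo.
  set (k := fun xi => / (2 * c0 g G xi) * Pi g G xi * H0 xi).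
  assert (Hk : forall b, lo <= b <= hi -> A lo * k b = H0 b * A' b).
  { intros b Hb. unfold k, A', c0. rewrite fan_cE, (rate_Pi b) by assumption.
    unfold Rdiv. ring. }
  destruct (cont_on_primitive lo hi lohi k) as [Psi [HPsi HPsiE]].
  { apply (cont_on_ext lo hi (fun b => / A lo * (H0 b * A' b))).
    - intros b Hb. rewrite <- Hk by assumption. field. lra.
    - apply (cont_on_mult lo hi (fun _ => / A lo)); [apply cont_on_const|].
      now apply cont_on_mult. }
  rewrite <- HPsiE by lra.
  set (Phi := fun b => A lo * Psi b).
  assert (HPhi0 : Phi lo = 0).
  { unfold Phi. rewrite HPsiE, RInt_point by lra. apply Rmult_0_r. }
  assert (HPhic : cont_on lo hi Phi).
  { apply (cont_on_mult lo hi (fun _ => A lo)); [apply cont_on_const|].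
    exact (cont_on_derive lo hi Psi _ HPsi). }
  assert (HPhid : forall b, lo < b < hi -> is_derive Phi b (H0 b * A' b)).
  { intros b Hb. rewrite <- Hk by lra. apply is_derive_Rscal.
    pose proof (HPsi b) as HP. rewrite clamp_id in HP; [exact HP|lra]. }
  replace (A lo * Psi hi) with (Phi hi - Phi lo) by (rewrite HPhi0; apply Rminus_0_r).
  clearbody Phi. clear k Hk Psi HPsi HPsiE HPhi0.
  destruct time_beta_nonneg as [dm [Hdm [_ Hmon]]].
  pose proof (eps_pos g G HC) as He0.
  assert (Hall : forall n, 0 < n -> at_right 0 (fun a =>
    Rabs (f a hi - f a lo - a * (Phi hi - Phi lo)) <= n * a * (hi - lo))).
  { intros n Hn.
    apply (cousin (fun u v => at_right 0 (fun a =>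
      Rabs (f a v - f a u - a * (Phi v - Phi u)) <= n * a * (v - u))) lo hi).
    - lra.
    - intros x Hx. set (k := H0 x).
      destruct (small_factor 1 (3 * L + 3 + Rabs k) n Rlt_0_1 Hn) as [r [Hr HrK]].
      destruct (cont_onP lo hi H0 x r Hc0 Hx (proj1 Hr)) as [d [Hd HH0]].
      exists d. split; [assumption|]. intros u v Hu Hv Hlu Hvh.
      destruct (Req_dec u v) as [<- |Huv].
      { apply filter_forall. intros a.
        replace (f a u - f a u - a * (Phi u - Phi u)) with 0 by ring.
        rewrite Rabs_R0. lra. }
      assert (Hnear : forall b, u < b < v -> Rabs (H0 b - k) <= r).
      { intros b Hb. left. apply HH0; [lra|]. abs_lra. }
      assert (HdA : 0 <= A v - A u <= L * (v - u)).
      { split.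
        - pose proof (rate_monotone u v). lra.
        - assert (HB : Rabs (A v - A u - 0 * (v - u)) <= L * (v - u)).
          { apply (mvt_cont_on lo hi A A'); auto; try lra.
            intros b Hb. rewrite Rminus_0_r. apply HLb. lra. }
          abs_lra. }
      assert (HdPhi : Rabs (Phi v - Phi u - k * (A v - A u)) <= r * L * (v - u)).
      { assert (HB : Rabs ((Phi v - k * A v) - (Phi u - k * A u) - 0 * (v - u))
                     <= r * L * (v - u)).
        { apply (mvt_cont_on lo hi (fun b => Phi b - k * A b)
            (fun b => (H0 b - k) * A' b)); try lra.
          - apply cont_on_minus; [exact HPhic|].
            apply (cont_on_mult lo hi (fun _ => k)); [apply cont_on_const|exact A_cont].
          - intros b Hb. replace ((H0 b - k) * A' b) with (H0 b * A' b - k * A' b) by ring.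
            apply is_derive_Rminus; [now apply HPhid|]. apply is_derive_Rscal. now apply HA'.
          - intros b Hb. rewrite Rminus_0_r, Rabs_mult.
            apply Rmult_le_compat; try apply Rabs_pos; [now apply Hnear|].
            apply HLb. lra. }
        abs_lra. }
      assert (HT : rlim (fun a => (T a v - T a u) / a) (A v - A u)).
      { apply (quotient_diff0 (fun a => T a u) (fun a => T a v)); apply A_quot; lra. }
      destruct (proj1 (right_limP _ _) HT (r * (v - u))) as [dt [Hdt HdT]].
      { apply Rmult_lt_0_compat; lra. }
      destruct (Hh r (proj1 Hr)) as [dh [Hdh Hhh]].
      apply near_right. exists (Rmin (Rmin dm dt) (Rmin dh (eps G))).
      split; [repeat apply Rmin_pos; auto|]. intros a Ha.
      assert (Ha' : 0 < a /\ a < dm /\ a < dt /\ a < dh /\ a < eps G).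
      { revert Ha. min_lra. }
      specialize (HdT a ltac:(lra)).
      set (DT := (T a v - T a u) / a) in *.
      assert (EDT : T a v - T a u = DT * a) by (unfold DT; field; lra).
      assert (HS1 : Rabs (f a v - f a u - k * (T a v - T a u)) <= 2 * r * (T a v - T a u)).
      { apply (stieltjes dm a u v k (2 * r) f h); auto; try lra.
        - intros b Hb. apply Hf. split; lra.
        - intros b Hb. apply Hf; lra.
        - intros b Hb. specialize (Hnear b Hb).
          specialize (Hhh a b ltac:(split; lra) ltac:(lra)).
          abs_lra. }
      rewrite EDT in HS1.
      assert (HDT : 0 <= DT <= (L + r) * (v - u) /\ Rabs (k * (DT - (A v - A u)))
                    <= Rabs k * (r * (v - u))).
      { split.
        - split.
          + assert (0 <= 2 * r * (DT * a)).
            { apply Rle_trans with (2 := HS1). apply Rabs_pos. }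
            apply Rmult_le_reg_l with (2 * r * a).
            * apply Rmult_lt_0_compat; lra.
            * rewrite Rmult_0_r. lra.
          + abs_lra.
        - rewrite Rabs_mult. apply Rmult_le_compat_l; [apply Rabs_pos|lra]. }
      destruct HDT as [HDT HDTk].
      assert (Hgoal : Rabs ((f a v - f a u - k * (DT * a))
         + a * (k * (DT - (A v - A u)) - (Phi v - Phi u - k * (A v - A u))))
         <= n * a * (v - u)).
      { apply Rle_trans with (1 := Rabs_triang _ _).
        apply Rle_trans with (2 * r * (DT * a)
          + a * (Rabs k * (r * (v - u)) + r * L * (v - u))).
        - apply Rplus_le_compat; [exact HS1|].
          rewrite Rabs_mult, (Rabs_pos_eq a) by lra. apply Rmult_le_compat_l; [lra|].
          apply Rle_trans with (1 := Rabs_triang _ _). rewrite Rabs_Ropp. lra.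
        - apply Rle_trans with (a * (v - u) * (r * (3 * L + 3 + Rabs k))).
          + assert (Q1 : 2 * r * (DT * a) <= 2 * r * a * ((L + r) * (v - u))).
            { replace (2 * r * (DT * a)) with (2 * r * a * DT) by ring.
              apply Rmult_le_compat_l; [|lra]. apply Rmult_le_pos; lra. }
            assert (Q2 : 0 <= a * (v - u) * r * (3 - 2 * r)).
            { apply Rmult_le_pos; [|lra]. apply Rmult_le_pos; [|lra].
              apply Rmult_le_pos; lra. }
            lra.
          + replace (n * a * (v - u)) with (a * (v - u) * n) by ring.
            apply Rmult_le_compat_l; [|lra]. apply Rmult_le_pos; lra. }
      replace (f a v - f a u - a * (Phi v - Phi u)) with
        ((f a v - f a u - k * (DT * a))
         + a * (k * (DT - (A v - A u)) - (Phi v - Phi u - k * (A v - A u)))) by ring.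
      exact Hgoal.
    - intros u v z _ _ P1 P2. generalize (filter_and _ _ P1 P2).
      apply filter_imp. intros a [Q1 Q2].
      abs_lra. }
  apply right_limP. intros e He.
  destruct (proj1 (near_right _) (Hall (e / 2 / (hi - lo)) ltac:(apply Rdiv_lt_0_compat; lra)))
    as [d [Hd H]].
  exists d. split; [assumption|]. intros a Ha. specialize (H a Ha).
  replace (e / 2 / (hi - lo) * a * (hi - lo)) with (e / 2 * a) in H by (field; lra).
  replace ((f a hi - f a lo) / a - (Phi hi - Phi lo)) with
    ((f a hi - f a lo - a * (Phi hi - Phi lo)) / a) by (field; lra).
  apply Rabs_div_lt; [lra|]. nra.
Qed.

(** * The entropy gradient at the origin *)

Let entropy_quotient (b q : R) : Prop :=
  rlim (fun a => (ent (W a b) - ent (UL G)) / a) q.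

(** Inside the wave, [c s_x] is inversely proportional to the square of
    [t_alpha]. Indeed the quotients of the entropy have the limit [F = - S0 A],
    since [s_alpha = - c s_x t_alpha], and increments [S0 dA], since
    [s_beta = c s_x t_beta]; hence [(F A)' = 0]. *)
Lemma entropy_interior : exists (S0 : R -> R) (C : R),
  unif_lim ent_flux S0 /\
  forall b, lo < b < hi -> S0 b = - C / (A b * A b) /\ entropy_quotient b (C / A b).
Proof.
  assert (Hex : forall b : R, exists l : R, lo < b < hi ->
     rlim (fun a => ent_flux a b) l).
  { intros b. destruct (classic (lo < b < hi)) as [Hb|Hb]; [|exists 0; tauto].
    destruct (bounded_limit _ b (bounded_entropy g G HC) Hb) as [l Hl].
    exists l. intros _. exact Hl. }
  set (S0 := fun b => proj1_sig (constructive_indefinite_description _ (Hex b))).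
  assert (HS0 : forall b, lo < b < hi -> rlim (fun a => ent_flux a b) (S0 b)).
  { intros b. exact (proj2_sig (constructive_indefinite_description _ (Hex b))). }
  clearbody S0.
  destruct (bounded_rate _ S0 (bounded_entropy g G HC) HS0) as [M [d [HM [Hd HR]]]].
  assert (HU : unif_lim ent_flux S0) by exact (rate_unif _ _ M d HM Hd HR).
  assert (HSc : forall b, lo < b < hi -> continuous S0 b).
  { intros b Hb. apply (unif_lim_continuous ent_flux); auto.
    intros a Hab. now apply ent_flux_continuous. }
  set (F := fun b => - S0 b * A b).
  assert (HF : forall b, lo < b < hi -> entropy_quotient b (F b)).
  { intros b Hb. apply (origin_quotient _ (fun a => - ent_flux a b * d1 T a b) _ _ (eps G)).
    - exact eps_positive.
    - rewrite <- (fan_entropy b) by lra. apply (coord_limit g G HC b). lra.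
    - intros z Hz. apply entropy_alpha. split; lra.
    - apply right_lim_mult.
      + apply (filterlim_comp _ _ _ _ Ropp _ (locally (S0 b))); [now apply HS0|].
        apply (filterlim_opp (K := R_AbsRing) (V := R_NormedModule)).
      + now apply (unif_lim_at (d1 T)). }
  assert (HFd : forall b, lo < b < hi -> is_derive F b (S0 b * (A b / (2 * fan_c b)))).
  { intros b Hb. apply (derive_of_increments F A); [|exact (rate_derive b Hb)].
    intros e He.
    destruct (stieltjes_local _ ent_flux S0 F b e
      entropy_transported HU Hb (HSc b Hb)) as [r [Hr HL]]; [|assumption|].
    - intros b1 b2 Hb1 Hb12 Hb2.
      apply (quotient_diff (fun a => ent (W a b1)) (fun a => ent (W a b2)) (ent (UL G)));
        apply HF; lra.
    - set (r' := Rmin r (Rmin (b - lo) (hi - b))).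
      assert (Hr' : 0 < r' /\ r' <= r /\ r' <= b - lo /\ r' <= hi - b).
      { unfold r'. min_lra. }
      exists r'. split; [lra|]. intros z Hz. apply HL; [|lra]. abs_lra. }
  set (m := (lo + hi) / 2). set (C := F m * A m).
  assert (HFA : forall u v, lo < u -> u <= v -> v < hi -> F v * A v = F u * A u).
  { intros u v Hu Huv Hv.
    assert (HB : Rabs (F v * A v - F u * A u - 0 * (v - u)) <= 0 * (v - u)).
    { apply (mvt_bound (fun z => F z * A z) (fun _ => 0)); [assumption| |].
      - intros z Hz.
        replace 0 with (S0 z * (A z / (2 * fan_c z)) * A z + F z * (A z / (2 * fan_c z)))
          by (unfold F; ring).
        apply is_derive_Rmult; [apply HFd; lra|]. apply (rate_derive z). lra.
      - intros z _. rewrite Rminus_0_r, Rabs_R0. lra. }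
    rewrite !Rmult_0_l, Rminus_0_r in HB.
    apply Rminus_diag_uniq, Rabs_eq_0, Rle_antisym; [exact HB|apply Rabs_pos]. }
  exists S0, C. split; [exact HU|]. intros b Hb. pose proof (A_pos b ltac:(lra)).
  assert (E : F b * A b = C).
  { unfold C. destruct (Rle_dec b m) as [Hm|Hm].
    - symmetry. apply HFA; unfold m in *; lra.
    - apply HFA; unfold m in *; lra. }
  rewrite <- E. split; [unfold F; field; lra|].
  replace (F b * A b / A b) with (F b) by (field; lra). now apply HF.
Qed.

(** The constant can be read on either edge: the increment of the entropy
    between the edge and a nearby interior line is controlled by that of the
    time. *)
Lemma entropy_edge (S0 : R -> R) (C b0 q : R) :
  unif_lim ent_flux S0 ->
  (forall b, lo < b < hi -> S0 b = - C / (A b * A b) /\ entropy_quotient b (C / A b)) ->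
  lo <= b0 <= hi -> entropy_quotient b0 q -> q * A b0 = C.
Proof.
  intros HU HSC Hb0 Hq.
  destruct (cont_on_pos_min lo hi lohi A A_cont A_pos) as [m [Hm Hmb]].
  set (B := Rabs C / (m * m)).
  assert (HB0 : 0 <= B).
  { apply Rle_mult_inv_pos; [apply Rabs_pos|nra]. }
  assert (HSB : forall b, lo < b < hi -> Rabs (S0 b - 0) <= B).
  { intros b Hb. rewrite Rminus_0_r, (proj1 (HSC b Hb)). specialize (Hmb b ltac:(lra)).
    unfold Rdiv. rewrite Rabs_mult, Rabs_Ropp.
    assert (0 < m * m) by nra. assert (m * m <= A b * A b) by nra.
    rewrite (Rabs_pos_eq (/ (A b * A b))) by (left; apply Rinv_0_lt_compat; lra).
    apply Rmult_le_compat_l; [apply Rabs_pos|]. apply Rinv_le_contravar; lra. }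
  assert (Hinc : forall b1 b2 D1 D2, lo <= b1 -> b1 <= b2 -> b2 <= hi ->
    entropy_quotient b1 D1 -> entropy_quotient b2 D2 ->
    Rabs (D2 - D1) <= B * (A b2 - A b1)).
  { intros b1 b2 D1 D2 Hb1 Hb12 Hb2 L1 L2.
    replace (D2 - D1) with (D2 - D1 - 0 * (A b2 - A b1)) by ring.
    apply (stieltjes_limit _ ent_flux S0 b1 b2 0 B _ entropy_transported HU); try lra.
    - intros z Hz. apply HSB. lra.
    - exact (quotient_diff (fun a => ent (W a b1)) (fun a => ent (W a b2)) _ _ _ L1 L2). }
  assert (Hnear : forall b, lo < b < hi -> Rabs (C / A b - q) <= B * Rabs (A b - A b0)).
  { intros b Hb. pose proof (proj2 (HSC b Hb)) as Lb. destruct (Rle_dec b0 b).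
    - rewrite (Rabs_pos_eq (A b - A b0)) by (pose proof (rate_monotone b0 b); lra).
      apply Hinc; lra || assumption.
    - rewrite Rabs_minus_sym, (Rabs_minus_sym (A b)).
      rewrite (Rabs_pos_eq (A b0 - A b)) by (pose proof (rate_monotone b b0); lra).
      apply Hinc; lra || assumption. }
  assert (HCA : cont_on lo hi (fun b => C / A b)).
  { apply (cont_on_mult lo hi (fun _ => C)); [apply cont_on_const|].
    apply cont_on_inv; [|exact A_cont]. intros b Hb. pose proof (A_pos b Hb). lra. }
  assert (E : C / A b0 = q).
  { apply cond_eq. intros e He.
    destruct (small_factor 1 B (e / 2) Rlt_0_1 ltac:(lra)) as [n [Hn HnB]].
    destruct (cont_onP lo hi _ b0 (e / 2) HCA Hb0) as [r1 [Hr1 K1]]; [lra|].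
    destruct (cont_onP lo hi _ b0 n A_cont Hb0 (proj1 Hn)) as [r2 [Hr2 K2]].
    destruct (strip_near b0 (Rmin r1 r2) Hb0) as [b [Hb Hbb]]; [now apply Rmin_pos|].
    Rmin_bounds (Rmin r1 r2).
    specialize (K1 b ltac:(lra) ltac:(lra)). specialize (K2 b ltac:(lra) ltac:(lra)).
    specialize (Hnear b Hb).
    assert (HBK : B * Rabs (A b - A b0) <= n * B).
    { rewrite (Rmult_comm n). apply Rmult_le_compat_l; lra. }
    abs_lra. }
  pose proof (A_pos b0 Hb0). rewrite <- E. field. lra.
Qed.

Lemma entropy_law (qh qt : R) :
  rlim (fun t => (ent (w G (Xhead G t) t) - ent (UL G)) / t) qh ->
  rlim (fun t => (ent (w G (Xtail G t) t) - ent (UL G)) / t) qt ->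
  qh * A lo * A lo = qt * A hi * A hi /\
  unif_lim ent_flux (fun b => - (qh * A lo * A lo) / (A b * A b)).
Proof.
  intros Hqh Hqt. destruct entropy_interior as [S0 [C [HU HSC]]].
  pose proof (entropy_edge S0 C lo (qh * A lo) HU HSC ltac:(lra) (edge_alpha _ _ _ _ lo ltac:(lra)
    (fun a Ha => f_equal (fun x => ent (w G x (T a lo)))
                   (proj2 (coord_head g G HC a Ha))) Hqh)) as Eh.
  pose proof (entropy_edge S0 C hi (qt * A hi) HU HSC ltac:(lra) (edge_alpha _ _ _ _ hi ltac:(lra)
    (fun a Ha => f_equal (fun x => ent (w G x (T a hi)))
                   (proj2 (coord_tail g G HC a Ha))) Hqt)) as Et.
  split; [lra|]. rewrite Eh. intros e He.
  destruct (HU e He) as [r [Hr HH]]. exists r. split; [assumption|].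
  intros a b Hab Ha. rewrite <- (proj1 (HSC b (proj2 Hab))). now apply HH.
Qed.

Let cL := csound g (UL G).
Let sL := ent (UL G).
Let sL' := Derive (fun x => ent (initL G x)) 0.

Lemma Pi_pos (b : R) : 0 < Pi g G b.
Proof. apply exp_pos. Qed.

Lemma head_quotients (r2 v2 s2 : R) :
  germ (Dleft G) (w G) (UL G)
    (Derive (fun x => rho (initL G x)) 0) r2
    (Derive (fun x => vel (initL G x)) 0) v2
    (Derive (fun x => ent (initL G x)) 0) s2 ->
  lim_state_right (fun t => w G (Xhead G t) t) (UL G) /\
  rlim (fun t => (rho (w G (Xhead G t) t) - rho (UL G)) / t)
    (r2 + lo * Derive (fun x => rho (initL G x)) 0) /\
  rlim (fun t => (vel (w G (Xhead G t) t) - vel (UL G)) / t)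
    (v2 + lo * Derive (fun x => vel (initL G x)) 0) /\
  rlim (fun t => (ent (w G (Xhead G t) t) - ent (UL G)) / t)
    (s2 + lo * Derive (fun x => ent (initL G x)) 0).
Proof.
  intros HJ. apply (wave_edge (Dleft G) (UL G) (Xhead G) (-1)); auto.
  - exact (head_curve g G HW).
  - exact (curve_to_origin _ _ (head_origin g G HW)).
  - apply edges_room.
Qed.

Lemma tail_quotients (r1 r2 v1 v2 s1 s2 : R) :
  germ (D1 G) (w G) (U1star G) r1 r2 v1 v2 s1 s2 ->
  lim_state_right (fun t => w G (Xtail G t) t) (U1star G) /\
  rlim (fun t => (rho (w G (Xtail G t) t) - rho (U1star G)) / t) (r2 + hi * r1) /\
  rlim (fun t => (vel (w G (Xtail G t) t) - vel (U1star G)) / t) (v2 + hi * v1) /\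
  rlim (fun t => (ent (w G (Xtail G t) t) - ent (U1star G)) / t) (s2 + hi * s1).
Proof.
  intros HJ. apply (wave_edge (D1 G) (U1star G) (Xtail G) 1); auto.
  - exact (tail_curve g G HW).
  - exact (curve_to_origin _ _ (tail_origin g G HW)).
  - apply edges_room.
  - unfold U1star. rewrite fan_cE by lra. unfold fan_c. ring.
Qed.

Lemma tail_entropy : ent (U1star G) = sL.
Proof. apply fan_entropy. lra. Qed.

Lemma head_speed_eq : lo = vel (UL G) - cL.
Proof. reflexivity. Qed.

Lemma tail_speed_eq : hi = vel (U1star G) - csound g (U1star G).
Proof. unfold U1star. rewrite fan_cE by lra. unfold fan_c. ring. Qed.

Definition ent_flux0 (b : R) : R := cL * sL' / Pi g G b ^ 2.

Lemma entropy_origin (r1 r2 v1 v2 s1 s2 : R) :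
  germ (D1 G) (w G) (U1star G) r1 r2 v1 v2 s1 s2 ->
  (s2 + hi * s1) * Pi g G hi ^ 2 = - cL * sL' /\
  unif_lim ent_flux ent_flux0.
Proof.
  intros HJ. destruct left_jet as [r2l [v2l [s2l HL]]].
  destruct (head_quotients _ _ _ HL) as [_ [_ [_ Qh]]].
  destruct (tail_quotients _ _ _ _ _ _ HJ) as [_ [_ [_ Qt]]].
  pose proof (germ_euler g _ _ _ Hg _ _ _ _ _ _ HL (euler_left g G HS)) as EL.
  assert (Eh : s2l + lo * Derive (fun x => ent (initL G x)) 0 = - cL * sL').
  { pose proof (jet_entropy EL) as JS. rewrite head_speed_eq.
    fold sL' in JS |- *. lra. }
  rewrite Eh in Qh. rewrite tail_entropy in Qt. fold sL in Qh.
  destruct (entropy_law _ _ Qh Qt) as [E1 E2].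
  pose proof (A_pos lo ltac:(lra)) as Plo.
  split.
  - rewrite (rate_Pi hi) in E1 by lra.
    apply Rmult_eq_reg_l with (A lo * A lo); [|nra].
    transitivity (- cL * sL' * A lo * A lo); [|ring]. rewrite E1. ring.
  - intros e He. destruct (E2 e He) as [d [Hd H]]. exists d. split; [assumption|].
    intros a b Hab Ha. specialize (H a b Hab Ha).
    replace (ent_flux0 b) with (- (- cL * sL' * A lo * A lo) / (A b * A b)); [exact H|].
    destruct Hab as [_ Hb]. rewrite (rate_Pi b) by lra. unfold ent_flux0.
    pose proof (Pi_pos b). field. lra.
Qed.

Lemma ent_flux0_cont : cont_on lo hi ent_flux0.
Proof.
  pose proof (A_pos lo ltac:(lra)) as Plo.
  apply (cont_on_ext lo hi (fun b => cL * sL' * (A lo * A lo) * / (A b * A b))).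
  - intros b Hb. rewrite (rate_Pi b Hb).
    unfold ent_flux0. pose proof (Pi_pos b). field. lra.
  - apply (cont_on_mult lo hi (fun _ => cL * sL' * (A lo * A lo))); [apply cont_on_const|].
    apply cont_on_inv; [|apply cont_on_mult; exact A_cont].
    intros b Hb. pose proof (A_pos b Hb). nra.
Qed.

(** * The interaction relation *)

Section Potential.

Variables (Psi K : R -> R -> R).
Hypothesis HPsi : potential g Psi K.

Let kin (U : state) : R := vel U + Psi (rho U) (ent U).

(** [H] in characteristic coordinates, for an arbitrary potential. *)
Definition source (a b : R) : R :=
  csound g (W a b) * K (rho (W a b)) (ent (W a b)) * ent_x (X a b) (T a b).

(** The limit of [source] at the origin, known from [entropy_origin]. *)
Definition source0 (b : R) : R := K (rho (fan G b)) sL * ent_flux0 b.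

Lemma Psi_continuous (r s : R) : 0 < r -> continuity_2d_pt Psi r s.
Proof.
  intros Hr. apply differentiable_continuity_pt.
  exists (sound g r s / r), (K r s + / (r * sound g r s) * d2 (pr g) r s).
  now apply HPsi.
Qed.

Lemma kin_transported : transported (fun a b => kin (W a b)) source.
Proof.
  split.
  - intros a b Hab. pose proof (wave_jet a b Hab) as HJ. simpl in HJ.
    assert (HD : Dwave G (X a b) (T a b)) by now apply (coord_in g G HC).
    destruct (wave_diff _ _ HD) as [Dr [Dv [Ds _]]].
    destruct (in_box (X a b) (T a b) (or_intror (or_introl HD))) as [_ [_ Hp]].
    pose proof (sound_pos g Hg _ (ent (W a b)) Hp) as Hc.
    pose proof (beta_derive _ a b Hab Dr) as Br.
    pose proof (beta_derive _ a b Hab Dv) as Bv.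
    pose proof (beta_derive _ a b Hab Ds) as Bs.
    pose proof (is_derive_path Psi _ _ b _ _ _ _ (proj1 (HPsi _ _ Hp)) Br Bs) as BP.
    unfold kin. evar_last.
    + exact (is_derive_Rplus _ _ b _ _ Bv BP).
    + pose proof (jet_plus g _ _ _ _ _ _ _ (K (rho (W a b)) (ent (W a b))) HJ Hp Hc) as E.
      unfold source. fold (csound g (W a b)) in *.
      transitivity (csound g (W a b) * K (rho (W a b)) (ent (W a b))
        * ent_x (X a b) (T a b) * d2 T a b); [|reflexivity].
      rewrite <- E. unfold speed_plus, ent_x, csound. ring.
  - intros a b Ha Hb.
    destruct (wave_state_continuous a b Ha Hb) as [[_ [Cv _]] Hp].
    apply lim_in_plus.
    + now apply (coords_lim_in (fun x t => vel (w G x t))).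
    + apply (wave_lim_in Psi); auto. now apply Psi_continuous.
Qed.

(** The Riemann invariant of the centered wave. *)
Lemma fan_kin (b : R) : lo <= b <= hi -> kin (fan G b) = kin (UL G).
Proof.
  pose proof Hfan as HF.
  set (F := fun z => vel (fan G z) + Psi (rho (fan G z)) sL).
  intros Hb. transitivity (F b).
  { unfold kin, F, sL. now rewrite (fan_entropy b Hb). }
  transitivity (F lo).
  2:{ unfold kin, F, sL. now rewrite fan_at_head. }
  assert (Hrho : cont_on lo hi (fun z => rho (fan G z))).
  { apply cont_on_continuous. intros z Hz. apply (fan_cont _ _ _ _ HF z Hz). }
  apply (cont_on_zero_derive lo hi); [| |exact Hb].
  - apply (cont_on_2d lo hi Rplus).
    + intros z _. apply continuity_2d_pt_plus;
        [apply continuity_2d_pt_id1|apply continuity_2d_pt_id2].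
    + apply cont_on_continuous. intros z Hz. apply (fan_cont _ _ _ _ HF z Hz).
    + apply (cont_on_2d lo hi Psi (fun z => rho (fan G z)) (fun _ => sL));
        [|exact Hrho|apply cont_on_const].
      intros z Hz. apply Psi_continuous. now apply fan_rho_pos.
  - intros z Hz. destruct (fan_invariant _ _ _ _ HF z Hz) as [Dr Dv].
    assert (Hz' : lo <= z <= hi) by lra.
    pose proof (fan_rho_pos z Hz') as Hp.
    pose proof (Derive_correct _ _ Dr : is_derive (fun x => rho (fan G x)) z
      (Derive (fun x : R => rho (fan G x)) z)) as Dr'.
    pose proof (is_derive_path Psi (fun z => rho (fan G z)) (fun _ => sL) z _ _ _ 0
      (proj1 (HPsi _ _ Hp)) Dr' (is_derive_const sL z)) as DP.
    evar_last; [exact (is_derive_Rplus _ _ _ _ _ Dv DP)|].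
    unfold csound. rewrite (fan_entropy z Hz'). fold sL.
    pose proof (sound_pos g Hg _ sL Hp).
    match goal with |- @eq _ ?p ?q => change (@eq R p q) end. field. lra.
Qed.

Lemma source0_cont : cont_on lo hi source0.
Proof.
  apply (cont_on_mult lo hi).
  - apply (cont_on_2d lo hi K (fun b => rho (fan G b)) (fun _ => sL)).
    + intros b Hb. apply HPsi. now apply fan_rho_pos.
    + apply cont_on_continuous. intros b Hb.
      apply (fan_cont _ _ _ _ Hfan b Hb).
    + apply cont_on_const.
  - exact ent_flux0_cont.
Qed.

Lemma source_pointwise (b : R) : lo < b < hi ->
  unif_lim ent_flux ent_flux0 ->
  rlim (fun a => source a b) (source0 b).
Proof.
  intros Hb HU.
  apply (filterlim_ext (fun a => K (rho (W a b)) (ent (W a b)) * ent_flux a b)).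
  { intros a. unfold source, ent_flux. ring. }
  apply right_lim_mult.
  - unfold sL. rewrite <- (fan_entropy b) by lra.
    apply (wave_state_limit K b); [lra|].
    apply HPsi. apply fan_rho_pos. lra.
  - now apply unif_lim_at.
Qed.

Hypothesis source_unif : unif_lim source source0.

Variables (r1 r2 v1 v2 s1 s2 : R).
Hypothesis HJ : germ (D1 G) (w G) (U1star G) r1 r2 v1 v2 s1 s2.

Let c1 := csound g (U1star G).
Let ps := d2 (pr g) (rho (U1star G)) (ent (U1star G)).

Lemma kin_data :
  is_derive (fun x => kin (initL G x)) 0
   (Derive (fun x => vel (initL G x)) 0
    + (cL / rho (UL G) * Derive (fun x => rho (initL G x)) 0
       + (K (rho (UL G)) sL + / (rho (UL G) * cL) * d2 (pr g) (rho (UL G)) sL) * sL')).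
Proof.
  pose proof (proj1 (data_smooth g G HS) 1%nat 0) as [Er [Ev Es]].
  pose proof (rs_pos _ _ _ _ _ _ _ Hriem) as [Hp _].
  apply is_derive_Rplus; [now apply Derive_correct|].
  apply (is_derive_path Psi (fun x => rho (initL G x)) (fun x => ent (initL G x))).
  - exact (proj1 (HPsi (rho (UL G)) (ent (UL G)) Hp)).
  - now apply Derive_correct.
  - now apply Derive_correct.
Qed.

(** The quotients of psi by [alpha] at the tail and at the head differ by the
    integral of [H], by [transported_quotient]. They are rates times derivatives
    along [u - c], which [jet_material] expresses at the tail by the material
    derivatives, and [jet_minus] at the head by the data. *)
Lemma interaction :
  let psiL' := Derive (fun x => kin (initL G x)) 0 in
  aL * (v2 + vel (U1star G) * v1)
  + bL g G * (c1 * c1 * r2 + ps * s2 + vel (U1star G) * (c1 * c1 * r1 + ps * s1)) =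
  cL / 2 * K (rho (U1star G)) sL * sL' * / Pi g G hi ^ 2
  + / 2 * / Pi g G hi * (- 2 * cL * psiL' + cL * K (rho (UL G)) sL * sL')
  + / 2 * / Pi g G hi *
    RInt (fun xi => / (2 * c0 g G xi) * Pi g G xi * source0 xi) lo hi.
Proof.
  intros psiL'.
  destruct left_jet as [r2l [v2l [s2l HL]]].
  destruct (head_quotients _ _ _ HL) as [_ [Qhr [Qhv Qhs]]].
  destruct (tail_quotients _ _ _ _ _ _ HJ) as [_ [Qtr [Qtv Qts]]].
  pose proof (germ_euler g _ _ _ Hg _ _ _ _ _ _ HL (euler_left g G HS)) as EL.
  pose proof (germ_euler g _ _ _ Hg _ _ _ _ _ _ HJ (euler_mid1 g G HS)) as E1.
  pose proof (germ_pos0 HL) as HpL.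
  pose proof (germ_pos0 HJ) as Hp1.
  pose proof (sound_pos g Hg _ (ent (UL G)) HpL) as HcL.
  pose proof (sound_pos g Hg _ (ent (U1star G)) Hp1) as Hc1.
  destruct (entropy_origin _ _ _ _ _ _ HJ) as [Es _].
  assert (Hkin : forall (Y : R -> R) (U : state) (p q z : R), 0 < rho U ->
    rlim (fun t => (rho (w G (Y t) t) - rho U) / t) p ->
    rlim (fun t => (vel (w G (Y t) t) - vel U) / t) q ->
    rlim (fun t => (ent (w G (Y t) t) - ent U) / t) z ->
    rlim (fun t => (kin (w G (Y t) t) - kin U) / t)
      (q + (sound g (rho U) (ent U) / rho U * p
        + (K (rho U) (ent U) + / (rho U * sound g (rho U) (ent U))
             * d2 (pr g) (rho U) (ent U)) * z))).
  { intros Y U p q z HpU Lr Lv Ls.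
    apply (filterlim_ext (fun t => (vel (w G (Y t) t) - vel U) / t
       + (Psi (rho (w G (Y t) t)) (ent (w G (Y t) t)) - Psi (rho U) (ent U)) / t)).
    - intros t. unfold kin, Rdiv. ring.
    - apply right_lim_plus; [exact Lv|].
      apply (quotient_chain Psi (fun t => rho (w G (Y t) t)) (fun t => ent (w G (Y t) t)));
        auto. now apply HPsi. }
  pose proof (Hkin _ _ _ _ _ HpL Qhr Qhv Qhs) as Qh.
  pose proof (Hkin _ _ _ _ _ Hp1 Qtr Qtv Qts) as Qt.
  set (qh := v2l + lo * _ + _) in Qh. set (qt := v2 + hi * v1 + _) in Qt.
  pose proof (edge_alpha _ (fun a => kin (W a lo)) _ _ lo ltac:(lra)
    (fun a Ha => f_equal (fun x => kin (w G x (T a lo)))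
                   (proj2 (coord_head g G HC a Ha))) Qh) as Lh.
  pose proof (edge_alpha _ (fun a => kin (W a hi)) _ _ hi ltac:(lra)
    (fun a Ha => f_equal (fun x => kin (w G x (T a hi)))
                   (proj2 (coord_tail g G HC a Ha))) Qt) as Lt.
  pose proof (transported_quotient _ _ _
    kin_transported source_unif source0_cont) as LI.
  set (J := RInt _ lo hi) in LI |- *.
  assert (Hsame : kin (U1star G) = kin (UL G)) by (apply fan_kin; lra).
  assert (EJ : A lo * J = qt * A hi - qh * A lo).
  { apply (right_limU (fun a => (kin (W a hi) - kin (W a lo)) / a)); [exact LI|].
    rewrite Hsame in Lt. exact (quotient_diff _ _ _ _ _ Lh Lt). }
  pose proof (A_pos lo ltac:(lra)) as Plo.
  assert (Eq : qt * Pi g G hi = qh + J).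
  { apply Rmult_eq_reg_l with (A lo); [|lra].
    rewrite (rate_Pi hi) in EJ by lra. lra. }
  assert (Eqh : qh = - 2 * cL * psiL' + cL * K (rho (UL G)) sL * sL').
  { pose proof (jet_minus g _ _ _ _ _ _ _ (K (rho (UL G)) sL) EL HpL HcL) as E.
    rewrite (is_derive_unique _ _ _ kin_data : psiL' = _).
    unfold qh. rewrite head_speed_eq. unfold cL, sL', sL in *. unfold csound in *.
    rewrite <- Rplus_assoc. rewrite E. ring. }
  assert (Eqt : qt = 2 * (aL * (v2 + vel (U1star G) * v1)
      + bL g G * (c1 * c1 * r2 + ps * s2 + vel (U1star G) * (c1 * c1 * r1 + ps * s1)))
      + K (rho (U1star G)) sL * (s2 + hi * s1)).
  { pose proof (jet_material g _ _ _ _ _ _ _ (K (rho (U1star G)) sL) E1 Hp1 Hc1) as E.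
    unfold qt. rewrite tail_speed_eq. unfold c1, ps, aL, bL. rewrite tail_entropy in *.
    unfold csound in *. rewrite tail_entropy in *.
    rewrite <- Rplus_assoc. rewrite E. ring. }
  pose proof (Pi_pos hi) as HPp.
  rewrite Eqh in Eq.
  assert (Es' : s2 + hi * s1 = - cL * sL' / Pi g G hi ^ 2).
  { rewrite <- Es. field. lra. }
  rewrite Es' in Eqt.
  set (M := aL * _ + bL g G * _) in *.
  replace M with ((qt - K (rho (U1star G)) sL * (- cL * sL' / Pi g G hi ^ 2)) / 2) by lra.
  replace qt with ((- 2 * cL * psiL' + cL * K (rho (UL G)) sL * sL' + J) / Pi g G hi)
    by (rewrite <- Eq; field; lra).
  field. lra.
Qed.

End Potential.

(** * The rarefaction wave of a polytropic gas *)

Section PolytropicWave.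

Variables (gamma cv : R) (As : R -> R).
Hypothesis Hgamma : 1 < gamma.
Hypothesis Hcv : 0 < cv.
Hypothesis Hpoly : forall r s, 0 < r ->
  pr g r s = As s * Rpower r gamma /\
  en g r s = pr g r s / ((gamma - 1) * r) /\
  en g r s = cv * temp g r s.

Let kap := kappa gamma cv.
Let K := fun r s => kap * sound g r s.
Let mu2 := (gamma - 1) / (gamma + 1).
Let Hpot : potential g (fun r s => 2 * sound g r s / (gamma - 1)) K :=
  polytropic_potential g gamma cv As Hg Hgamma Hcv Hpoly.

Lemma mu2_pos : 0 < mu2.
Proof. apply Rdiv_lt_0_compat; lra. Qed.

Lemma cL_pos : 0 < cL.
Proof.
  apply sound_pos; [exact Hg|]. apply (rs_pos _ _ _ _ _ _ _ Hriem).
Qed.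

(** As [u + 2 c / (gamma - 1)] is constant across the centered wave and [u - c]
    is the slope [b], the sound speed is an affine function of [b]. *)
Lemma fan_c_affine (b : R) : lo <= b <= hi -> fan_c b = cL - mu2 * (b - lo).
Proof.
  intros Hb. pose proof (fan_kin _ K Hpot b Hb) as E.
  cbv beta in E. change (sound g (rho (fan G b)) (ent (fan G b))) with (csound g (fan G b)) in E.
  rewrite (fan_cE b Hb) in E.
  change (sound g (rho (UL G)) (ent (UL G))) with cL in E.
  assert (Ev : vel (fan G b) = fan_c b + b) by (unfold fan_c; ring).
  assert (EL : vel (UL G) = cL + lo) by (unfold cL, betaL, head_speed; ring).
  rewrite Ev, EL in E.
  apply Rmult_eq_reg_l with (1 + 2 / (gamma - 1)).
  - unfold mu2. replace ((1 + 2 / (gamma - 1)) * fan_c b)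
      with (fan_c b + b + 2 * fan_c b / (gamma - 1) - b) by (field; lra).
    rewrite E. field. lra.
  - assert (0 < 2 / (gamma - 1)) by (apply Rdiv_lt_0_compat; lra). lra.
Qed.

Let theta := c0 g G hi / cL.
Let p := 1 / (2 * mu2).
Let ratio (b : R) : R := fan_c b / cL.

Lemma ratio_pos (b : R) : lo <= b <= hi -> 0 < ratio b.
Proof.
  intros Hb. apply Rdiv_lt_0_compat; [now apply fan_c_pos|exact cL_pos].
Qed.

Lemma theta_ratio : theta = ratio hi.
Proof. unfold theta, ratio, c0. rewrite fan_cE; [reflexivity|lra]. Qed.

Lemma ratio_head : ratio lo = 1.
Proof.
  unfold ratio. rewrite fan_c_affine by lra. pose proof cL_pos. field. lra.
Qed.

(** The affine function that [ratio] is on the segment, differentiable at the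
    end points too. *)
Let aff (b : R) : R := 1 - mu2 / cL * (b - lo).

Lemma aff_ratio (b : R) : lo <= b <= hi -> aff b = ratio b.
Proof.
  intros Hb. unfold aff, ratio. rewrite fan_c_affine by assumption.
  pose proof cL_pos. field. lra.
Qed.

Lemma aff_derive (b : R) : is_derive aff b (- (mu2 / cL)).
Proof.
  unfold aff. evar_last.
  - apply is_derive_Rminus; [apply @is_derive_const|].
    apply is_derive_Rscal. apply is_derive_Rminus; [apply @is_derive_id|apply @is_derive_const].
  - unfold zero, one; simpl. unfold one; simpl. ring.
Qed.

(** [1 / (2 c)] is the derivative of [- p ln ratio], since [ratio] has the slope
    [- mu2 / cL]. *)
Lemma polytropic_Pi (b : R) : lo <= b <= hi -> Pi g G b = / Rpower (ratio b) p.
Proof.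
  intros Hb. pose proof cL_pos as HcL. pose proof mu2_pos as Hmu.
  unfold Pi. rewrite <- Rpower_Ropp. unfold Rpower. f_equal.
  apply (is_RInt_unique (V := CR)).
  apply (is_RInt_ext (fun z => (- p * (/ aff z * - (mu2 / cL))))).
  { intros z Hz. rewrite Rmin_left, Rmax_right in Hz by lra.
    unfold c0. rewrite fan_cE by lra. rewrite aff_ratio by lra.
    pose proof (fan_c_pos z ltac:(lra)).
    unfold ratio, p. match goal with |- @eq _ ?x ?y => change (@eq R x y) end.
    field. lra. }
  replace (- p * ln (ratio b)) with (- p * ln (aff b) - - p * ln (aff lo)).
  2:{ rewrite !aff_ratio by lra. rewrite ratio_head, ln_1. ring. }
  assert (Hpos : forall z, Rmin lo b <= z <= Rmax lo b -> 0 < aff z).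
  { intros z Hz. rewrite Rmin_left, Rmax_right in Hz by lra.
    rewrite aff_ratio by lra. apply ratio_pos. lra. }
  apply (is_RInt_derive (V := CR) (fun z => - p * ln (aff z))).
  - intros z Hz. apply is_derive_Rscal. specialize (Hpos z Hz).
    evar_last.
    + apply (is_derive_comp ln aff); [|apply aff_derive].
      apply is_derive_Reals, derivable_pt_lim_ln, Hpos.
    + unfold scal; simpl; unfold mult; simpl. ring.
  - intros z Hz. specialize (Hpos z Hz).
    apply (ex_derive_continuous (fun z => - p * (/ aff z * - (mu2 / cL)))).
    eexists. apply is_derive_Rscal. apply is_derive_Rmult; [|apply @is_derive_const].
    apply (is_derive_inv aff); [apply aff_derive|lra].
Qed.

(** Up to a constant factor, the integral of [Pi H / (2 c)], as [H] is
    proportional to [c / Pi^2]. *)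
Lemma ratio_integral :
  is_RInt (fun z => / 2 * Rpower (ratio z) p) lo hi
    (cL / (1 + 2 * mu2) * (1 - Rpower theta p * theta)).
Proof.
  pose proof cL_pos as HcL. pose proof mu2_pos as Hmu.
  assert (Hp1 : 0 < p + 1).
  { assert (0 < p) by (unfold p; apply Rdiv_lt_0_compat; lra). lra. }
  assert (Hpos : forall z, Rmin lo hi <= z <= Rmax lo hi -> 0 < aff z).
  { intros z Hz. rewrite Rmin_left, Rmax_right in Hz by lra.
    rewrite aff_ratio by lra. now apply ratio_pos. }
  apply (is_RInt_ext (fun z => - (cL / (1 + 2 * mu2)) *
     ((p + 1) * Rpower (aff z) (p + 1 - 1) * - (mu2 / cL)))).
  { intros z Hz. rewrite Rmin_left, Rmax_right in Hz by lra.
    rewrite aff_ratio by lra. replace (p + 1 - 1) with p by ring.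
    match goal with |- @eq _ ?x ?y => change (@eq R x y) end.
    unfold p at 1. field. lra. }
  replace (cL / (1 + 2 * mu2) * (1 - Rpower theta p * theta)) with
    (- (cL / (1 + 2 * mu2)) * Rpower (aff hi) (p + 1)
     - - (cL / (1 + 2 * mu2)) * Rpower (aff lo) (p + 1)).
  2:{ rewrite !aff_ratio by lra. rewrite ratio_head, theta_ratio, Rpower_plus.
      rewrite (Rpower_1 (ratio hi)) by (apply ratio_pos; lra).
      replace (Rpower 1 (p + 1)) with 1
        by (unfold Rpower; now rewrite ln_1, Rmult_0_r, exp_0). ring. }
  apply (is_RInt_derive (V := CR)
    (fun z => - (cL / (1 + 2 * mu2)) * Rpower (aff z) (p + 1))).
  - intros z Hz. apply is_derive_Rscal. specialize (Hpos z Hz). evar_last.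
    + apply (is_derive_comp (fun y => Rpower y (p + 1)) aff); [|apply aff_derive].
      apply is_derive_Reals, derivable_pt_lim_power, Hpos.
    + unfold scal; simpl; unfold mult; simpl. ring.
  - intros z Hz. specialize (Hpos z Hz).
    apply (ex_derive_continuous (fun z => - (cL / (1 + 2 * mu2)) *
     ((p + 1) * Rpower (aff z) (p + 1 - 1) * - (mu2 / cL)))).
    eexists. apply is_derive_Rscal. apply is_derive_Rmult; [|apply @is_derive_const].
    apply is_derive_Rscal.
    apply (is_derive_comp (fun y => Rpower y (p + 1 - 1)) aff); [|apply aff_derive].
    apply is_derive_Reals, derivable_pt_lim_power, Hpos.
Qed.

Lemma unif_lim_mult (f h : R -> R -> R) (f0 h0 : R -> R) :
  unif_lim f f0 -> unif_lim h h0 -> cont_on lo hi f0 -> cont_on lo hi h0 ->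
  unif_lim (fun a b => f a b * h a b) (fun b => f0 b * h0 b).
Proof.
  intros Hf Hh Cf Ch e He.
  destruct (cont_on_bounded lo hi lohi f0 Cf) as [M [HM HMb]].
  destruct (cont_on_bounded lo hi lohi h0 Ch) as [N [HN HNb]].
  destruct (small_factor 1 (M + N + 1) e Rlt_0_1 He) as [n [Hn HnK]].
  destruct (Hf n (proj1 Hn)) as [d [Hd H]]. destruct (Hh n (proj1 Hn)) as [d' [Hd' H']].
  exists (Rmin d d'). split; [now apply Rmin_pos|]. intros a b Hab Ha.
  Rmin_bounds (Rmin d d').
  specialize (H a b Hab ltac:(lra)). specialize (H' a b Hab ltac:(lra)).
  destruct Hab as [_ Hb]. specialize (HMb b ltac:(lra)). specialize (HNb b ltac:(lra)).
  replace (f a b * h a b - f0 b * h0 b) with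
    (f0 b * (h a b - h0 b) + (f a b - f0 b) * (h0 b + (h a b - h0 b))) by ring.
  apply Rle_lt_trans with (2 := HnK).
  apply Rle_trans with (1 := Rabs_triang _ _). rewrite !Rabs_mult.
  assert (Q1 : Rabs (f0 b) * Rabs (h a b - h0 b) <= M * n).
  { apply Rmult_le_compat; try apply Rabs_pos; lra. }
  assert (Q2 : Rabs (f a b - f0 b) * Rabs (h0 b + (h a b - h0 b)) <= n * (N + 1)).
  { apply Rmult_le_compat; try apply Rabs_pos; [lra|].
    apply Rle_trans with (1 := Rabs_triang _ _). lra. }
  lra.
Qed.

Lemma sound_unif : unif_lim (fun a b => csound g (w G (xab G a b) (tab G a b))) fan_c.
Proof.
  destruct speed_rates as [M [d [HM [Hd H]]]].
  apply (rate_unif _ _ M d HM Hd). intros a b Hab Ha.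
  destruct (H a b Hab Ha) as [H1 H2].
  unfold speed_minus, speed_plus in *.
  abs_lra.
Qed.

(** [H] is the product of [K = kappa c] and [c s_x], which both converge
    uniformly. *)
Lemma polytropic_source :
  unif_lim ent_flux ent_flux0 -> cont_on lo hi ent_flux0 ->
  unif_lim (source K) (source0 K).
Proof.
  intros HU HCf e He.
  assert (H1 : unif_lim (fun a b => kap * csound g (w G (xab G a b) (tab G a b)))
                 (fun b => kap * fan_c b)).
  { apply (unif_lim_mult (fun _ _ => kap) _ (fun _ => kap)).
    - intros e' He'. exists 1. split; [lra|]. intros. rewrite Rminus_diag, Rabs_R0. lra.
    - exact sound_unif.
    - apply cont_on_const.
    - exact fan_c_cont. }
  destruct (unif_lim_mult _ _ _ _ H1 HU) with (e := e) as [d [Hd H]]; auto.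
  { apply (cont_on_mult lo hi (fun _ => kap)); [apply cont_on_const|].
    exact fan_c_cont. }
  exists d. split; [assumption|]. intros a b Hab Ha. specialize (H a b Hab Ha).
  unfold source, source0, K, ent_flux in *.
  destruct Hab as [_ Hb].
  unfold sL. rewrite <- (fan_entropy b) by lra.
  change (sound g (rho (fan G b)) (ent (fan G b))) with (csound g (fan G b)).
  rewrite fan_cE by lra.
  replace (csound g (w G (xab G a b) (tab G a b)) *
    (kap * sound g (rho (w G (xab G a b) (tab G a b))) (ent (w G (xab G a b) (tab G a b)))) *
    ent_x (xab G a b) (tab G a b)) with
   (kap * csound g (w G (xab G a b) (tab G a b)) *
    (csound g (w G (xab G a b) (tab G a b)) * ent_x (xab G a b) (tab G a b)))
   by (unfold csound; ring).
  exact H.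
Qed.

Lemma polytropic_dL (l : R) :
  l = cL / 2 * K (rho (U1star G)) sL * Derive (fun x => ent (initL G x)) 0 * / Pi g G hi ^ 2
  + / 2 * / Pi g G hi * (- 2 * cL * Derive (fun x => psi_poly g gamma (initL G x)) 0
     + cL * K (rho (UL G)) sL * Derive (fun x => ent (initL G x)) 0)
  + / 2 * / Pi g G hi *
    RInt (fun xi => / (2 * c0 g G xi) * Pi g G xi * source0 K xi) lo hi ->
  l = dL_polytropic g G gamma.
Proof.
  intros ->. pose proof cL_pos as HcL. pose proof mu2_pos as Hmu.
  set (psi' := Derive (fun x => psi_poly g gamma (initL G x)) 0).
  assert (Hth : 0 < theta) by (rewrite theta_ratio; apply ratio_pos; lra).
  set (P := Rpower theta p).
  assert (HP : 0 < P) by apply exp_pos.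
  assert (EPi : Pi g G hi = / P).
  { rewrite polytropic_Pi by lra. now rewrite <- theta_ratio. }
  assert (EI : RInt (fun xi => / (2 * c0 g G xi) * Pi g G xi * source0 K xi) lo hi
     = kap * cL * sL' * (cL / (1 + 2 * mu2) * (1 - P * theta))).
  { apply (is_RInt_unique (V := CR)).
    apply (is_RInt_ext (fun z => scal (kap * cL * sL') (/ 2 * Rpower (ratio z) p))).
    - intros z Hz. rewrite Rmin_left, Rmax_right in Hz by lra.
      unfold source0, ent_flux0, K, c0, sL. rewrite <- (fan_entropy z) by lra.
      change (sound g (rho (fan G z)) (ent (fan G z))) with (csound g (fan G z)).
      rewrite fan_cE by lra. rewrite polytropic_Pi by lra.
      pose proof (fan_c_pos z ltac:(lra)).
      assert (0 < Rpower (ratio z) p) by apply exp_pos.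
      unfold scal; simpl; unfold mult; simpl. field. lra.
    - apply (is_RInt_scal (V := CR)). exact ratio_integral. }
  rewrite EI, EPi.
  assert (ET : temp g (rho (UL G)) (ent (UL G)) = kap * (cL * cL)).
  { destruct (polytropic_sound g gamma cv As Hg Hgamma Hcv Hpoly (rho (UL G)) (ent (UL G)))
      as [_ [_ [E _]]]; [|exact E].
    apply (rs_pos _ _ _ _ _ _ _ Hriem). }
  assert (EK : K (rho (U1star G)) sL = kap * (theta * cL)).
  { unfold K, theta, c0, U1star. unfold sL. rewrite <- (fan_entropy hi) by lra.
    unfold csound at 1. field. lra. }
  assert (EKL : K (rho (UL G)) sL = kap * cL) by reflexivity.
  unfold dL_polytropic. fold cL sL' psi' theta mu2. fold p.
  rewrite ET, EK, EKL.
  replace ((1 + mu2) / mu2) with (p + p + 1) by (unfold p; field; lra).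
  rewrite !Rpower_plus, Rpower_1 by assumption. fold P.
  field. lra.
Qed.

End PolytropicWave.

End Solution.

(** * The two forms of the coefficient *)

Theorem proposition3p5 (g : eos) (G : grp) (Hg : eos_ok g)
    (HG : grp_solution g G) :
  exists Du Dp : R,
    axis_limit (material G (fun x t => vel (w G x t))) Du /\
    axis_limit (material G (fun x t => pressure g (w G x t))) Dp /\
    (forall (b : lower_limit) (H0 : R -> R),
       admissible g b ->
       alpha_derivative_bounded g G (Hfun g G b) ->
       is_H_origin g G b H0 ->
       aL * Du + bL g G * Dp = dL_generic g G b H0) /\
    (forall gamma : R,
       1 < gamma ->
       polytropic g gamma ->
       aL * Du + bL g G * Dp = dL_polytropic g G gamma).
Proof.
  destruct (mid1_germ g G Hg HG) as [r1 [r2 [v1 [v2 [s1 [s2 H1]]]]]].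
  destruct (mid2_germ g G Hg HG) as [r1' [r2' [v1' [v2' [s1' [s2' H2]]]]]].
  pose proof (axis_velocity g G Hg HG _ _ _ _ _ _ _ _ _ _ _ _ H1 H2) as Lv.
  pose proof (axis_pressure g G Hg HG _ _ _ _ _ _ _ _ _ _ _ _ H1 H2) as Lp.
  eexists. eexists. split; [exact Lv|]. split; [exact Lp|].
  pose proof (proj2 (entropy_origin g G Hg HG _ _ _ _ _ _ H1)) as HU.
  pose proof (beta_order g G HG) as lohi.
  split.
  - intros b H0 Hb HHb HH0.
    pose proof (generic_potential g b Hg Hb) as HP.
    assert (HE : forall xi, betaL g G < xi < bstar G -> H0 xi = source0 g G (Kfun g b) xi).
    { intros xi Hxi. apply (right_limU _ _ _ (HH0 xi Hxi)).
      exact (source_pointwise g G HG _ _ HP xi Hxi HU). }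
    destruct (bounded_rate g G _ H0 HHb HH0) as [M [d [HM [Hd HR]]]].
    assert (HS : unif_lim g G (source g G (Kfun g b)) (source0 g G (Kfun g b))).
    { intros e He. destruct (rate_unif g G _ _ M d HM Hd HR e He) as [d' [Hd' H]].
      exists d'. split; [assumption|]. intros a xi Hab Ha. rewrite <- HE by apply Hab.
      exact (H a xi Hab Ha). }
    pose proof (interaction g G Hg HG _ _ HP HS _ _ _ _ _ _ H1) as E. cbv zeta in E.
    rewrite E. unfold dL_generic. cbv zeta. f_equal. f_equal.
    apply RInt_ext. intros z Hz. rewrite Rmin_left, Rmax_right in Hz by lra.
    rewrite HE by assumption. reflexivity.
  - intros gamma Hgamma [A [cv [Hcv Hpoly]]].
    pose proof (polytropic_potential g gamma cv A Hg Hgamma Hcv Hpoly) as HP.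
    assert (HS : unif_lim g G (source g G (fun r s => kappa gamma cv * sound g r s))
                  (source0 g G (fun r s => kappa gamma cv * sound g r s))).
    { apply (polytropic_source g G Hg HG gamma cv); auto.
      exact (ent_flux0_cont g G Hg HG). }
    pose proof (interaction g G Hg HG _ _ HP HS _ _ _ _ _ _ H1) as E. cbv zeta in E.
    exact (polytropic_dL g G Hg HG gamma cv A Hgamma Hcv Hpoly _ E).
Qed.
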